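(* Let $q$ be an odd prime power with $q \notin \{5,7,11,13,31,41\}$. Then for every $\theta \in \mathbb{F}_{q^2}$ with $\mathbb{F}_{q^2} = \mathbb{F}_q(\theta)$ there exists $x \in \mathbb{F}_q$ such that $\theta + x$ is $2$-primitive, i.e. the extension $\mathbb{F}_{q^2}/\mathbb{F}_q$ possesses the translate property for $2$-primitive elements. In particular, the least integer $T$ such that $\mathbb{F}_{q^2}/\mathbb{F}_q$ possesses the translate property for $2$-primitive elements for every odd prime power $q > T$ is $T = 41$.
   Context: For a prime power $q$ and integers $n,r$ with $r \mid q^n-1$, an element of $\mathbb{F}_{q^n}^*$ is called $r$-primitive if its multiplicative order is $(q^n-1)/r$. An element $\theta$ with $\mathbb{F}_{q^n}=\mathbb{F}_q(\theta)$ is a generator of the extension, and $\{\theta+x : x \in \mathbb{F}_q\}$ is its set of translates. The extension $\mathbb{F}_{q^n}/\mathbb{F}_q$ possesses the translate property for $r$-primitive elements if every set of translates of every generator contains an $r$-primitive element. *)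

(* Defs.v *)
From HB Require Import structures.
From mathcomp Require Import all_boot all_order all_algebra all_fingroup all_solvable all_field.

Set Implicit Arguments.
Unset Strict Implicit.
Unset Printing Implicit Defensive.

Import GRing.Theory.
Local Open Scope ring_scope.

Definition prime_power (q : nat) : Prop :=
  exists p k : nat, [/\ prime p, (0 < k)%N & q = (p ^ k)%N].

Section TranslateProperty.

Variables (F : finFieldType) (L : fieldExtType F).

(* [1%VS] is the base field F inside L. *)
Definition generator (theta : L) : Prop := <<1; theta>>%VS = {:L}%VS.

(* With q = #|F| and n = [L : F], [m.-primitive_root y] says that the
   multiplicative order of y is m; in particular y != 0. *)
Definition r_primitive (r : nat) (y : L) : Prop :=
  (r %| #|F| ^ \dim {:L} - 1)%N /\
  ((#|F| ^ \dim {:L} - 1) %/ r)%N.-primitive_root y.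

Definition translate_property (r : nat) : Prop :=
  forall theta : L, generator theta ->
    exists x : F, r_primitive r (theta + x%:A).

End TranslateProperty.

(* The fields of orders q and q ^ n are unique up to isomorphism, so "the
   extension F_(q^n) / F_q" is rendered by quantifying over all its models
   (which exist whenever q is a prime power and 0 < n). *)
Definition translate_property_Fq (q n r : nat) : Prop :=
  forall (F : finFieldType) (L : fieldExtType F),
    #|F| = q -> \dim {:L} = n -> translate_property L r.

Definition is_least_int (P : int -> Prop) (T : int) : Prop :=
  P T /\ forall T' : int, P T' -> T <= T'.

(* Main.v *)
(** Fix a generator g of the cyclic group of F_(q^2) and write theta + x = g ^ a(x) for x in F_q.
    Distinct pairs (x, y) give distinct quotients (theta + x) / (theta + y), none of them in F_q,
    so {a(x)} is a Bose difference set in Z/(q^2-1) relative to the multiples of q + 1.  Counting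
    collisions modulo m therefore bounds the variance of a(x) mod m by q, and the Cauchy-Schwarz
    inequality replaces the usual character sum estimates.  Since theta + x is 2-primitive exactly
    when gcd (a(x), q^2 - 1) = 2, a sieve over the odd primes dividing q^2 - 1 gives the result
    unless q is small: with the prime 3 in the core it succeeds for q >= 34700 when q^2 - 1 has at
    most 17 odd prime divisors, and with the smallest third of the primes in the core otherwise.

    Below 34700 the sieve inequality is evaluated for every prime power; it fails for 328 of them.
    Apart from the six exceptions these are settled by certificates.  With g the class of X in
    F_p[X]/(mu), sets of translates correspond to the values theta^q - theta = g^m with
    m = (q+1)/2 mod q+1.  If g^(qj) - g^j = g^h then g^(m-h) lies in F_q, so g^(m-h+j) is a
    translate of theta; a handful of pairs (j, h) suffices to make gcd (m-h+j, q^2-1) = 2 for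
    every m.  For q = 41 no translate of a square root of 14 is 2-primitive. *)

Require Import Defs.
From Stdlib Require Import PArith NArith Lia.
From HB Require Import structures.
From mathcomp Require Import all_boot all_order all_algebra all_fingroup all_solvable all_field.
From mathcomp Require Import ring lra zify.
Import Order.TTheory GRing.Theory Num.Theory.
Local Open Scope ring_scope.
Set Implicit Arguments.
Unset Strict Implicit.
Unset Printing Implicit Defensive.

(** * Collisions in a Bose family and the sieve *)

(** The sieve condition has the shape [q * totient k * delta ^ 2 > (4 * k) ^ 2 * (s + delta) ^ 2],
    where [s] primes are sieved and [delta] is 1 minus the sum of their reciprocals. Moving a prime
    l into the core [k] multiplies the required [q] by about l, while sieving it takes 1/l from
    [delta]. So only the smallest primes belong in the core, and when [q ^ 2 - 1] has many prime
    divisors its own size pays for a large core. All errors are multiples of the square root of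
    [q * totient k]; to stay in [rat], each estimate is kept as a bound on a square.

    The statement concerns every model of the two fields, whereas a certificate computes with
    polynomials modulo [mu], whose irreducibility is not tested. What is transferred to a given [L]
    is a root of [mu] in [L]: equalities modulo [mu] hold at this root, and an inequality is
    certified by exhibiting an inverse of the difference. *)

Lemma size_filter_dvdn (g j : nat) : (0 < g)%N ->
  size [seq d <- iota 0 (g * j) | g %| d]%N = j.
Proof.
move=> g0; rewrite -[RHS](size_iota 0) -[RHS](size_map (muln g)).
apply/perm_size/uniq_perm; first by rewrite filter_uniq ?iota_uniq.
  by rewrite map_inj_uniq ?iota_uniq // => x y /eqP; rewrite eqn_pmul2l // => /eqP.
move=> d; rewrite mem_filter mem_iota; apply/andP/mapP.
  case=> /dvdnP[e ->]; rewrite mulnC add0n leq0n /= ltn_pmul2l // => ej.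
  by exists e; rewrite ?mem_iota //= add0n.
by case=> e; rewrite mem_iota => /andP[_ ej] ->; rewrite dvdn_mulr // ltn_pmul2l.
Qed.

(** Cauchy-Schwarz without square roots: the squares of [A * g i - B * f i] add up to
    [A * (A * C - B ^ 2)]. *)
Lemma sum_mulr_sqr_le (R : realFieldType) (I : finType) (f g : I -> R) :
  (\sum_i f i * g i) ^+ 2 <= (\sum_i f i ^+ 2) * \sum_i g i ^+ 2.
Proof.
set A := \sum_i f i ^+ 2; set B := \sum_i _; set C := \sum_i g i ^+ 2.
have A_ge0 : 0 <= A by apply: sumr_ge0 => i _; apply: sqr_ge0.
have [A0|A_neq0] := eqVneq A 0.
  suff -> : B = 0 by rewrite A0 mul0r expr0n.
  apply: big1 => i _; move/eqP: A0.
  rewrite psumr_eq0 => [/allP/(_ i (mem_index_enum i))|j _]; last exact: sqr_ge0.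
  by rewrite /= sqrf_eq0 => /eqP ->; rewrite mul0r.
have A_gt0 : 0 < A by rewrite lt_def A_neq0.
have : 0 <= \sum_i (A * g i - B * f i) ^+ 2 by apply: sumr_ge0 => i _; apply: sqr_ge0.
have -> : \sum_i (A * g i - B * f i) ^+ 2 = A * (A * C - B ^+ 2).
  transitivity (\sum_i (A ^+ 2 * g i ^+ 2 + ((- 2 * A * B) * (f i * g i) + B ^+ 2 * f i ^+ 2))).
    by apply: eq_bigr => i _; ring.
  by rewrite !big_split /= -!mulr_sumr -/A -/B -/C; ring.
by rewrite pmulr_rge0 // subr_ge0.
Qed.

(* [a] enumerates a relative difference set of Bose type in [Z/(q^2-1)Z],
   relative to the subgroup of multiples of [q+1]. *)
Definition bose_family (I : finType) (a : I -> nat) : Prop :=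
  let q := #|I| in
  (forall x y x' y', x != y -> x' != y' ->
     a x + a y' = a x' + a y %[mod q ^ 2 - 1] -> x = x' /\ y = y')%N /\
  (forall x y, a x = a y %[mod q + 1] -> x = y)%N.

Section BoseFamily.
Variables (I : finType) (a : I -> nat).
Let q := #|I|.
Let n := (q ^ 2 - 1)%N.
Hypotheses (q_gt1 : (1 < q)%N) (Ha : bose_family a).

Let n_fact : n = ((q + 1) * (q - 1))%N.
Proof. by rewrite /n -[1%N in LHS](exp1n 2) subn_sqr mulnC. Qed.

Let n_gt0 : (0 < n)%N.
Proof. by rewrite n_fact muln_gt0 addn1 /= subn_gt0. Qed.

(** The differences [a x - a y] with [x != y] are distinct modulo [n] and avoid the multiples of
    [q + 1]. Those divisible by [m] thus lie among the [n / m] multiples of [m], outside the [n / g]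
    multiples of [g = lcm(m, q + 1)]. Since [g <= m * (q + 1)], the latter number at least
    [(q - 1) / m], which leaves at most [(n - (q - 1)) / m = q * (q - 1) / m]. *)
Lemma card_bose_collisions (m : nat) : (m %| n)%N ->
  (#|[set p : I * I | (p.1 != p.2) && (a p.1 == a p.2 %[mod m])]| * m <= q * (q - 1))%N.
Proof.
case: Ha => inj_a rel_a m_n.
have m_gt0 : (0 < m)%N by apply: dvdn_gt0 m_n.
set A := [set p | _].
(* [D p] is [a p.1 - a p.2] modulo [n], arranged so that no subtraction is truncated. *)
pose D (p : I * I) := ((a p.1 + (n - a p.2 %% n)) %% n)%N.
have D_add p : (D p + a p.2 = a p.1 %[mod n])%N.
  rewrite /D modnDml -addnA -[LHS]modnDmr -[X in (_ + X)%N](modnDmr _ (a p.2)).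
  by rewrite subnK ?modnn ?addn0 // ltnW // ltn_mod.
have uniqD : uniq (map D (enum A)).
  rewrite map_inj_in_uniq ?enum_uniq // => -[x y] [x' y'].
  rewrite !mem_enum !inE /= => /andP[nxy _] /andP[nxy' _] eqD.
  have /(_ _ _ _ _ nxy nxy')[|-> -> //] := inj_a.
  have /= e1 := D_add (x, y); have /= e2 := D_add (x', y').
  by rewrite -/q -/n -(modnDml (a x)) -(modnDml (a x')) -e1 -e2 !modnDml eqD addnAC.
pose g := lcmn m (q + 1).
have g_n : (g %| n)%N by rewrite dvdn_lcm m_n n_fact dvdn_mulr.
have g_gt0 : (0 < g)%N by apply: dvdn_gt0 g_n.
have sizeE h : (h %| n)%N -> size [seq d <- iota 0 n | h %| d]%N = (n %/ h)%N.
  move=> hn; rewrite -[in iota _ _](divnK hn) mulnC size_filter_dvdn //.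
  exact: dvdn_gt0 hn.
have leA : (#|A| + n %/ g <= n %/ m)%N.
  rewrite cardE -(size_map D) -!sizeE // -size_cat.
  apply: uniq_leq_size.
    rewrite cat_uniq uniqD filter_uniq ?iota_uniq // andbT.
    apply/hasPn => d; rewrite mem_filter => /andP[g_d _].
    apply/negP => /mapP[[x y]]; rewrite mem_enum inE /= => /andP[/eqP nxy _] eqd.
    apply/nxy/rel_a.
    have q1_n : (q + 1 %| n)%N by rewrite n_fact dvdn_mulr.
    have /(congr1 (modn^~ (q + 1)%N)) := D_add (x, y).
    rewrite /= !modn_dvdm // -eqd => <-.
    by rewrite -modnDml (eqP (dvdn_trans (dvdn_lcmr m _) g_d)).
  move=> d; rewrite mem_cat !mem_filter !mem_iota !add0n !leq0n /= => /orP[].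
    case/mapP=> [[x y]]; rewrite mem_enum inE /= => /andP[_ /eqP eqm] ->.
    rewrite [in X in _ && X]/D ltn_mod n_gt0 andbT.
    have /(congr1 (modn^~ m)) := D_add (x, y).
    by rewrite /= !modn_dvdm // eqm -{2}[a y]add0n => /eqP; rewrite eqn_modDr mod0n.
  case/andP=> g_d ->.
  by rewrite (dvdn_trans (dvdn_lcml _ _) g_d).
have leg : (q - 1 <= m * (n %/ g))%N.
  have g_le : (g <= m * (q + 1))%N.
    apply: dvdn_leq; first by rewrite muln_gt0 m_gt0 addn1.
    by rewrite dvdn_lcm dvdn_mulr //= dvdn_mull.
  have := leq_mul (leqnn (n %/ g)%N) g_le; rewrite (divnK g_n) {1}n_fact.
  by rewrite mulnC mulnA leq_pmul2r ?addn1 // mulnC.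
have := leq_mul leA (leqnn m); rewrite (divnK m_n).
by rewrite mulnDl; nia.
Qed.

(** As [f] has sum 0, each class count [N c] may be replaced by its deviation from the mean [q / M],
    and Cauchy-Schwarz leaves the variance of the counts. The latter is the number of ordered pairs
    in a common class, the [q] diagonal ones included, minus [q ^ 2 / M]; by the collision bound it
    is at most [q - q / M]. *)
Lemma bose_second_moment (M : nat) (f : 'I_M -> rat) :
  (M %| n)%N -> forall r : I -> 'I_M, (forall x, val (r x) = a x %% M)%N ->
  \sum_c f c = 0 -> (\sum_x f (r x)) ^+ 2 <= q%:R * \sum_c f c ^+ 2.
Proof.
move=> M_n r rE f0.
have M_gt0 : (0 < M)%N by apply: dvdn_gt0 M_n.
have MR_gt0 : 0 < M%:R :> rat by rewrite ltr0n.
pose N c : rat := (\sum_x (r x == c))%N%:R.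
have NE c : N c = \sum_x (r x == c)%:R by rewrite /N natr_sum.
have sum_fr (g : 'I_M -> rat) : \sum_x g (r x) = \sum_c g c * N c.
  under [RHS]eq_bigr do rewrite NE mulr_sumr.
  rewrite exchange_big; apply: eq_bigr => x _ /=.
  rewrite (bigD1 (r x)) //= eqxx mulr1 big1 ?addr0 // => c.
  by rewrite eq_sym => /negPf ->; rewrite mulr0.
have sumN : \sum_c N c = q%:R.
  have := sum_fr (fun=> 1); rewrite sumr_const -/q.
  by under [in RHS]eq_bigr do rewrite mul1r; move=> <-.
have sumN2 : \sum_c N c ^+ 2 = (q + #|[set p : I * I | (p.1 != p.2) && (a p.1 == a p.2 %[mod M])]|)%:R.
  under eq_bigr do rewrite expr2.
  rewrite -sum_fr; under eq_bigr do rewrite NE.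
  set A := [set p | _].
  have -> : (q + #|A|)%:R = \sum_x (1 + \sum_y ((x != y) && (a x == a y %[mod M]))%:R) :> rat.
    rewrite big_split /= sumr_const natrD; congr (_ + _).
    rewrite pair_big /= -sum1_card big_mkcond natr_sum; apply: eq_bigr => p _ /=.
    by rewrite inE; case: ifP.
  apply: eq_bigr => x _ /=.
  rewrite (bigD1 x) //= [in RHS](bigD1 x) //= !eqxx /= add0r; congr (_ + _).
  apply: eq_bigr => y nyx; rewrite [x == y]eq_sym nyx /= -!rE val_eqE.
  by rewrite [r x == _]eq_sym.
have leN2 : \sum_c N c ^+ 2 <= q%:R + (q * (q - 1))%:R / M%:R.
  rewrite sumN2 natrD lerD2l ler_pdivlMr // -natrM ler_nat.
  exact: card_bose_collisions.
have var_le : \sum_c (N c - q%:R / M%:R) ^+ 2 <= q%:R.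
  have -> : \sum_c (N c - q%:R / M%:R) ^+ 2 = \sum_c N c ^+ 2 - q%:R ^+ 2 / M%:R.
    transitivity (\sum_c (N c ^+ 2 + (- 2 * (q%:R / M%:R) * N c + (q%:R / M%:R) ^+ 2))).
      by apply: eq_bigr => c _; ring.
    rewrite !big_split /= -mulr_sumr sumN sumr_const card_ord -mulr_natr.
    by field; rewrite gt_eqF.
  have q1 : 1 <= q%:R :> rat by rewrite ler1n ltnW.
  rewrite lerBlDr (le_trans leN2) // lerD2l ler_pM2r ?invr_gt0 //.
  by rewrite -natrX ler_nat; nia.
have -> : \sum_x f (r x) = \sum_c f c * (N c - q%:R / M%:R).
  rewrite sum_fr; under [RHS]eq_bigr do rewrite mulrBr.
  by rewrite big_split /= sumrN -mulr_suml f0 mul0r oppr0 addr0.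
apply: le_trans (sum_mulr_sqr_le _ _) _.
by rewrite mulrC ler_wpM2r // sumr_ge0 // => c _; apply: sqr_ge0.
Qed.

End BoseFamily.

(** * Residue counts and the weighted sieve *)

Lemma sum_gcdn4_eq2 (k : nat) : odd k ->
  (\sum_(0 <= c < 4 * k) (gcdn c (4 * k) == 2) = totient k)%N.
Proof.
(* Numbers are grouped in pairs [2 * c], [2 * c + 1]. Only the even member can have gcd 2 with
   [4 * k], and it does exactly when [c] is coprime to [2 * k]; moreover
   [totient (2 * k) = totient k]. *)
move=> k_odd; have -> : (4 * k = (2 * k) * 2)%N by lia.
rewrite big_nat_mul /=.
transitivity (\sum_(0 <= c < 2 * k) coprime (2 * k) c)%N; last first.
  by rewrite -totient_count_coprime totient_coprime ?coprime2n // mul1n.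
apply: eq_bigr => c _; rewrite mulSn addnC addn2 big_nat_recl ?leqnSn //.
rewrite big_nat1 -muln_gcdl; set u := gcdn _ _; set v := gcdn _ _.
have -> : (v == 2) = false.
  apply/negP => /eqP v2; have : (2 %| v)%N by rewrite v2.
  by rewrite /v dvdn_gcd => /andP[]; rewrite dvdn2 /= oddM andbF.
by rewrite addn0 coprime_sym /coprime; congr nat_of_bool; lia.
Qed.

Lemma sum_gcdn_periodic (M l e : nat) :
  (\sum_(0 <= c < M * l) (gcdn c M == e) = l * \sum_(0 <= c < M) (gcdn c M == e))%N.
Proof.
rewrite mulnC big_nat_mul (eq_big_nat _ _ (F2 := fun=> \sum_(0 <= c < M) (gcdn c M == e)))%N.
  by rewrite sum_nat_const_nat subn0.
move=> j _; rewrite -{1}[(j * M)%N]add0n big_addn mulSn addnK.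
by apply: eq_bigr => c _; rewrite addnC gcdnC gcdnMDl gcdnC.
Qed.

(** Each block of [l] consecutive numbers holds one multiple [j * l] of [l], and
    [gcdn (j * l) M = gcdn j M]. *)
Lemma sum_gcdn_dvdn (M l e : nat) : (0 < l)%N -> coprime l M ->
  (\sum_(0 <= c < M * l) ((gcdn c M == e) && (l %| c)) = \sum_(0 <= c < M) (gcdn c M == e))%N.
Proof.
move=> l_gt0 co_lM; rewrite big_nat_mul; apply: eq_bigr => j _.
rewrite -{1}[(j * l)%N]add0n big_addn mulSn addnK big_ltn // add0n.
rewrite dvdn_mull // andbT gcdnC Gauss_gcdl 1?coprime_sym // gcdnC.
rewrite big_nat big1 /= ?addn0 // => c /andP[c_gt0 c_l].
by rewrite dvdn_addl ?dvdn_mull // gtnNdvd // andbF.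
Qed.

(** The triangle inequality for [|x| <= u sqrt T] and [|y| <= v sqrt T], squared so that no root of
    [T] is taken. *)
Lemma sqrD_le (R : realFieldType) (T x y u v : R) :
  0 <= T -> 0 <= u -> 0 <= v ->
  x ^+ 2 <= u ^+ 2 * T -> y ^+ 2 <= v ^+ 2 * T -> (x + y) ^+ 2 <= (u + v) ^+ 2 * T.
Proof.
move=> T0 u0 v0 hx hy.
suff : x * y <= u * v * T by nra.
have uvT : 0 <= u * v * T by rewrite !mulr_ge0.
rewrite leNgt; apply/negP => lt_xy.
have : (u * v * T) ^+ 2 < (x * y) ^+ 2 by rewrite ltr_pXn2r // nnegrE // ltW // (le_lt_trans uvT).
rewrite ltNge => /negP; apply.
have -> : (u * v * T) ^+ 2 = (u ^+ 2 * T) * (v ^+ 2 * T) by ring.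
by rewrite exprMn ler_pM ?sqr_ge0.
Qed.

Section Sieve.
Variables (I : finType) (a : I -> nat) (k : nat).
Let q := #|I|.
Let n := (q ^ 2 - 1)%N.
Hypotheses (q_gt1 : (1 < q)%N) (Ha : bose_family a) (k_odd : odd k) (k_n : (4 * k %| n)%N).

Let phi := totient k.
Let core (c : nat) := gcdn c (4 * k) == 2%N.
Let NC : nat := (\sum_x core (a x))%N.
Let B (l : nat) : nat := (\sum_x (core (a x) && (l %| a x)))%N.

Let M_gt0 : (0 < 4 * k)%N.
Proof. by rewrite muln_gt0 /=; case: k k_odd. Qed.

(** The core consists of [phi] of the [4 * k] classes, so [q * phi / (4 * k)] values are expected in
    it. The test function is the centred indicator of the core, cleared of denominators. *)
Lemma core_deviation : ((4 * k)%:R * NC%:R - q%:R * phi%:R) ^+ 2 <= q%:R * ((4 * k)%:R ^+ 2 * phi%:R) :> rat.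
Proof.
pose f (c : 'I_(4 * k)) : rat := (4 * k)%:R * (core c)%:R - phi%:R.
pose r (x : I) := Ordinal (ltn_pmod (a x) M_gt0).
have rE x : val (r x) = (a x %% (4 * k))%N by [].
have sumC : \sum_(c < 4 * k) (core c)%:R = phi%:R :> rat.
  by rewrite -natr_sum -(big_mkord xpredT (fun c => core c : nat)) sum_gcdn4_eq2.
have core_r x : core (r x) = core (a x) by rewrite /core gcdn_modl.
have f0 : \sum_c f c = 0.
  by rewrite big_split /= -mulr_sumr sumC sumr_const card_ord -mulr_natr; ring.
have -> : (4 * k)%:R * NC%:R - q%:R * phi%:R = \sum_x f (r x) :> rat.
  rewrite big_split /= -mulr_sumr sumr_const /NC natr_sum -/q -mulr_natr.
  by under [in RHS]eq_bigr do rewrite core_r; ring.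
apply: le_trans (bose_second_moment q_gt1 Ha k_n rE f0) _.
rewrite ler_wpM2l //.
have -> : \sum_c f c ^+ 2 = (4 * k)%:R ^+ 2 * phi%:R - (4 * k)%:R * phi%:R ^+ 2.
  transitivity (\sum_(c < 4 * k) (((4 * k)%:R ^+ 2 - 2 * (4 * k)%:R * phi%:R) * (core c)%:R + phi%:R ^+ 2) : rat).
    by apply: eq_bigr => c _; rewrite /f; case: (core c); rewrite /= ?mulr1 ?mulr0; ring.
  by rewrite big_split /= -mulr_sumr sumC sumr_const card_ord -mulr_natr; ring.
by rewrite gerBl mulr_ge0 // sqr_ge0.
Qed.

(** [B l] is compared with [NC / l] and not with its expected value [q * phi / (4 * k * l)]. In this
    way the error of [NC] enters the sieve only once, with weight [delta], and not once for every
    prime. *)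
Lemma prime_deviation (l : nat) : (0 < l)%N -> coprime l (4 * k) -> (4 * k * l %| n)%N ->
  (l%:R * (B l)%:R - NC%:R) ^+ 2 <= q%:R * (l%:R ^+ 2 * phi%:R) :> rat.
Proof.
move=> l_gt0 co_l l_n.
have Ml_gt0 : (0 < 4 * k * l)%N by rewrite muln_gt0 M_gt0.
pose g (c : nat) : rat := l%:R * (core c && (l %| c)%N)%:R - (core c)%:R.
pose f (c : 'I_(4 * k * l)) : rat := g c.
pose r (x : I) := Ordinal (ltn_pmod (a x) Ml_gt0).
have rE x : val (r x) = (a x %% (4 * k * l))%N by [].
have sumC : \sum_(c < 4 * k * l) (core c)%:R = (l * phi)%:R :> rat.
  rewrite -natr_sum -(big_mkord xpredT (fun c => core c : nat)).
  by rewrite sum_gcdn_periodic sum_gcdn4_eq2.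
have sumCl : \sum_(c < 4 * k * l) (core c && (l %| c)%N)%:R = phi%:R :> rat.
  rewrite -natr_sum -(big_mkord xpredT (fun c => (core c && (l %| c)%N) : nat)).
  by rewrite sum_gcdn_dvdn // sum_gcdn4_eq2.
have core_r x : core (r x) = core (a x).
  by rewrite /core -[gcdn (r x) _]gcdn_modl rE modn_dvdm ?gcdn_modl // dvdn_mulr.
have l_r x : (l %| r x)%N = (l %| a x)%N.
  by rewrite rE /dvdn modn_dvdm // dvdn_mull.
have f0 : \sum_c f c = 0.
  by rewrite big_split /= -mulr_sumr sumrN sumCl sumC natrM subrr.
have -> : l%:R * (B l)%:R - NC%:R = \sum_x f (r x) :> rat.
  rewrite big_split /= -mulr_sumr sumrN /NC /B !natr_sum.
  by congr (_ * _ - _); apply: eq_bigr => x _; rewrite core_r ?l_r.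
apply: le_trans (bose_second_moment q_gt1 Ha l_n rE f0) _.
rewrite ler_wpM2l //.
have -> : \sum_c f c ^+ 2 = l%:R ^+ 2 * phi%:R - l%:R * phi%:R.
  transitivity (\sum_(c < 4 * k * l) ((l%:R ^+ 2 - 2 * l%:R) * (core c && (l %| c)%N)%:R + (core c)%:R) : rat).
    by apply: eq_bigr => c _; rewrite /f /g; case: (core c); case: (_ %| _)%N; rewrite /= ?mulr1 ?mulr0; ring.
  by rewrite big_split /= -mulr_sumr sumC sumCl natrM; ring.
by rewrite gerBl mulr_ge0.
Qed.

(** If no [x] survives, each core element is hit by some prime, so [NC] is at most the sum of the
    [B l], that is [NC * (1 - delta)] plus the sum of the errors [E l]. Hence [delta * NC] is at
    most the sum of the [E l], and replacing [NC] by its main term adds [delta * E0]. Every error is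
    at most the square root of [T = q * phi], so [delta * T / (4 * k)] is at most [size S + delta]
    times that root, which the hypothesis excludes. *)
Lemma bose_sieve (S : seq nat) (delta := 1 - \sum_(l <- S) l%:R^-1 : rat) :
  {in S, forall l, [&& 0 < l, coprime l (4 * k) & 4 * k * l %| n]%N} ->
  0 < delta ->
  (4 * k)%:R ^+ 2 * ((size S)%:R + delta) ^+ 2 < q%:R * phi%:R * delta ^+ 2 ->
  exists2 x, gcdn (a x) (4 * k) = 2%N & {in S, forall l, ~~ (l %| a x)%N}.
Proof.
move=> HS d_gt0 big_q; set T : rat := q%:R * phi%:R in big_q.
have T0 : 0 <= T by rewrite mulr_ge0.
have K_gt0 : 0 < (4 * k)%:R :> rat by rewrite ltr0n.
have [|none] := boolP [exists x, core (a x) && all (fun l => ~~ (l %| a x)%N) S].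
  by case/existsP => x /andP[/eqP ? /allP ?]; exists x.
have NC_le : (NC <= \sum_(l <- S) B l)%N.
  rewrite exchange_big; apply: leq_sum => x _.
  case: (boolP (core _)) => // core_x.
  have := existsPn none x; rewrite core_x -has_predC => /hasP[l lS /negPn l_x].
  by rewrite (big_rem l) //= l_x.
pose E l : rat := (B l)%:R - NC%:R / l%:R.
pose E0 : rat := q%:R * phi%:R / (4 * k)%:R - NC%:R.
have E0_le : E0 ^+ 2 <= 1 ^+ 2 * T.
  have -> : E0 = - (((4 * k)%:R * NC%:R - q%:R * phi%:R) / (4 * k)%:R).
    by rewrite /E0; field; rewrite gt_eqF // ltr0n; case: (k) k_odd.
  rewrite sqrrN expr_div_n expr1n mul1r ler_pdivrMr ?exprn_gt0 //.
  by apply: le_trans core_deviation _; rewrite /T mulrCA mulrC.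
have sumE_le : (\sum_(l <- S) E l) ^+ 2 <= (size S)%:R ^+ 2 * T.
  elim: (S) HS => [|l s IHs] Hs; first by rewrite big_nil expr0n mulr_ge0 // sqr_ge0.
  rewrite big_cons /= -nat1r; apply: sqrD_le => //.
    have /and3P[l_gt0 co_l l_n] := Hs l (mem_head _ _).
    have lR : 0 < l%:R :> rat by rewrite ltr0n.
    have -> : E l = (l%:R * (B l)%:R - NC%:R) / l%:R by rewrite /E; field; rewrite gt_eqF.
    rewrite expr_div_n expr1n mul1r ler_pdivrMr ?exprn_gt0 //.
    by apply: le_trans (prime_deviation l_gt0 co_l l_n) _; rewrite /T mulrCA mulrC.
  by apply: IHs => m ms; apply: Hs; rewrite inE ms orbT.
have d_le : (delta * E0) ^+ 2 <= delta ^+ 2 * T.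
  by rewrite exprMn ler_pM2l ?exprn_gt0 // -[T]mul1r -[1](expr1n _ 2).
have tot_le := sqrD_le T0 (ler0n _ _) (ltW d_gt0) sumE_le d_le.
have tot_ge : delta * (T / (4 * k)%:R) <= \sum_(l <- S) E l + delta * E0.
  have : NC%:R <= \sum_(l <- S) (B l)%:R :> rat by rewrite -natr_sum ler_nat.
  have -> : \sum_(l <- S) E l = \sum_(l <- S) (B l)%:R - NC%:R * (1 - delta).
    by rewrite /delta subKr mulr_sumr -sumrB.
  by rewrite /E0 -/T; set X := \sum_(l <- S) _; lra.
have T_gt0 : 0 < T.
  rewrite lt_def T0 andbT; apply/eqP => T00; move: big_q; rewrite T00 mul0r ltNge => /negP[].
  by rewrite mulr_ge0 ?sqr_ge0.
have tot_lt : ((size S)%:R + delta) ^+ 2 * T < (delta * (T / (4 * k)%:R)) ^+ 2.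
  have -> : (delta * (T / (4 * k)%:R)) ^+ 2 = (T * delta ^+ 2) * T / (4 * k)%:R ^+ 2.
    by field; rewrite gt_eqF // ltr0n; case: (k) k_odd.
  by rewrite ltr_pdivlMr ?exprn_gt0 // mulrAC ltr_pM2r // mulrC.
have main_ge0 : 0 <= delta * (T / (4 * k)%:R) by rewrite !mulr_ge0 ?invr_ge0 // ltW.
have := le_lt_trans tot_le tot_lt.
by rewrite ltr_pXn2r ?nnegrE ?(le_trans main_ge0 tot_ge) // ltNge tot_ge.
Qed.

End Sieve.

(** * Quadratic extensions *)

Lemma sub1_sqr_fact (q : nat) : (q ^ 2 - 1 = (q + 1) * (q - 1))%N.
Proof. by rewrite -[1%N in LHS](exp1n 2) subn_sqr mulnC. Qed.

Section QuadraticExtension.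
Variables (F : finFieldType) (L : fieldExtType F).
Hypothesis dimL : \dim {:L} = 2%N.
Let q := #|F|.
Let n := (q ^ 2 - 1)%N.

Let q_gt1 : (1 < q)%N := finNzRing_gt1 F.

Let n_gt0 : (0 < n)%N.
Proof. by rewrite /n sub1_sqr_fact muln_gt0 addn1 subn_gt0. Qed.

Lemma mem1_expf (y : L) : (y \in 1%VS) = (y ^+ q == y).
Proof. by rewrite (Fermat's_little_theorem 1%AS) dimv1 expn1. Qed.

Lemma quadratic_expf (y : L) : y ^+ (q ^ 2) = y.
Proof. by apply/eqP; rewrite -dimL -(Fermat's_little_theorem {:L}%AS) memvf. Qed.

Lemma quadratic_expf1 (y : L) : y != 0 -> y ^+ n = 1.
Proof.
move=> y0; apply: (mulIf y0); rewrite mul1r -exprSr /n subn1 prednK ?expn_gt0 ?(ltnW q_gt1) //.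
exact: quadratic_expf.
Qed.

Lemma exists_prim_root : {g : L | n.-primitive_root g}.
Proof.
apply: sigW; pose rs : seq L := [seq x <- enum (finvect_type L) | x != 0].
have /hasP[g _ g_prim] : has n.-primitive_root rs; last by exists g.
apply: has_prim_root => //; last 2 first.
- by apply: filter_uniq; apply: enum_uniq.
- have cardL : #|finvect_type L| = (q ^ 2)%N.
    by rewrite -(card_vspacef (FieldExt.on (finvect_type L))) card_vspace dimL.
  rewrite size_filter -(leq_add2r 1%N) /n subnK; last by rewrite expn_gt0 (ltnW q_gt1).
  rewrite -cardL cardE -(count_predC (fun x : finvect_type L => x != 0)) leq_add2l.
  rewrite (@eq_count _ _ (pred1 (0 : finvect_type L))); last by move=> x /=; rewrite negbK.
  by rewrite count_uniq_mem ?enum_uniq //; case: (_ \in _).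
apply/allP => y; rewrite mem_filter => /andP[y0 _].
by apply/unity_rootP/quadratic_expf1.
Qed.

Lemma prim_rootX (g : L) (y : L) : n.-primitive_root g -> y != 0 ->
  exists i, y = g ^+ i.
Proof. by move=> gP /quadratic_expf1/(prim_rootP gP)[i ->]; exists i. Qed.

Lemma prim_rootX_mem1 (g : L) (i : nat) : n.-primitive_root g ->
  (g ^+ i \in 1%VS) = (q + 1 %| i)%N.
Proof.
move=> gP; rewrite mem1_expf -exprM (eq_prim_root_expr gP).
have q0 : (0 < q)%N by apply: ltnW.
have -> : (i * q = i + i * (q - 1))%N by rewrite -{2}[i]muln1 -mulnDr subnKC.
rewrite -{3}[i]addn0 eqn_modDl mod0n /n sub1_sqr_fact -/(dvdn _ _).
by rewrite dvdn_pmul2r // subn_gt0.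
Qed.

(** Degree 2 leaves no room for an intermediate field. *)
Lemma generator_notin1 (theta : L) : Defs.generator theta <-> theta \notin 1%VS.
Proof.
split=> [gen|theta1].
  apply/negP => /(@Fadjoin_idP _ _ 1%AS) E; have := dimL.
  by rewrite -gen E dimv1.
rewrite /Defs.generator; apply/eqP; rewrite eqEdim subvf dimL /=.
rewrite ltnNge; apply: contra theta1 => dim1.
suff -> : 1%VS = <<1; theta>>%VS by apply: memv_adjoin.
by apply/eqP; rewrite eqEdim subv_adjoin dimv1.
Qed.

Lemma algD_notin1 (theta : L) (x : F) : theta \notin 1%VS -> theta + x%:A != 0.
Proof.
apply: contra; rewrite addr_eq0 => /eqP ->.
by rewrite rpredN memvZ // mem1v.
Qed.

Lemma mem1_alg (c : L) : c \in 1%VS -> exists x : F, c = x%:A.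
Proof. by case/vlineP => x ->; exists x. Qed.

Lemma alg_mem1 (x : F) : x%:A \in (1%VS : {vspace L}).
Proof. by rewrite memvZ // mem1v. Qed.

(** Equal quotients mean [(theta + x) * (theta + y') = (theta + x') * (theta + y)]. Since 1 and
    [theta] are independent over [F], this gives [x + y' = x' + y] and [x * y' = x' * y]; the pairs
    [x, y'] and [x', y] agree up to order, and [x != y] forces [x = x']. If a quotient lies in [F],
    comparing coefficients of [theta] shows that it is 1. *)
Lemma translates_bose (g theta : L) (a : F -> nat) :
  n.-primitive_root g -> theta \notin 1%VS ->
  (forall x, theta + x%:A = g ^+ a x) -> bose_family a.
Proof.
move=> gP theta1 aE.
have theta_free (u v : F) : u *: theta = v%:A -> u = 0 /\ v = 0.
  move=> uv; have [u0|u0] := eqVneq u 0.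
    split=> //; move: uv; rewrite u0 scale0r => /esym/eqP.
    by rewrite scaler_eq0 oner_eq0 orbF => /eqP.
  case/negP: theta1; rewrite -[theta]scale1r -(mulVf u0) -scalerA uv.
  by rewrite memvZ // alg_mem1.
have algM (u v : F) : (u * v)%:A = u%:A * v%:A :> L by rewrite mulr_algl scalerA.
split=> [x y x' y' nxy nxy'|x y] /eqP.
  rewrite -(eq_prim_root_expr gP) !exprD -!aE => /eqP E.
  have : ((x + y') - (x' + y)) *: theta = (x' * y - x * y')%:A.
    rewrite -[LHS]mulr_algl !scalerBl !scalerDl !algM.
    set X := x%:A in E *; set Y := y%:A in E *; set X' := x'%:A in E *; set Y' := y'%:A in E *.
    have -> : (X + Y' - (X' + Y)) * theta =
      X' * Y - X * Y' + ((theta + X) * (theta + Y') - (theta + X') * (theta + Y)) by ring.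
    by rewrite E subrr addr0.
  case/theta_free => /eqP; rewrite subr_eq0 => /eqP e1 /eqP; rewrite subr_eq0 => /eqP e2.
  have : (x - x') * (x - y) = 0.
    have y'E : y' = x' + y - x by rewrite -e1; ring.
    have -> : (x - x') * (x - y) = x' * y - x * (x' + y - x) by ring.
    by rewrite -y'E e2 subrr.
  move/eqP; rewrite mulf_eq0 !subr_eq0 (negPf nxy) orbF => /eqP xx'.
  by split=> //; move: e1; rewrite xx' => /addrI.
move=> /eqP axy; apply/eqP; apply: contraT => nxy.
wlog le_xy : x y axy nxy / (a y <= a x)%N.
  by move=> W; case/orP: (leq_total (a y) (a x)) => ?; [apply: (W x y)|apply: (W y x)] => //; rewrite eq_sym.
move/eqP: axy; rewrite eqn_mod_dvd // -(prim_rootX_mem1 _ gP) => /mem1_alg[c cE].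
have : g ^+ (a x) = c%:A * g ^+ (a y) by rewrite -cE -exprD subnK.
rewrite -!aE mulr_algl scalerDr => E.
have /theta_free[/eqP] : (1 - c) *: theta = (c * y - x)%:A.
  rewrite !scalerBl scale1r -scalerA; apply/eqP.
  by rewrite subr_eq addrAC [X in _ == X - _]addrC -E addrK.
rewrite subr_eq0 => /eqP <-; rewrite mul1r => /eqP; rewrite subr_eq0 eq_sym => /eqP e.
by rewrite e eqxx in nxy.
Qed.

Lemma r_primitive2_exp (g : L) (i : nat) :
  n.-primitive_root g -> gcdn i n = 2%N -> r_primitive 2 (g ^+ i).
Proof.
move=> gP gi; split; rewrite dimL -/q -/n.
  by rewrite -gi dvdn_gcdr.
by rewrite -gi; apply: exp_prim_root.
Qed.

End QuadraticExtension.

(** * From the sieve to 2-primitive translates *)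

Lemma dvdn8_sqr_sub1 (q : nat) : odd q -> (8 %| q ^ 2 - 1)%N.
Proof.
move=> q_odd; have -> : q = (q./2.*2 + 1)%N by rewrite -{1}[q]odd_double_half q_odd addnC.
have -> : ((q./2.*2 + 1) ^ 2 - 1 = 4 * (q./2 * (q./2).+1))%N by nia.
have -> : 8%N = (4 * 2)%N by [].
by rewrite dvdn_pmul2l // dvdn2 oddM /= andbN.
Qed.

(** If the gcd of [i] and [n] exceeds 2, it is a multiple of [2 * r] for some prime [r]. The 4 in
    the modulus excludes [r = 2]; an odd [r] either divides [k], contradicting gcd 2 with [4 * k],
    or belongs to [S]. Higher powers of the primes in [n] never enter. *)
Lemma gcdn_eq2_sieve (n k i : nat) (S : seq nat) :
  (0 < n)%N -> odd k -> (4 * k %| n)%N ->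
  (forall l, prime l -> odd l -> (l %| n)%N -> (l %| k)%N || (l \in S)) ->
  gcdn i (4 * k) = 2%N -> {in S, forall l, ~~ (l %| i)%N} -> gcdn i n = 2%N.
Proof.
move=> n_gt0 k_odd k_n cover gi iS.
have i2 : (2 %| i)%N by rewrite -gi dvdn_gcdl.
have n4 : (4 %| n)%N := dvdn_trans (dvdn_mulr k (dvdnn 4)) k_n.
have n2 : (2 %| n)%N by apply: dvdn_trans n4.
have /dvdnP[e eE] : (2 %| gcdn i n)%N by rewrite dvdn_gcd i2.
rewrite eE; suff -> : e = 1%N by [].
have e_gt0 : (0 < e)%N.
  by have := gcdn_gt0 i n; rewrite n_gt0 orbT eE muln_gt0 => /andP[].
apply/eqP; apply: contraT => e1.
have e_gt1 : (1 < e)%N by rewrite ltn_neqAle eq_sym e1.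
have r_prime := pdiv_prime e_gt1; set r := pdiv e in r_prime.
have : (2 * r %| gcdn i n)%N by rewrite eE mulnC dvdn_pmul2r // pdiv_dvd.
rewrite dvdn_gcd => /andP[r_i r_n].
have [r_odd|r_even] := boolP (odd r); last first.
  have r2 : r = 2%N by case: (even_prime r_prime) => // r_odd; rewrite r_odd in r_even.
  have : (4 %| gcdn i (4 * k))%N by rewrite dvdn_gcd dvdn_mulr // andbT -[4%N]/(2 * 2)%N -{2}r2.
  by rewrite gi.
have {}r_i : (r %| i)%N := dvdn_trans (dvdn_mull _ (dvdnn r)) r_i.
have {}r_n : (r %| n)%N := dvdn_trans (dvdn_mull _ (dvdnn r)) r_n.
case/orP: (cover r r_prime r_odd r_n) => [r_k|/iS]; last by rewrite r_i.
have : (r %| gcdn i (4 * k))%N by rewrite dvdn_gcd r_i dvdn_mull.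
by rewrite gi dvdn_prime2 // => /eqP r2; rewrite r2 in r_odd.
Qed.

(* Only [s / delta] matters, so bounds on both transfer. *)
Lemma sieve_ineq_mono (R : realFieldType) (A Q s s' d d' : R) :
  0 <= A -> 0 <= s -> s <= s' -> 0 < d' -> d' <= d ->
  A * (s' + d') ^+ 2 < Q * d' ^+ 2 -> A * (s + d) ^+ 2 < Q * d ^+ 2.
Proof.
move=> A0 s0 ss' d0 dd' lt'.
have d_gt0 : 0 < d by apply: lt_le_trans dd'.
have [[d_ge0 d'_ge0] s'_ge0] := (ltW d_gt0, ltW d0, le_trans s0 ss').
rewrite -(@ltr_pM2r _ (d' ^+ 2)) ?exprn_gt0 //.
apply: (@le_lt_trans _ _ (A * (s' + d') ^+ 2 * d ^+ 2)).
  have -> : A * (s + d) ^+ 2 * d' ^+ 2 = A * ((s + d) * d') ^+ 2 by ring.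
  have -> : A * (s' + d') ^+ 2 * d ^+ 2 = A * ((s' + d') * d) ^+ 2 by ring.
  rewrite ler_wpM2l // ler_pXn2r ?nnegrE //; first by nra.
    by rewrite mulr_ge0 ?addr_ge0.
  by rewrite mulr_ge0 ?addr_ge0.
by rewrite [ltRHS]mulrAC ltr_pM2r ?exprn_gt0.
Qed.

Section SieveTranslate.
Variables (F : finFieldType) (L : fieldExtType F).
Hypotheses (dimL : \dim {:L} = 2%N).
Let q := #|F|.
Let n := (q ^ 2 - 1)%N.
Hypothesis q_odd : odd q.

Lemma sieve_translate (k : nat) (S : seq nat) (s d : rat) :
  odd k -> (4 * k %| n)%N ->
  {in S, forall l, [&& prime l, odd l, coprime l k & l %| n]%N} ->
  (forall l, prime l -> odd l -> (l %| n)%N -> (l %| k)%N || (l \in S)) ->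
  (size S)%:R <= s -> 0 < d -> \sum_(l <- S) l%:R^-1 <= 1 - d ->
  (4 * k)%:R ^+ 2 * (s + d) ^+ 2 < q%:R * (totient k)%:R * d ^+ 2 ->
  translate_property L 2.
Proof.
move=> k_odd k_n HS cover s_ge d_gt0 d_le ineq theta /(generator_notin1 dimL) theta1.
have [g gP] := exists_prim_root dimL.
have /all_sig[a aE] x : {i : nat | theta + x%:A = g ^+ i}.
  apply: sig_eqW; apply: (prim_rootX dimL gP); exact: algD_notin1.
have Ha : bose_family a by apply: translates_bose gP theta1 aE.
have d_le' : d <= 1 - \sum_(l <- S) l%:R^-1 by rewrite lerBrDr addrC -lerBrDr.
have [|||x ax Sx] := bose_sieve (finNzRing_gt1 F) Ha k_odd k_n (S := S).
- move=> l /HS/and4P[l_prime l_odd co_l l_n]; have l_gt0 := prime_gt0 l_prime.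
  have co : coprime l (4 * k).
    by rewrite coprimeMr co_l andbT (@coprimeXr 2 l 2) // coprimen2.
  by rewrite l_gt0 co Gauss_dvd 1?coprime_sym // k_n.
- exact: lt_le_trans d_le'.
- by apply: sieve_ineq_mono ineq; rewrite ?sqr_ge0.
exists x; rewrite aE; apply: (r_primitive2_exp dimL gP).
apply: gcdn_eq2_sieve cover ax Sx => //.
exact: prim_order_gt0 gP.
Qed.

(** The core is 3, or trivial when 3 divides [q]. The constant is [(4 * 3) ^ 2 / totient 3 = 72],
    and it exceeds the 16 that belongs to the trivial core. Sieving 3 would instead take 1/3 from
    [delta]. *)
Lemma sieve_translate3 (s d : rat) (S := [seq l <- primes n | odd l && (l != 3)]) :
  (size S)%:R <= s -> 0 < d -> \sum_(l <- S) l%:R^-1 <= 1 - d ->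
  72 * (s + d) ^+ 2 < q%:R * d ^+ 2 ->
  translate_property L 2.
Proof.
have n_gt0 : (0 < n)%N.
  by have [g gP] := exists_prim_root dimL; apply: prim_order_gt0 gP.
have n8 : (8 %| n)%N by apply: dvdn8_sqr_sub1.
have S3 : {in S, forall l, [&& prime l, odd l, l != 3 & l %| n]%N}.
  by move=> l; rewrite mem_filter mem_primes => /andP[/andP[-> ->] /and3P[-> _ ->]].
pose k := if (3 %| n)%N then 3%N else 1%N.
have k_odd : odd k by rewrite /k; case: ifP.
have k_n : (4 * k %| n)%N.
  have n4 : (4 %| n)%N by apply: dvdn_trans n8.
  by rewrite /k; case: ifP => n3; rewrite ?muln1 ?Gauss_dvd ?n4.
have HS : {in S, forall l, [&& prime l, odd l, coprime l k & l %| n]%N}.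
  move=> l /S3/and4P[l_prime l_odd l3 l_n]; rewrite l_prime l_odd l_n /k.
  by case: ifP => _; rewrite ?coprimen1 ?prime_coprime ?dvdn_prime2 ?l3.
have cover l : prime l -> odd l -> (l %| n)%N -> (l %| k)%N || (l \in S).
  move=> l_prime l_odd l_n; rewrite mem_filter l_odd mem_primes l_prime n_gt0 l_n !andbT /=.
  case: (eqVneq l 3%N) => [l3|_]; last by rewrite orbT.
  by rewrite /k -l3 l_n l3.
have [totient3 totient1] : totient 3 = 2%N /\ totient 1 = 1%N by [].
move=> s_ge d_gt0 d_le ineq; apply: (sieve_translate k_odd k_n HS cover s_ge d_gt0 d_le).
move: ineq (sqr_ge0 (s + d)); rewrite /k.
set Y := (s + d) ^+ 2; set Z := d ^+ 2; set q' : rat := q%:R.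
case: ifP => _; [rewrite totient3 | rewrite totient1].
  by move: q' => {}q'; lra.
by move: q' => {}q'; lra.
Qed.
End SieveTranslate.

(** * Large q *)

Lemma prod_primes_dvdn (s : seq nat) (m : nat) :
  uniq s -> {in s, forall l, prime l && (l %| m)%N} -> (\prod_(l <- s) l %| m)%N.
Proof.
elim: s m => [|x s IHs] m /=; first by rewrite big_nil dvd1n.
case/andP=> xs us Hs; have /andP[x_prime x_m] := Hs x (mem_head _ _).
have Hs' : {in s, forall l, prime l && (l %| m)%N}.
  by move=> l ls; apply: Hs; rewrite inE ls orbT.
rewrite big_cons Gauss_dvd ?x_m ?IHs // prime_coprime //.
apply/negP; rewrite Euclid_dvd_prod // big_has => /hasP[y ys].
have /andP[y_prime _] := Hs' y ys.
by rewrite dvdn_prime2 // => /eqP xy; rewrite xy ys in xs.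
Qed.

Lemma totient_prod_primes (s : seq nat) :
  uniq s -> all prime s -> totient (\prod_(l <- s) l) = (\prod_(l <- s) l.-1)%N.
Proof.
elim: s => [|x s IHs] /=; first by rewrite !big_nil.
case/andP=> xs us /andP[x_prime s_prime].
have co : coprime x (\prod_(l <- s) l).
  rewrite prime_coprime //; apply/negP; rewrite Euclid_dvd_prod // big_has => /hasP[y ys].
  have y_prime := allP s_prime y ys.
  by rewrite dvdn_prime2 // => /eqP xy; rewrite xy ys in xs.
by rewrite !big_cons totient_coprime // totient_prime // IHs.
Qed.

Lemma sorted_odd_gap (s : seq nat) (i d : nat) :
  sorted ltn s -> all odd s -> (i + d < size s)%N ->
  (nth 0 s i + d.*2 <= nth 0 s (i + d))%N.
Proof.
move=> s_sorted /allP s_odd; elim: d => [|d IHd] ltd; first by rewrite !addn0.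
have ltd' : (i + d < size s)%N by lia.
have o1 := s_odd _ (mem_nth 0%N ltd').
have o2 := s_odd _ (mem_nth 0%N ltd).
have lt12 : (nth 0 s (i + d) < nth 0 s (i + d.+1))%N.
  by apply: (sorted_ltn_nth ltn_trans) => //; rewrite ?inE // addnS.
have := IHd ltd'; move: o1 o2 lt12; set u := nth _ _ _; set v := nth _ _ _; set w := nth _ _ _.
by move=> o1 o2 lt12; lia.
Qed.

(** * Splitting the odd prime divisors into thirds *)

Section ThirdSplit.
Variables (s : seq nat).
Hypotheses (s_sorted : sorted ltn s) (s_odd : all odd s) (s_ge3 : all (leq 3) s).
Let t := (size s %/ 3)%N.
Hypothesis t_ge6 : (6 <= t)%N.
Let x i := nth 0%N s i.

Let size_le : (size s <= 3 * t + 2)%N.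
Proof. by rewrite /t; lia. Qed.
Let size_ge : (3 * t <= size s)%N.
Proof. by rewrite /t; lia. Qed.

Let x_ge (i : nat) : (i < size s)%N -> (2 * i + 3 <= x i)%N.
Proof.
move=> i_lt; have := @sorted_odd_gap s 0 i s_sorted s_odd; rewrite add0n => /(_ i_lt).
have : (3 <= nth 0 s 0)%N by apply: (allP s_ge3); apply: mem_nth; apply: leq_ltn_trans i_lt.
by rewrite /x; lia.
Qed.

(** Entry [i] is at least [2 * i + 3]. So the [t] entries of the middle third are at least
    [2 * t + 3], and the remaining ones, at most [t + 2] in number, are at least [4 * t + 3]; the
    two groups contribute about 1/2 and 1/4. *)
Lemma third_split_sum : \sum_(l <- drop t s) l%:R^-1 <= 1 - 4^-1 :> rat.
Proof.
rewrite (big_nth 0%N) size_drop.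
have size_lt : (t <= size s - t)%N by lia.
rewrite (big_cat_nat (n := t) (leq0n _) size_lt) /=.
have t0 : 0 <= t%:R :> rat by [].
have le1 : \sum_(0 <= i < t) (nth 0%N (drop t s) i)%:R^-1 <= t%:R / (2 * t%:R + 3) :> rat.
  apply: (@le_trans _ _ (\sum_(0 <= i < t) (2 * t%:R + 3)^-1)); last first.
    by rewrite sumr_const_nat subn0 -[X in X <= _]mulr_natl.
  rewrite !big_nat; apply: ler_sum => i /andP[_ i_lt].
  have ti : (t + i < size s)%N by lia.
  rewrite nth_drop lef_pV2 ?posrE; first last.
  - by rewrite ltr_wpDl // mulr_ge0.
  - by rewrite ltr0n; have := x_ge ti; rewrite /x; lia.
  by rewrite -natrM -natrD ler_nat; have := x_ge ti; rewrite /x; lia.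
have le2 : \sum_(t <= i < size s - t) (nth 0%N (drop t s) i)%:R^-1 <= (t%:R + 2) / (4 * t%:R + 3) :> rat.
  apply: (@le_trans _ _ (\sum_(t <= i < size s - t) (4 * t%:R + 3)^-1)); last first.
    rewrite sumr_const_nat -[X in X <= _]mulr_natl ler_wpM2r //.
      by rewrite invr_ge0 addr_ge0 // mulr_ge0.
    by rewrite -natrD ler_nat; lia.
  rewrite !big_nat; apply: ler_sum => i /andP[t_le i_lt].
  have ti : (t + i < size s)%N by lia.
  rewrite nth_drop lef_pV2 ?posrE; first last.
  - by rewrite ltr_wpDl // mulr_ge0.
  - by rewrite ltr0n; have := x_ge ti; rewrite /x; lia.
  by rewrite -natrM -natrD ler_nat; have := x_ge ti; rewrite /x; lia.
apply: (le_trans (lerD le1 le2)).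
(* The shortfall of the first term from 1/2 makes up for the excess of the second over 1/4. *)
have -> : t%:R / (2 * t%:R + 3) = 2^-1 - 3 / 2 / (2 * t%:R + 3) :> rat.
  by field; rewrite gt_eqF // ltr_wpDl // mulr_ge0.
have -> : (t%:R + 2) / (4 * t%:R + 3) = 4^-1 + 5 / 4 / (4 * t%:R + 3) :> rat.
  by field; rewrite gt_eqF // ltr_wpDl // mulr_ge0.
have : 5 / 4 / (4 * t%:R + 3) <= 3 / 2 / (2 * t%:R + 3) :> rat.
  rewrite ler_pdivrMr; last by rewrite ltr_wpDl // mulr_ge0.
  rewrite mulrAC ler_pdivlMr; last by rewrite ltr_wpDl // mulr_ge0.
  by move: t0; set T := t%:R : rat; lra.
by set A := 5 / 4 / _; set B := 3 / 2 / _; lra.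
Qed.

Let pow_ge : (32 * (8 * t + 9) ^ 4 <= (4 * t + 3) ^ t)%N.
Proof.
(* Six factors are enough: [8 * t + 9] is at most 19/9 of [4 * t + 3] precisely from [t = 6] on, and
   32 times the fourth power of 19/9 is below [27 ^ 2], hence below [(4 * t + 3) ^ 2]. *)
apply: (@leq_trans ((4 * t + 3) ^ 6)); last by rewrite leq_pexp2l // addn3.
have : (9 * (8 * t + 9) <= 19 * (4 * t + 3))%N by lia.
have : (27 <= 4 * t + 3)%N by lia.
move: (8 * t + 9)%N (4 * t + 3)%N => a b.
rewrite -!(ler_nat rat) (natrM _ 9) (natrM _ 19) (natrM _ 32) !natrX; move: (ler0n rat a).
move: (a%:R : rat) (b%:R : rat) => {}a {}b a0 b27 ab.
have {}ab : 81 * a ^+ 2 <= 361 * b ^+ 2 by nra.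
have {}b27 : 729 <= b ^+ 2 by nra.
rewrite -[4%N]/(2 * 2)%N -[6%N]/(2 * 3)%N !exprM.
move: (a ^+ 2) (b ^+ 2) (sqr_ge0 a) ab b27 => A B A0 AB B729.
have : 81 * 81 * A ^+ 2 <= 361 * 361 * B ^+ 2 by nra.
have : 729 * B ^+ 2 <= B ^+ 3.
  rewrite -subr_ge0; have -> : B ^+ 3 - 729 * B ^+ 2 = (B - 729) * B ^+ 2 by ring.
  by rewrite mulr_ge0 ?sqr_ge0 ?subr_ge0.
by move: (A ^+ 2) (B ^+ 2) (B ^+ 3) (sqr_ge0 B) => ? ? ?; lra.
Qed.

(** This is the square of the sieve condition for delta = 1/4, divided by [8 * k], once [q ^ 2] is
    bounded below by 8 times the product of all the primes. The middle third pays for the core,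
    because [x i ^ 3 <= x (t + i) * (x i - 1) ^ 2]; the last third, whose product is at least
    [(4 * t + 3) ^ t], pays for the polynomial factor. *)
Lemma third_split_prod :
  (32 * (\prod_(l <- take t s) l) ^ 3 * (4 * size (drop t s) + 1) ^ 4 <=
   (\prod_(l <- drop t s) l) * (\prod_(l <- take t s) l.-1) ^ 2)%N.
Proof.
have size_take_t : size (take t s) = t by rewrite size_takel //; lia.
set k := \prod_(l <- take t s) l; set phi := \prod_(l <- take t s) l.-1.
have kE : k = (\prod_(0 <= i < t) x i)%N.
  rewrite /k (big_nth 0%N) size_take_t !big_nat; apply: eq_bigr => i /andP[_ it].
  by rewrite nth_take.
have phiE : phi = (\prod_(0 <= i < t) (x i).-1)%N.
  rewrite /phi (big_nth 0%N) size_take_t !big_nat; apply: eq_bigr => i /andP[_ it].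
  by rewrite nth_take.
pose A := (\prod_(0 <= i < t) x (t + i))%N.
have leS : (A * (4 * t + 3) ^ t <= \prod_(l <- drop t s) l)%N.
  rewrite (big_nth 0%N) size_drop.
  have [le_t le_2t] : (t <= size s - t)%N /\ (2 * t <= size s - t)%N by lia.
  have le_t2 : (t <= 2 * t)%N by lia.
  rewrite (big_cat_nat (n := t) (leq0n _) le_t) /= (big_cat_nat le_t2 le_2t) /=.
  have -> : A = (\prod_(0 <= i < t) nth 0 (drop t s) i)%N.
    by apply: eq_bigr => i _; rewrite nth_drop.
  rewrite leq_mul2l; apply/orP; right.
  rewrite -[X in (X <= _)%N]muln1; apply: leq_mul.
    have -> : ((4 * t + 3) ^ t = \prod_(t <= i < 2 * t) (4 * t + 3))%N.
      by rewrite prod_nat_const_nat; congr (_ ^ _)%N; lia.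
    rewrite !big_nat; apply: leq_prod => i /andP[t_le i_lt]; rewrite nth_drop.
    by have := x_ge (i := (t + i)%N); rewrite /x; lia.
  rewrite big_nat; apply: (big_ind (fun z => 0 < z)%N) => [//|u v u1 v1|i /andP[t_le i_lt]].
    by rewrite muln_gt0 u1.
  by rewrite nth_drop; have := x_ge (i := (t + i)%N); rewrite /x; lia.
have leA : (k ^ 3 <= A * phi ^ 2)%N.
  have prodX (f : nat -> nat) e :
      ((\prod_(0 <= i < t) f i) ^ e = \prod_(0 <= i < t) f i ^ e)%N.
    by apply: (big_morph (expn^~ e)) => [u v|]; rewrite ?expnMn ?exp1n.
  rewrite kE phiE !prodX -big_split /= !big_nat; apply: leq_prod => i /andP[_ i_lt].
  have gap := @sorted_odd_gap s i t s_sorted s_odd.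
  have i_s : (i < size s)%N by lia.
  have ge3 := x_ge i_s.
  have {}gap : (x i + t.*2 <= x (t + i))%N by rewrite addnC in gap *; apply: gap; lia.
  (* The gap [x (t + i) - x i] is at least [2 * t >= 12]. In terms of [u = x i - 3], the difference
     [(u + 15) * (u + 2) ^ 2 - (u + 3) ^ 3] has nonnegative coefficients. *)
  have -> : (x i = (x i - 3) + 3)%N by lia.
  have : (x i - 3 + 3 + 12 <= x (t + i))%N by lia.
  move: (x i - 3)%N (x (t + i)%N) => u v uv.
  by apply: (@leq_trans ((u + 15) * (u + 2) ^ 2)); [nia | apply: leq_mul; lia].
apply: (@leq_trans (A * (4 * t + 3) ^ t * phi ^ 2)); last by rewrite leq_mul2r leS orbT.
rewrite mulnAC [(A * _ * _)%N]mulnAC mulnC; apply: leq_mul => //.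
apply: leq_trans pow_ge; rewrite leq_mul2l leq_exp2r //= size_drop; lia.
Qed.

End ThirdSplit.

(** * Comparison with the first primes and thresholds for q *)

Definition first_primes : seq nat :=
  [:: 5; 7; 11; 13; 17; 19; 23; 29; 31; 37; 41; 43; 47; 53; 59; 61; 67]%N.

(** Pigeonhole: if entry [i] of [s] were smaller, the first [i + 1] entries of [s] would be distinct
    primes among the first [i] of the list. *)
Lemma nth_first_primes_le (s : seq nat) (i : nat) :
  sorted ltn s -> {in s, forall l, prime l && (5 <= l)%N} ->
  (i < size s)%N -> (i < 17)%N -> (nth 0 first_primes i <= nth 0 s i)%N.
Proof.
move=> s_sorted Hs i_s i17; rewrite leqNgt; apply/negP => lt_i.
(* The list has no gaps: each prime from 5 on that is below entry [j] occurs among the first [j]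
   entries. *)
have small : all (fun j => all (fun l => (prime l && (5 <= l) ==> (l \in take j first_primes))%N)
    (iota 0 (nth 0 first_primes j)%N)) (iota 0 17) by vm_compute.
have : (size (take i.+1 s) <= size (take i first_primes))%N.
  apply: uniq_leq_size; first exact/take_uniq/(sorted_uniq ltn_trans ltnn).
  move=> l l_s; have := allP small i; rewrite mem_iota add0n leq0n i17 => /(_ isT)/allP/(_ l).
  rewrite mem_iota add0n leq0n (Hs l (mem_take l_s)) /=; apply.
  apply: leq_ltn_trans lt_i; have /(nthP 0%N)[j] := l_s.
  rewrite size_takel // => j_i <-; rewrite nth_take //.
  have s_leq : sorted leq s by apply: sub_sorted s_sorted => u v /ltnW.
  by apply: (sorted_leq_nth leq_trans leqnn 0%N s_leq); rewrite ?inE //; lia.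
by rewrite size_takel // (size_takel (ltnW i17 : i <= size first_primes)%N) ltnn.
Qed.

Section Large.
Variables (F : finFieldType) (L : fieldExtType F).
Hypotheses (dimL : \dim {:L} = 2%N).
Let q := #|F|.
Let n := (q ^ 2 - 1)%N.
Hypothesis q_odd : odd q.

Let n_gt0 : (0 < n)%N.
Proof. by have [g gP] := exists_prim_root dimL; apply: prim_order_gt0 gP. Qed.

Let P := [seq l <- primes n | odd l].

Let P_sorted : sorted ltn P.
Proof. exact/sorted_filter/sorted_primes/ltn_trans. Qed.

Let P_uniq : uniq P.
Proof. exact: (sorted_uniq ltn_trans ltnn). Qed.

Let mem_P l : (l \in P) = [&& odd l, prime l & l %| n]%N.
Proof. by rewrite mem_filter mem_primes n_gt0. Qed.

Let prod_P (s : seq nat) : uniq s -> {subset s <= P} -> (8 * \prod_(l <- s) l %| n)%N.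
Proof.
move=> s_uniq sP; rewrite Gauss_dvd; last first.
  rewrite -[8%N]/(2 ^ 3)%N coprimeXl // coprime2n.
  rewrite big_seq; apply: (big_ind (fun z => odd z)) => //= [u v u_odd v_odd|l /sP]; first by rewrite oddM u_odd.
  by rewrite mem_P => /and3P[].
rewrite dvdn8_sqr_sub1 // prod_primes_dvdn // => l /sP.
by rewrite mem_P => /and3P[_ -> ->].
Qed.

(** Eighteen primes put at least 6 into each third, as the splitting estimates require. *)
Lemma translate_many_primes : (18 <= size P)%N -> translate_property L 2.
Proof.
move=> P18; pose t := (size P %/ 3)%N.
have t6 : (6 <= t)%N by rewrite /t; lia.
have P_odd : all odd P by apply/allP => l; rewrite mem_P => /and3P[].
have P_ge3 : all (leq 3) P.
  by apply/allP => l; rewrite mem_P => /and3P[l_odd l_prime _]; apply: odd_prime_gt2.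
have := third_split_prod P_sorted P_odd P_ge3 t6.
have := third_split_sum P_sorted P_odd P_ge3 t6.
rewrite -/t; set K := take t P; set S := drop t P; set k := (\prod_(l <- K) l)%N.
have K_P : {subset K <= P} by move=> l; apply: mem_take.
have S_P : {subset S <= P} by move=> l; apply: mem_drop.
have K_prime : all prime K by apply/allP => l /K_P; rewrite mem_P => /and3P[].
have K_uniq : uniq K by apply: take_uniq.
rewrite -(totient_prod_primes K_uniq K_prime) -/k; set m := size S; set phi := totient k.
have PE : (\prod_(l <- P) l = k * \prod_(l <- S) l)%N by rewrite -big_cat cat_take_drop.
have k_odd : odd k.
  rewrite /k big_seq; apply: (big_ind (fun z => odd z)) => //= [u v u_odd v_odd|l /K_P]; first by rewrite oddM u_odd.
  by rewrite mem_P => /and3P[].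
have k_n : (4 * k %| n)%N.
  apply: dvdn_trans (prod_P K_uniq K_P); rewrite -[8%N]/(4 * 2)%N -mulnA dvdn_pmul2l //.
  by rewrite dvdn_mull.
have HS : {in S, forall l, [&& prime l, odd l, coprime l k & l %| n]%N}.
  move=> l lS; have := S_P l lS; rewrite mem_P => /and3P[l_odd l_prime l_n].
  rewrite l_odd l_prime l_n /= prime_coprime // andbT.
  rewrite Euclid_dvd_prod // big_has; apply/hasP => -[x xK].
  rewrite dvdn_prime2 ?(allP K_prime _ xK) // => /eqP lx.
  move: P_uniq; rewrite -(cat_take_drop t P) cat_uniq => /and3P[_ /hasPn/(_ l lS)/=].
  by rewrite lx xK.
have cover l : prime l -> odd l -> (l %| n)%N -> (l %| k)%N || (l \in S).
  move=> l_prime l_odd l_n; have : l \in P by rewrite mem_P l_odd l_prime.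
  rewrite -(cat_take_drop t P) mem_cat => /orP[lK|->]; last by rewrite orbT.
  by rewrite /k (big_rem l) //= dvdn_mulr.
have n_ge : (8 * (k * \prod_(l <- S) l) <= n)%N by rewrite -PE dvdn_leq // prod_P.
move: (\prod_(l <- S) l)%N n_ge => R n_ge sum_le prod_le.
have phi_gt0 : (0 < phi)%N by rewrite totient_gt0; case: (k) k_odd.
(* The sieve inequality for delta = 1/4 without denominators. It is squared because the size of [q]
   is known through [8 * k * R <= n < q ^ 2]. *)
have ineq : (16 * k ^ 2 * (4 * m + 1) ^ 2 < q * phi)%N.
  rewrite -ltn_sqr.
  have -> : ((16 * k ^ 2 * (4 * m + 1) ^ 2) ^ 2 = 8 * k * (32 * k ^ 3 * (4 * m + 1) ^ 4))%N by ring.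
  apply: (@leq_ltn_trans (8 * (k * R) * phi ^ 2)).
    have -> : (8 * (k * R) * phi ^ 2 = 8 * k * (R * phi ^ 2))%N by rewrite !mulnA.
    by rewrite leq_mul2l prod_le orbT.
  rewrite expnMn ltn_pmul2r ?expn_gt0 ?phi_gt0 //.
  by apply: leq_ltn_trans n_ge _; rewrite /n ltn_subrL expn_gt0; move: q_odd; case: (q).
apply: (@sieve_translate F L dimL k S m%:R 4^-1 k_odd k_n HS cover) => //.
move: ineq; rewrite -(ltr_nat rat) -/phi -/q.
rewrite (natrM _ (16 * k ^ 2)) (natrM _ 16) !natrX natrD (natrM _ 4 m) (natrM _ q) (natrM _ 4 k).
move: (k%:R : rat) (m%:R : rat) (q%:R : rat) (phi%:R : rat) => a b c d ?.
have -> : (4 * a) ^+ 2 * (b + 4^-1) ^+ 2 = (16 * a ^+ 2 * (4 * b + 1) ^+ 2) / 16 by field.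
have -> : c * d * 4^-1 ^+ 2 = c * d / 16 by field.
have gt16 : 0 < 16^-1 :> rat by rewrite invr_gt0 ltr0n.
by rewrite (ltr_pM2r gt16).
Qed.

Let S := [seq l <- primes n | odd l && (l != 3)].

Let S_P : {subset S <= P}.
Proof. by move=> l; rewrite !mem_filter => /andP[/andP[-> _] ->]. Qed.

Let S_sorted : sorted ltn S.
Proof. exact/sorted_filter/sorted_primes/ltn_trans. Qed.

Let S_prime5 : {in S, forall l, prime l && (5 <= l)%N}.
Proof.
move=> l; rewrite mem_filter mem_primes => /andP[/andP[l_odd l3] /and3P[l_prime _ _]].
by rewrite l_prime; have := odd_prime_gt2 l_odd l_prime; lia.
Qed.

Let sum_S (m : nat) : (size S <= m <= 17)%N ->
  \sum_(l <- S) l%:R^-1 <= \sum_(l <- take m first_primes) l%:R^-1 :> rat.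
Proof.
case/andP=> Sm m17; rewrite (big_nth 0%N) [leRHS](big_nth 0%N).
rewrite (size_takel (m17 : m <= size first_primes)%N) (big_cat_nat (leq0n _) Sm) /=.
apply: ler_wpDr; first by apply: sumr_ge0 => i _; rewrite invr_ge0.
rewrite !big_nat; apply: ler_sum => i /andP[_ i_S].
have i_m : (i < m)%N := leq_trans i_S Sm.
have i17 := leq_trans i_m m17.
have le_nth := nth_first_primes_le S_sorted S_prime5 i_S i17.
have fp_gt0 : (0 < nth 0 first_primes i)%N by move: i i17 {i_S i_m le_nth}; do 17?case=> //.
by rewrite nth_take // lef_pV2 ?posrE ?ltr0n ?ler_nat // (leq_trans fp_gt0).
Qed.

Let prod_S (m : nat) : (m <= size S)%N -> (m <= 17)%N ->
  8 * \prod_(l <- take m first_primes) l%:R < q%:R ^+ 2 :> rat.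
Proof.
move=> mS m17.
have S_uniq : uniq (take m S) by apply/take_uniq/(sorted_uniq ltn_trans ltnn).
have := dvdn_leq n_gt0 (prod_P S_uniq (fun l lS => S_P (mem_take lS))).
rewrite -natr_prod -natrX => le_n.
rewrite -(natrM _ 8) ltr_nat; apply: (@leq_ltn_trans n); last first.
  by rewrite /n ltn_subrL expn_gt0; move: q_odd; case: (q).
apply: leq_trans le_n; rewrite leq_mul2l /=.
rewrite (big_nth 0%N) [X in (_ <= X)%N](big_nth 0%N) (size_takel mS).
rewrite (size_takel (m17 : m <= size first_primes)%N) !big_nat; apply: leq_prod => i /andP[_ i_m].
rewrite !nth_take //; apply: nth_first_primes_le => //; exact: leq_trans i_m _.
Qed.

(** For a given number of primes other than 2 and 3, the worst case is the initial segment of 5, 7,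
    11, and so on. Seven primes leave delta just above 0.3343, and 72 times the square of 7.3343 /
    0.3343 is about 34656; this is the origin of 34700. More primes require a larger [q] but also
    force one through the product of the primes: eight of them give [q >= 92800], enough to sieve
    nine, and ten give [q >= 3000000], enough to sieve seventeen. *)
Lemma translate_large : (347 * 100 <= q)%N -> translate_property L 2.
Proof.
rewrite -(ler_nat rat) natrM => q_ge.
have [|P18] := leqP 18 (size P); first exact: translate_many_primes.
have S17 : (size S <= 17)%N.
  have S_uniq : uniq S := sorted_uniq ltn_trans ltnn S_sorted.
  exact: leq_trans (uniq_leq_size S_uniq S_P) P18.
have le_nat7 (a b : nat) : (a <= b)%N -> a%:R <= b%:R :> rat by rewrite ler_nat.
have [S7|S8] := leqP (size S) 7.
  have S7' : (size S <= 7 <= 17)%N by rewrite S7.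
  apply: (@sieve_translate3 F L dimL q_odd 7 (3343 / (100 * 100)) (le_nat7 _ 7%N S7)).
  - by lra.
  - by apply: le_trans (sum_S S7') _; rewrite /= !big_cons big_nil; lra.
  - by move: q_ge; rewrite -/q; move: (q%:R : rat) => c; lra.
have [S9|S10] := leqP (size S) 9.
  have S9' : (size S <= 9 <= 17)%N by rewrite S9.
  have := prod_S S8 isT; rewrite /= !big_cons big_nil => q2.
  have q_ge' : 928 * 100 <= q%:R :> rat.
    by move: q2 q_ge; move: (q%:R : rat) => c; nra.
  apply: (@sieve_translate3 F L dimL q_odd 9 (267 / 1000) (le_nat7 _ 9%N S9)).
  - by lra.
  - by apply: le_trans (sum_S S9') _; rewrite /= !big_cons big_nil; lra.
  - by move: q_ge'; rewrite -/q; move: (q%:R : rat) => c; lra.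
have S17' : (size S <= 17 <= 17)%N by rewrite S17.
have := prod_S S10 isT; rewrite /= !big_cons big_nil => q2.
have q_ge' : 3000 * 1000 <= q%:R :> rat.
  by move: q2 q_ge; move: (q%:R : rat) => c; nra.
apply: (@sieve_translate3 F L dimL q_odd 17 (104 / 1000) (le_nat7 _ 17%N S17)).
- by lra.
- by apply: le_trans (sum_S S17') _; rewrite /= !big_cons big_nil; lra.
- by move: q_ge'; rewrite -/q; move: (q%:R : rat) => c; lra.
Qed.

End Large.

(** * Computations in finite fields *)

Local Open Scope nat_scope.

(** Binary long division keeping only the remainder [r]: [2 * r + 1] is below [2 * p], so one
    subtraction per digit suffices, and [Pos.sub_mask] compares and subtracts in one pass. *)
Fixpoint pmod (a p : positive) : N :=
  match a with
  | xH => if p is xH then N0 else Npos xH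
  | xO a' => if pmod a' p is Npos r then
      match Pos.sub_mask (xO r) p with
      | Pos.IsNul => N0 | Pos.IsPos z => Npos z | Pos.IsNeg => Npos (xO r)
      end else N0
  | xI a' =>
      let r1 := if pmod a' p is Npos r then xI r else xH in
      match Pos.sub_mask r1 p with
      | Pos.IsNul => N0 | Pos.IsPos z => Npos z | Pos.IsNeg => Npos r1
      end
  end.

Definition Nmod (a p : N) : N :=
  match a, p with Npos a, Npos p => pmod a p | _, _ => a end.

Section PolyRing.
Variables (p : N) (M : list N).

(* Lists are the coefficients, constant term first, of elements of F_p[X]/(X^D - sum_i m_i X^i),
   with [D] the length of [M]; [vstep] computes [X * acc + c * b] when [top] is the last entry of
   [acc]. *)
Fixpoint vstep (top c prev : N) (acc m b : list N) : list N :=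
  match acc, m, b with
  | a :: acc, x :: m, y :: b =>
      Nmod (N.add prev (N.add (N.mul top x) (N.mul c y))) p :: vstep top c a acc m b
  | _, _, _ => [::]
  end.

(** Horner's rule in X over the coefficients of [u]; what each multiplication by X pushes out at the
    top is reduced at once through [M]. *)
Definition vmul (u v : list N) : list N :=
  foldr (fun c acc => vstep (last N0 acc) c N0 acc M v) (map (fun=> N0) M) u.

(** Repeated squares of [b], computed once for all the exponents of a certificate; [vpow] picks from
    this table along the binary digits of the exponent. *)
Fixpoint vpows (k : nat) (b : list N) : list (list N) :=
  if k is k'.+1 then b :: vpows k' (vmul b b) else [::].

Fixpoint vpow (e : positive) (tb : list (list N)) : list N :=
  match e, tb with
  | xH, b :: _ => b
  | xO e, _ :: tb => vpow e tb
  | xI e, b :: tb => vmul b (vpow e tb)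
  | _, [::] => [::]
  end.

Fixpoint vadd (u v : list N) : list N :=
  match u, v with
  | x :: u, y :: v => Nmod (N.add x y) p :: vadd u v
  | _, _ => [::]
  end.

Fixpoint veq (u v : list N) : bool :=
  match u, v with
  | x :: u, y :: v => N.eqb x y && veq u v
  | [::], [::] => true
  | _, _ => false
  end.

End PolyRing.

Fixpoint odd_part (a : positive) : positive := if a is xO a' then odd_part a' else a.

(* Trial division without repetitions; [None] when the fuel runs out. *)
Fixpoint pfac (fuel : nat) (m d : positive) : option (list N) :=
  if fuel is f.+1 then
    if m is xH then Some [::] else
    if Pos.ltb m (Pos.mul d d) then Some [:: Npos m] else
    if pmod m d is N0 then
      if N.div (Npos m) (Npos d) is Npos m' then
        if pmod m' d is N0 then pfac f m' d
        else if pfac f m' (Pos.add d 2) is Some r then Some (Npos d :: r) else None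
      else None
    else pfac f m (Pos.add d 2)
  else None.

(** Exhausted fuel is harmless: on [None], [cert_ok] and [sieve_ok] reject, while [candidate]
    accepts and so leaves the number to be checked. *)
Definition pfac_odd (m : N) : option (list N) :=
  if m is Npos a then pfac 400 (odd_part a) 3 else None.

Fixpoint Nmem (x : N) (s : list N) : bool :=
  if s is y :: s' then N.eqb x y || Nmem x s' else false.

Fixpoint Nundup (s : list N) : list N :=
  if s is x :: s' then if Nmem x s' then Nundup s' else x :: Nundup s' else [::].

(* Whether for every [m] some [x] in [a] has [m + x] divisible by no [l] in [ls].  For each [l] it
   suffices to let [-m] run through the residues attained on [a]. *)
Fixpoint cover (ls a : list N) : bool :=
  if a is [::] then false else
  if ls is l :: ls' then
    all (fun r => cover ls' (filter (fun x => ~~ N.eqb (Nmod x l) r) a))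
        (Nundup (map (fun x => Nmod x l) a))
  else true.

(* [cert_M] lists the [m_i] of [mu = X^D - sum_i m_i X^i] over F_p, whose root [g] has order
   [n = q^2 - 1]; [cert_inv] holds the inverses of [g^(n/l) - 1] for the primes [l] dividing [n];
   a pair [(j, e)] of [cert_je] asserts [g^(qj) - g^j = g^h] with [h = (q+1)/2 + (q+1)e]. *)
Record cert := Cert {
  cert_q : N; cert_p : N; cert_M : list N; cert_inv : list (list N); cert_je : list (N * N) }.

Definition Npos_of (a : N) : positive := if a is Npos p then p else xH.

Section CertCheck.
Variables (q p : N) (M : list N).

Definition cert_n : N := N.sub (N.mul q q) 1.
Definition cert_half : N := N.div (N.add q 1) 2.
Definition cert_exp (e : N) : N := N.add cert_half (N.mul (N.add q 1) e).
Definition cert_offset (je : N * N) : N := N.sub (N.add cert_n je.1) (cert_exp je.2).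

Definition vone : list N := Npos 1 :: map (fun=> N0) (behead M).
Definition vminus1 : list N := N.sub p 1 :: map (fun=> N0) (behead M).
Definition vX : list N := N0 :: Npos 1 :: map (fun=> N0) (behead (behead M)).
Definition Xpows : list (list N) := vpows p M (Pos.size_nat (Npos_of cert_n)) vX.

(** Different coordinate lists might take the same value in [L], so comparing lists cannot show that
    [g ^ (n / l)] differs from 1. A product equal to 1 does survive evaluation. *)
Definition order_ok (tb : list (list N)) (li : N * list N) : bool :=
  veq (vmul p M li.2 (vadd p (vpow p M (Npos_of (N.div cert_n li.1)) tb) vminus1)) vone.

(** The bound 128 fits the table of seven entries for the powers of [g ^ q]; the bound on [cert_exp]
    keeps the subtraction in [cert_offset] from being truncated. *)
Definition relation_ok (tb tbq : list (list N)) (je : N * N) : bool :=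
  [&& N.leb (cert_exp je.2) cert_n, N.ltb 0 je.1, N.ltb je.1 128, N.leb je.1 cert_n &
      veq (vpow p M (Npos_of je.1) tbq)
        (vadd p (vpow p M (Npos_of je.1) tb) (vpow p M (Npos_of (cert_exp je.2)) tb))].

(** The conditions that do not depend on m. An odd prime dividing [q + 1] divides [(q + 1) / 2],
    hence m, so it divides m plus the offset only if it divides the offset. If [q] is 3 modulo 4,
    then m is [(q + 1) / 2] modulo 4. If [q] is 1 modulo 4, then m is odd, an odd offset makes the
    sum even, and divisibility by 4 is left to the covering. *)
Definition offset_ok (l2 : list N) (je : N * N) : bool :=
  all (fun l => ~~ N.eqb (Nmod (cert_offset je) l) 0) l2 &&
  (if N.eqb (Nmod q 4) 3 then N.eqb (Nmod (N.add (cert_offset je) cert_half) 4) 2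
   else N.eqb (Nmod (cert_offset je) 2) 1).

Definition field_ok (invs : list (list N)) (ls : list N) (jes : list (N * N))
    (tb : list (list N)) : bool :=
  [&& veq (vpow p M (Npos_of cert_n) tb) vone,
      size invs == size ls,
      all (order_ok tb) (zip ls invs) &
      all (relation_ok tb (vpows p M 7 (vpow p M (Npos_of q) tb))) jes].

(** A choice among the offsets has to deal only with the odd primes dividing [q - 1], modulo which m
    is unconstrained, and with 4 when [q] is 1 modulo 4. *)
Definition cover_ok (l1 l2 : list N) (jes : list (N * N)) : bool :=
  all (offset_ok l2) jes &&
  cover (if N.eqb (Nmod q 4) 3 then l1 else Npos 4 :: l1) (map cert_offset jes).

End CertCheck.

Definition cert_ok (c : cert) : bool :=
  let: Cert q p M invs jes := c in
  if (pfac_odd (N.sub q 1), pfac_odd (N.add q 1)) is (Some l1, Some l2) then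
    [&& 1 < size M, N.eqb (N.pow p (N.of_nat (size M))) (N.mul q q),
        field_ok q p M invs (Npos 2 :: l1 ++ l2) jes (Xpows q p M) &
        cover_ok q l1 l2 jes]
  else false.

(* Fixed-point denominator for the reciprocals of primes. *)
Definition sieve_scale : N := Npos 16384.

(** Reciprocals are rounded up, so [t] overestimates their sum and [d] underestimates delta, both in
    units of [1 / sieve_scale]. If [t] is too large, the truncated subtraction yields 0, which the
    test [0 < d] rejects. *)
Definition sieve_ok (q : N) : bool :=
  if (pfac_odd (N.sub q 1), pfac_odd (N.add q 1)) is (Some l1, Some l2) then
    let ls := filter (fun l => ~~ N.eqb l 3) (l1 ++ l2) in
    let s := foldr (fun _ => N.succ) N0 ls in
    let t := foldr (fun l => N.add (N.succ (N.div sieve_scale l))) N0 ls in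
    let d := N.sub sieve_scale t in
    let w := N.add (N.mul s sieve_scale) d in
    N.ltb (N.mul 72 (N.mul w w)) (N.mul q (N.mul d d)) && N.ltb 0 d
  else false.

Definition candidate (q : N) : bool :=
  if pfac_odd q is Some (_ :: _ :: _) then false else true.

Fixpoint range_ok (qs : list N) (fuel : nat) (q : N) : bool :=
  if fuel is f.+1 then
    [|| ~~ candidate q, sieve_ok q | Nmem q qs] && range_ok qs f (N.add q 2)
  else true.

(** * Correctness of remainders and trial division *)

Lemma pmodE (a p : positive) : pmod a p = N.modulo (Npos a) (Npos p).
Proof.
have reduce (x : positive) : (Npos x < 2 * Npos p)%num ->
    let y := match Pos.sub_mask x p with
      | Pos.IsNul => N0 | Pos.IsPos z => Npos z | Pos.IsNeg => Npos x end in
    (y < Npos p)%num /\ (Npos x = y \/ Npos x = Npos p + y)%num.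
  move=> x_lt /=.
  case: Pos.sub_mask_spec => [->|z xE|xE].
  - by split; [lia | right; lia].
  - by split; [lia | right; lia].
  - by split; [lia | left].
elim: a => [a IH|a IH|] /=.
- rewrite IH; set r := N.modulo _ _.
  have r_lt : (r < Npos p)%num by apply: N.mod_lt.
  have aE := N.div_mod (Npos a) (Npos p) ltac:(done); rewrite -/r in aE.
  set x := (if r is Npos r then xI r else xH).
  have xE : Npos x = (2 * r + 1)%num by rewrite /x; case: (r).
  have [|y_lt y_eq] := reduce x; first by lia.
  case: y_eq => y_eq.
    by apply: (N.mod_unique _ _ (2 * (Npos a / Npos p))%num) => //; lia.
  by apply: (N.mod_unique _ _ (2 * (Npos a / Npos p) + 1)%num) => //; lia.
- rewrite IH; set r := N.modulo _ _.
  have r_lt : (r < Npos p)%num by apply: N.mod_lt.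
  have aE := N.div_mod (Npos a) (Npos p) ltac:(done); rewrite -/r in aE.
  case rE : r => [|x].
    by apply: (N.mod_unique _ _ (2 * (Npos a / Npos p))%num) => //; lia.
  have [|y_lt y_eq] := reduce (xO x); first by lia.
  case: y_eq => y_eq.
    by apply: (N.mod_unique _ _ (2 * (Npos a / Npos p))%num) => //; lia.
  by apply: (N.mod_unique _ _ (2 * (Npos a / Npos p) + 1)%num) => //; lia.
by case: p {reduce}.
Qed.

Lemma NmodE (a p : N) : N.to_nat (Nmod a p) = (N.to_nat a %% N.to_nat p)%N.
Proof.
case: a p => [|a] [|p] //=; first by rewrite mod0n.
rewrite pmodE; set r := N.modulo _ _.
have r_lt : (r < Npos p)%num by apply: N.mod_lt.
have aE := N.div_mod (Npos a) (Npos p) ltac:(done); rewrite -/r in aE.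
have -> : Pos.to_nat a = (N.to_nat (Npos a / Npos p) * Pos.to_nat p + N.to_nat r)%N by lia.
by rewrite modnMDl modn_small //; lia.
Qed.

Lemma pmod_eq0 (a p : positive) : (if pmod a p is N0 then true else false) = (Pos.to_nat p %| Pos.to_nat a)%N.
Proof.
have /= := NmodE (Npos a) (Npos p); rewrite /dvdn => <-.
by case: pmod => //= r; lia.
Qed.

Lemma odd_partE (a : positive) :
  odd (Pos.to_nat (odd_part a)) /\ exists k, Pos.to_nat a = (2 ^ k * Pos.to_nat (odd_part a))%N.
Proof.
elim: a => [a _|a [IHo [k IHk]]|]; rewrite ?[odd_part _]/=.
- have -> : Pos.to_nat a~1 = (Pos.to_nat a).*2.+1 by lia.
  by split; [rewrite oddS odd_double | exists 0%N; rewrite mul1n].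
- have -> : Pos.to_nat a~0 = (2 * Pos.to_nat a)%N by lia.
  by split=> //; exists k.+1; rewrite expnS -mulnA -IHk.
- by split=> //; exists 0%N.
Qed.

Lemma Npos_div_exact (m d m' : positive) : (Pos.to_nat d %| Pos.to_nat m)%N ->
  N.div (Npos m) (Npos d) = Npos m' -> Pos.to_nat m = (Pos.to_nat d * Pos.to_nat m')%N.
Proof.
case/dvdnP=> k kE; have -> : Npos m = (N.of_nat k * Npos d)%num by lia.
have d0 : Npos d <> N0 by [].
rewrite (N.div_mul _ _ d0) kE mulnC => km'.
by congr (_ * _)%N; lia.
Qed.

Lemma to_nat_add2 (d : positive) : Pos.to_nat (d + 2) = (Pos.to_nat d).+2.
Proof. by lia. Qed.

Section TrialDivision.

Let noSmall (m d : positive) := forall l, prime l -> (l %| Pos.to_nat m)%N -> (Pos.to_nat d <= l)%N.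

Let noSmall_step (m d : positive) : odd (Pos.to_nat m) -> odd (Pos.to_nat d) -> noSmall m d ->
  ~~ (Pos.to_nat d %| Pos.to_nat m)%N -> noSmall m (Pos.add d 2).
Proof.
move=> m_odd d_odd nS d_m l l_prime l_m; have := nS l l_prime l_m.
have l_odd : odd l by apply: dvdn_odd l_m m_odd.
have : l != Pos.to_nat d by apply: contraNneq d_m => <-.
by lia.
Qed.

Let noSmall_dvd (m m' d : positive) : (Pos.to_nat m' %| Pos.to_nat m)%N ->
  noSmall m d -> noSmall m' d.
Proof. by move=> m'm nS l l_prime l_m'; apply: nS => //; apply: dvdn_trans m'm. Qed.

(** The invariant [noSmall] says that every prime factor of [m] is at least the current trial
    divisor [d]. Hence if [1 < m < d ^ 2], there is no room for two factors and [m] is prime. *)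
Lemma pfac_complete (f : nat) (m d : positive) (r : list N) :
  pfac f m d = Some r -> odd (Pos.to_nat m) -> odd (Pos.to_nat d) -> noSmall m d ->
  forall l, prime l -> (l %| Pos.to_nat m)%N -> l \in map N.to_nat r.
Proof.
elim: f m d r => [//|f IHf] m d r E m_odd d_odd nS l l_prime l_m.
have m1 : m <> xH by move=> m1; move: l_m; rewrite m1 dvdn1 => /eqP l1; rewrite l1 in l_prime.
have {E} : (if Pos.ltb m (Pos.mul d d) then Some [:: Npos m] else
    if pmod m d is N0 then
      if N.div (Npos m) (Npos d) is Npos m' then
        if pmod m' d is N0 then pfac f m' d
        else if pfac f m' (Pos.add d 2) is Some r then Some (Npos d :: r) else None
      else None
    else pfac f m (Pos.add d 2)) = Some r by move: E => /=; case: (m) m1.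
case: Pos.ltb_spec => [m_lt [<-]|_].
  rewrite /= mem_seq1; have /dvdnP[e eE] := l_m.
  have l_d := nS l l_prime l_m.
  have [e1|e1] := eqVneq e 1%N; first by rewrite eE e1; lia.
  have e_gt1 : (1 < e)%N by lia.
  have := nS _ (pdiv_prime e_gt1); rewrite eE => /(_ (dvdn_mulr _ (pdiv_dvd e))) d_e.
  have := dvdn_leq (ltnW e_gt1) (pdiv_dvd e).
  by nia.
have := pmod_eq0 m d; case dmE : (pmod m d) => [|z] d_m; last first.
  have d2_odd : odd (Pos.to_nat (d + 2)) by rewrite to_nat_add2 /= negbK.
  have nS2 : noSmall m (d + 2) by apply: noSmall_step => //; rewrite -d_m.
  by move=> E; apply: (IHf _ _ _ E m_odd d2_odd nS2).
have {}d_m : (Pos.to_nat d %| Pos.to_nat m)%N by rewrite -d_m.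
case m'E : (N.div _ _) => [//|m'].
have mE : (Pos.to_nat m = Pos.to_nat d * Pos.to_nat m')%N.
  exact: Npos_div_exact d_m m'E.
have m'_m : (Pos.to_nat m' %| Pos.to_nat m)%N by rewrite mE dvdn_mull.
have m'_odd : odd (Pos.to_nat m') := dvdn_odd m'_m m_odd.
have nS' := noSmall_dvd m'_m nS.
have l_dm' : (l %| Pos.to_nat d)%N || (l %| Pos.to_nat m')%N by rewrite -Euclid_dvdM // -mE.
have l_d : (l %| Pos.to_nat d)%N -> l = Pos.to_nat d.
  by move=> l_d; have := dvdn_leq _ l_d; have := nS l l_prime l_m; lia.
have := pmod_eq0 m' d; case: (pmod m' d) => [|z] d_m'.
  move=> E; apply: (IHf _ _ _ E) => //.
  by case/orP: l_dm' => [/l_d ->|//]; rewrite -d_m'.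
case E : (pfac _ _ _) => [r'|//] [<-] /=; rewrite inE.
case/orP: l_dm' => [/l_d ->|l_m']; first by rewrite eqxx.
have d2_odd : odd (Pos.to_nat (d + 2)) by rewrite to_nat_add2 /= negbK.
have nS2 : noSmall m' (d + 2) by apply: noSmall_step => //; rewrite -d_m'.
by rewrite (IHf _ _ _ E m'_odd d2_odd nS2 l l_prime l_m') orbT.
Qed.

(** By the invariant, the first trial divisor that divides [p ^ e] is [p] itself, and the cofactor
    is again a power of [p]. *)
Lemma pfac_prime_power (f : nat) (m d : positive) (r : list N) (p e : nat) :
  pfac f m d = Some r -> odd (Pos.to_nat m) -> odd (Pos.to_nat d) -> (1 < Pos.to_nat d)%N ->
  noSmall m d -> prime p -> Pos.to_nat m = (p ^ e)%N -> (size r <= 1)%N.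
Proof.
move=> E m_odd d_odd d_gt1 nS p_prime; elim: f m d r e E m_odd d_odd d_gt1 nS => [//|f IHf] m d r e.
case: (Pos.eq_dec m xH) => [->|m1]; first by move=> [<-].
move=> E m_odd d_odd d_gt1 nS mpe.
have {E} : (if Pos.ltb m (Pos.mul d d) then Some [:: Npos m] else
    if pmod m d is N0 then
      if N.div (Npos m) (Npos d) is Npos m' then
        if pmod m' d is N0 then pfac f m' d
        else if pfac f m' (Pos.add d 2) is Some r then Some (Npos d :: r) else None
      else None
    else pfac f m (Pos.add d 2)) = Some r by move: E => /=; case: (m) m1.
case: Pos.ltb_spec => [m_lt [<-]//|_].
have := pmod_eq0 m d; case dmE : (pmod m d) => [|z] d_m; last first.
  have d2_odd : odd (Pos.to_nat (d + 2)) by rewrite to_nat_add2 /= negbK.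
  have d2_gt1 : (1 < Pos.to_nat (d + 2))%N by rewrite to_nat_add2.
  have nS2 : noSmall m (d + 2) by apply: noSmall_step => //; rewrite -d_m.
  by move=> E; apply: (IHf _ _ _ _ E m_odd d2_odd d2_gt1 nS2 mpe).
have {}d_m : (Pos.to_nat d %| Pos.to_nat m)%N by rewrite -d_m.
case m'E : (N.div _ _) => [//|m'].
have mE : (Pos.to_nat m = Pos.to_nat d * Pos.to_nat m')%N.
  exact: Npos_div_exact d_m m'E.
have m'_m : (Pos.to_nat m' %| Pos.to_nat m)%N by rewrite mE dvdn_mull.
have m'_odd : odd (Pos.to_nat m') := dvdn_odd m'_m m_odd.
have nS' := noSmall_dvd m'_m nS.
have dp : Pos.to_nat d = p.
  move: d_m; rewrite mpe => /(dvdn_pfactor _ _ p_prime)[i i_e dE].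
  have i_gt0 : (0 < i)%N by case: i dE i_e => // dE _; move: d_gt1; rewrite dE.
  have : (Pos.to_nat d <= p)%N.
    by apply: nS => //; rewrite mE dvdn_mulr // dE dvdn_exp.
  rewrite dE -{2}[p]expn1 leq_exp2l ?prime_gt1 // => i_le1.
  by have -> : i = 1%N by apply/eqP; rewrite eqn_leq i_le1.
case: e mpe => [mpe|e]; first by move: d_gt1; rewrite mE in mpe; nia.
rewrite mE dp expnS => /eqP; rewrite eqn_pmul2l ?prime_gt0 // => /eqP m'pe.
have := pmod_eq0 m' d; case: (pmod m' d) => [|z] d_m'.
  by move=> E; apply: (IHf _ _ _ _ E m'_odd d_odd d_gt1 nS' m'pe).
have m'1 : m' = xH.
  case: e m'pe => [|e] m'pe; first by lia.
  by move: d_m'; rewrite m'pe dp expnS dvdn_mulr.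
by rewrite m'1; case: (f) => [|f'] //= [<-].
Qed.

End TrialDivision.

Lemma pfac_odd_complete (m : N) (r : list N) : pfac_odd m = Some r ->
  forall l, prime l -> odd l -> (l %| N.to_nat m)%N -> l \in map N.to_nat r.
Proof.
case: m => [//|a]; rewrite /pfac_odd; move: 400%N => f E l l_prime l_odd; rewrite [N.to_nat _]/=.
have [a_odd [k ->]] := odd_partE a => l_a.
apply: (pfac_complete E) => // [l' l'_prime l'_a|].
  by rewrite odd_prime_gt2 // (dvdn_odd l'_a).
by move: l_a => /=; rewrite Gauss_dvdr // coprimeXr // coprimen2.
Qed.

Lemma candidate_prime_power (q : N) (p e : nat) :
  prime p -> odd (N.to_nat q) -> N.to_nat q = (p ^ e)%N -> candidate q.
Proof.
case: q => [|a] // p_prime a_odd aE; rewrite /candidate /pfac_odd.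
move: 400%N => f; case E : (pfac _ _ _) => [[|x [|y r]]|] //.
have oaE : odd_part a = a by case: a a_odd {aE E} => //= a; lia.
suff : (size [:: x, y & r] <= 1)%N by [].
rewrite oaE in E; apply: (pfac_prime_power E) aE => // l l_prime l_a.
by rewrite odd_prime_gt2 // (dvdn_odd l_a).
Qed.

Local Open Scope ring_scope.

(** * Evaluation of coefficient lists in a ring *)

Section Evaluation.
Variables (R : comNzRingType) (g : R) (p : N) (M : list N).
Hypothesis p0 : (N.to_nat p)%:R = 0 :> R.

Definition veval (v : list N) : R := foldr (fun a r => (N.to_nat a)%:R + g * r) 0 v.

Let mu : R := g ^+ size M - veval M.

(* Congruence modulo the defining relation: for [g = 'X] it is what produces a root of [mu], and it
   is equality once [g] is that root. *)
Definition vcong (x y : R) : Prop := exists c, x = y + c * mu.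

Lemma vcong_refl x : vcong x x.
Proof. by exists 0; rewrite mul0r addr0. Qed.

Lemma vcong_mul x x' y y' : vcong x x' -> vcong y y' -> vcong (x * y) (x' * y').
Proof. by case=> c -> [d ->]; exists (x' * d + c * y' + c * d * mu); ring. Qed.

Lemma vcong_trans x y z : vcong x y -> vcong y z -> vcong x z.
Proof. by case=> c -> [d ->]; exists (d + c); ring. Qed.

Lemma vcong_exp x y i : vcong x y -> vcong (x ^+ i) (y ^+ i).
Proof.
move=> xy; elim: i => [|i IH]; first exact: vcong_refl.
by rewrite !exprS; apply: vcong_mul.
Qed.

Lemma natr_Nmod (a : N) : (N.to_nat (Nmod a p))%:R = (N.to_nat a)%:R :> R.
Proof.
rewrite NmodE [in RHS](divn_eq (N.to_nat a) (N.to_nat p)) natrD natrM p0.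
by rewrite mulr0 add0r.
Qed.

Lemma veval_zeros (T : Type) (s : list T) : veval (map (fun=> N0) s) = 0.
Proof. by elim: s => //= _ s ->; rewrite mulr0 addr0. Qed.

Lemma size_vstep top c prev acc m b : size acc = size m -> size b = size m ->
  size (vstep p top c prev acc m b) = size m.
Proof. by elim: m prev acc b => [|x m IH] prev [|a acc] [|y b] //= [sa] [sb]; rewrite IH. Qed.

(** Multiplication by X pushes the last entry of [acc] out to degree [size m]. Keeping this term on
    the left, with [top] independent of it, makes the induction work; in [vmul] the two coefficients
    agree and combine into a multiple of [mu]. *)
Lemma veval_vstep top c prev acc m b : size acc = size m -> size b = size m ->
  veval (vstep p top c prev acc m b) + (N.to_nat (last prev acc))%:R * g ^+ size m =
  (N.to_nat prev)%:R + g * veval acc + (N.to_nat top)%:R * veval m + (N.to_nat c)%:R * veval b.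
Proof.
elim: m prev acc b => [|x m IH] prev [|a acc] [|y b] //=.
  by move=> _ _; rewrite expr0; ring.
move=> [sa] [sb]; have := IH a acc b sa sb.
rewrite natr_Nmod !N2Nat.inj_add !N2Nat.inj_mul !natrD !natrM exprS.
set X := veval (vstep _ _ _ _ _ _ _); set l := (N.to_nat (last _ _))%:R => E.
set A := _ + (_ + _).
have -> : A + g * X + l * (g * g ^+ size m) = A + g * (X + l * g ^+ size m) by ring.
by rewrite E /A; ring.
Qed.

Lemma size_vmul u v : size v = size M -> size (vmul p M u v) = size M.
Proof. by move=> sv; elim: u => [|c u IH] /=; rewrite ?size_map ?size_vstep. Qed.

Lemma veval_vmul u v : size v = size M -> vcong (veval (vmul p M u v)) (veval u * veval v).
Proof.
move=> sv; elim: u => [|c u IH] /=.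
  by rewrite /vmul /= veval_zeros mul0r; apply: vcong_refl.
have [d IHd] := IH; set acc := vmul p M u v in IHd *.
have sacc : size acc = size M by apply: size_vmul.
have := veval_vstep (last N0 acc) c N0 sacc sv.
rewrite -/(vmul p M (c :: u) v) /= -/(vmul p M u v) -/acc => E.
exists (g * d + - (N.to_nat (last N0 acc))%:R); rewrite mulrDl.
move: E; set Y := veval (vstep _ _ _ _ _ _ _) => E.
have -> : Y = Y + (N.to_nat (last N0 acc))%:R * g ^+ size M - (N.to_nat (last N0 acc))%:R * g ^+ size M by ring.
by rewrite E IHd /mu; ring.
Qed.

Lemma vpow_spec (e : positive) (k : nat) (b : list N) :
  (Pos.size_nat e <= k)%N -> size b = size M ->
  size (vpow p M e (vpows p M k b)) = size M /\
  vcong (veval (vpow p M e (vpows p M k b))) (veval b ^+ Pos.to_nat e).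
Proof.
elim: e k b => [e IH|e IH|] [|k] b //= ek sb.
- have [sz IHe] := IH k (vmul p M b b) ek (size_vmul _ sb).
  split; first by rewrite size_vmul.
  apply: vcong_trans (veval_vmul _ sz) _.
  have -> : Pos.to_nat e~1 = (2 * Pos.to_nat e).+1 by lia.
  rewrite exprS exprM; apply: vcong_mul; first exact: vcong_refl.
  by apply: vcong_trans IHe _; apply: vcong_exp; rewrite expr2; apply: veval_vmul.
- have [sz IHe] := IH k (vmul p M b b) ek (size_vmul _ sb).
  split=> //; have -> : Pos.to_nat e~0 = (2 * Pos.to_nat e)%N by lia.
  rewrite exprM; apply: vcong_trans IHe _.
  by apply: vcong_exp; rewrite expr2; apply: veval_vmul.
- by split=> //; rewrite expr1; apply: vcong_refl.
Qed.

Lemma veval_vadd u v : size u = size v -> veval (vadd p u v) = veval u + veval v.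
Proof.
elim: u v => [|x u IH] [|y v] //= => [_|[suv]]; first by rewrite addr0.
by rewrite natr_Nmod N2Nat.inj_add natrD IH //; ring.
Qed.

Lemma size_vadd u v : size u = size v -> size (vadd p u v) = size v.
Proof. by elim: u v => [|x u IH] [|y v] //= [/IH ->]. Qed.

End Evaluation.

Lemma veqE u v : veq u v -> u = v.
Proof.
by elim: u v => [|x u IH] [|y v] //= /andP[/N.eqb_spec -> /IH ->].
Qed.

(** If [m + y] is divisible by [l] for some [y] in [a], the elements to avoid are those congruent to
    [y] modulo [l], and the branch that removes this residue serves; if there is no such [y], every
    branch serves. *)
Lemma cover_spec (ls a : list N) : cover ls a ->
  forall m : nat, exists2 x, List.In x a &
    forall l, List.In l ls -> l <> N0 -> ~~ (N.to_nat l %| m + N.to_nat x)%N.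
Proof.
have NundupP (s : list N) x : List.In x s -> List.In x (Nundup s).
  elim: s => //= y s IH; case: ifP => [ys|_] [yx|/IH] //=; last 2 first.
  - by left.
  - by right.
  apply: IH; rewrite -yx {x yx}; elim: s ys => //= z s IH /orP[/N.eqb_spec ->|/IH]; first by left.
  by right.
have allIn (P : pred N) (s : list N) x : all P s -> List.In x s -> P x.
  by elim: s => //= y s IH /andP[Py /IH Ps] [<-|/Ps].
have In_map (f : N -> N) (s : list N) x : List.In x s -> List.In (f x) (map f s).
  by elim: s => //= y s IH [->|/IH]; [left|right].
have In_filter (P : pred N) (s : list N) x : List.In x (filter P s) -> List.In x s /\ P x.
  elim: s => //= y s IH; case: ifP => [Py /= [<-|/IH[]]|_ /IH[]].
  - by split=> //; left.
  - by split=> //; right.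
  - by split=> //; right.
elim: ls a => [|l ls IH] [|x0 a'] //; set a := x0 :: a'.
  by move=> _ m; exists x0; [left|].
move=> cov m.
have {}cov : all (fun r => cover ls (filter (fun x => ~~ N.eqb (Nmod x l) r) a))
        (Nundup (map (fun x => Nmod x l) a)) by exact: cov.
have branch y : List.In y a -> exists2 x, List.In x a /\ Nmod x l <> Nmod y l &
    forall l', List.In l' ls -> l' <> N0 -> ~~ (N.to_nat l' %| m + N.to_nat x)%N.
  move=> ya; have yr : List.In (Nmod y l) (Nundup (map (fun x => Nmod x l) a)).
    by apply/NundupP; apply: (In_map (fun x => Nmod x l)).
  have [x xa xls] := IH _ (allIn _ _ _ cov yr) m.
  move: xa => /In_filter[xa xy]; exists x => //.
  by split=> // E; move: xy; rewrite E N.eqb_refl.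
have [|none] := boolP (has (fun x => (N.to_nat l %| m + N.to_nat x)%N) a).
  have hasIn (P : pred N) (s : list N) : has P s -> exists2 x, List.In x s & P x.
    elim: s => //= y s IHs /orP[Py|/IHs[x xs Px]]; first by exists y; [left|].
    by exists x; [right|].
  case/hasIn=> y ya y_m; have [x [xa xy] xls] := branch y ya.
  exists x => // l' [<- l0|]; last exact: xls.
  apply/negP => x_m; apply: xy; apply: N2Nat.inj; rewrite !NmodE.
  apply/eqP; rewrite -(eqn_modDl m); move: x_m y_m; rewrite /dvdn.
  by move=> /eqP -> /eqP ->.
have [x [xa _] xls] := branch x0 (or_introl erefl).
exists x => // l' [<- l0|]; last exact: xls.
apply: contra none => x_m; elim: (a) xa => //= y s IHs [->|/IHs ->]; first by rewrite x_m.
by rewrite orbT.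
Qed.

Lemma prim_root_by_primes (R : fieldType) (n : nat) (z : R) : (0 < n)%N -> z ^+ n = 1 ->
  (forall l, prime l -> (l %| n)%N -> z ^+ (n %/ l) != 1) -> n.-primitive_root z.
Proof.
move=> n_gt0 zn Hl; have [m mP m_n] := prim_order_exists n_gt0 zn.
have [<- //|m_neq] := eqVneq m n.
have nm_gt1 : (1 < n %/ m)%N.
  rewrite ltn_neqAle eq_sym divn_gt0 ?(dvdn_gt0 n_gt0 m_n) // (dvdn_leq n_gt0 m_n) andbT.
  by apply: contra m_neq => /eqP nm1; rewrite -(divnK m_n) nm1 mul1n.
have l_prime := pdiv_prime nm_gt1; set l := pdiv _ in l_prime.
have l_nm : (l %| n %/ m)%N by apply: pdiv_dvd.
have l_n : (l %| n)%N by rewrite -(divnK m_n) dvdn_mulr.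
case/negP: (Hl l l_prime l_n); rewrite -(prim_order_dvd mP).
by rewrite -[X in (X %/ _)%N](divnK m_n) -divn_mulAC // dvdn_mull.
Qed.

Lemma NdivE (a b : N) : N.to_nat (N.div a b) = (N.to_nat a %/ N.to_nat b)%N.
Proof.
case: b => [|b]; first by case: a.
have b0 : Npos b <> N0 by [].
have r_lt := N.mod_lt a (Npos b) b0; have aE := N.div_mod a (Npos b) b0.
set r := N.modulo a _ in r_lt aE; set k := N.div a _ in aE *.
have -> : N.to_nat a = (N.to_nat k * N.to_nat (Npos b) + N.to_nat r)%N by lia.
rewrite divnMDl; last by lia.
by rewrite divn_small ?addn0 //; lia.
Qed.

(** * Translates obtained from relations between powers *)

Section Direct.
Variables (F : finFieldType) (L : fieldExtType F).
Hypothesis dimL : \dim {:L} = 2%N.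
Let q := #|F|.
Let n := (q ^ 2 - 1)%N.

Lemma pchar_card : exists2 p, p \in [pchar L] & p.-nat q.
Proof.
have [p p_prime pF] := finPcharP F; exists p.
  by rewrite (fmorph_pchar (in_alg L)).
by have := pprimeChar_pgroup pF; rewrite /pgroup cardsT.
Qed.

Lemma natr_card : q%:R = 0 :> L.
Proof.
have [p pL pq] := pchar_card; apply/eqP; rewrite -(dvdn_pcharf pL).
have q_gt1 : (1 < q)%N := finNzRing_gt1 F.
have q_pi : pdiv q \in \pi(q) by rewrite pi_pdiv.
have := pnatPpi pq q_pi; rewrite inE /= => /eqP <-.
exact: pdiv_dvd.
Qed.

Lemma expf_cardD (x y : L) : (x + y) ^+ q = x ^+ q + y ^+ q.
Proof.
by have [p pL pq] := pchar_card; rewrite exprDn_pchar // (eq_pnat _ (pcharf_eq pL)).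
Qed.

Lemma expf_cardN (x : L) : odd q -> (- x) ^+ q = - x ^+ q.
Proof. by move=> q_odd; rewrite exprNn -signr_odd q_odd mulN1r. Qed.

Lemma translate_direct (g : L) (JH : seq (nat * nat)) :
  odd q -> n.-primitive_root g ->
  {in JH, forall jh, [/\ g ^+ (q * jh.1) = g ^+ jh.1 + g ^+ jh.2, (jh.2 <= n)%N &
     (jh.2 = (q + 1) %/ 2 %[mod q + 1])%N]} ->
  (forall m, (m = (q + 1) %/ 2 %[mod q + 1])%N ->
     exists2 jh, jh \in JH & gcdn (m + (n - jh.2) + jh.1) n = 2%N) ->
  translate_property L 2.
Proof.
move=> q_odd gP HJ cov theta /(generator_notin1 dimL) theta1.
have q_gt0 : (0 < q)%N by case: (q) q_odd.
pose d := theta ^+ q - theta.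
have d0 : d != 0 by apply: contra theta1; rewrite /d subr_eq0 mem1_expf.
have [m dE] := prim_rootX dimL gP d0.
have dq : d ^+ q = - d.
  rewrite /d expf_cardD expf_cardN // -exprM mulnn quadratic_expf //.
  by rewrite opprB addrC.
have n_fact : n = ((q - 1) * (q + 1))%N by rewrite /n sub1_sqr_fact mulnC.
have two0 : (2%:R : L) != 0.
  apply/eqP => two0; have := natr_card; rewrite -[q in LHS]odd_double_half q_odd natrD.
  by rewrite -muln2 natrM two0 mulr0 addr0 => /eqP; rewrite oner_eq0.
have d_neq : - d != d.
  by rewrite -subr_eq0 -opprD -mulr2n oppr_eq0 -mulr_natr mulf_neq0.
(* Frobenius fixes [d ^ 2] but not [d], the characteristic being odd. So [q + 1] divides [m * 2] and
   not [m]: the exponent is an odd multiple of [(q + 1) / 2]. *)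
have m_half : (m = (q + 1) %/ 2 %[mod q + 1])%N.
  have dq2 : (d ^+ 2) ^+ q = d ^+ 2 by rewrite -exprM mulnC exprM dq sqrrN.
  have : (q + 1 %| m * 2)%N.
    by rewrite -(prim_rootX_mem1 _ gP) mem1_expf exprM -dE dq2.
  have : ~~ (q + 1 %| m)%N by rewrite -(prim_rootX_mem1 _ gP) mem1_expf -dE dq.
  have -> : (q + 1 = ((q + 1) %/ 2) * 2)%N by rewrite divnK // dvdn2 oddD q_odd.
  set h := ((q + 1) %/ 2)%N; rewrite dvdn_pmul2r // mulnK // => nm /dvdnP[u mE].
  have u_odd : odd u.
    by apply: contraR nm; rewrite -dvdn2 => /dvdnP[v vE]; rewrite mE vE -mulnA [(2 * h)%N]mulnC dvdn_mull.
  have -> : m = (u./2 * (h * 2) + h)%N.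
    by rewrite mE -[u in LHS]odd_double_half u_odd; lia.
  by rewrite modnMDl.
have [[j h] jhJ /= gcd2] := cov m m_half.
have [/= rel h_n h_half] := HJ _ jhJ.
set i := (m + (n - h))%N in gcd2.
have c1 : g ^+ i \in 1%VS.
  rewrite prim_rootX_mem1 // /i.
  have : (m + (n - h) + h = 0 + h %[mod q + 1])%N.
    rewrite -addnA subnK // add0n h_half -m_half n_fact addnC modnMDl //.
  by move/eqP; rewrite eqn_modDr mod0n.
(* The factor [g ^ i] is fixed by Frobenius and comes out of [b ^ q - b], leaving
   [g ^ (i + h) = g ^ (m + n) = d]. Then Frobenius fixes [b - theta], so [b] is a translate of
   [theta]. *)
pose b := g ^+ (i + j).
have bq : b ^+ q - b = d.
  rewrite /b exprD exprMn; move: c1; rewrite mem1_expf => /eqP ->.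
  rewrite -exprM mulnC rel mulrDr addrC addKr -exprD /i -addnA subnK //.
  by rewrite exprD (prim_expr_order gP) mulr1 dE.
have : b - theta \in 1%VS.
  rewrite mem1_expf expf_cardD expf_cardN // -subr_eq0.
  have -> : b ^+ q - theta ^+ q - (b - theta) = (b ^+ q - b) - d by rewrite /d; ring.
  by rewrite bq subrr.
case/mem1_alg=> x xE; exists x; rewrite -xE addrC subrK.
exact: r_primitive2_exp gcd2.
Qed.

End Direct.

(** * Soundness of the certificates *)

Lemma Npos_ofE (e : N) : (0 < N.to_nat e)%N -> Pos.to_nat (Npos_of e) = N.to_nat e.
Proof. by case: e. Qed.

Lemma Pos_size_nat_leq (a b : positive) : (Pos.to_nat a <= Pos.to_nat b)%N ->
  (Pos.size_nat a <= Pos.size_nat b)%N.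
Proof.
move=> ab; case: (Pos.eq_dec a b) => [-> //|nab].
by apply/ssrnat.leP; apply: Pos.size_nat_monotone; lia.
Qed.

Section PowerTable.
Variables (R : comNzRingType) (g : R) (q p : N) (M : list N).
Hypotheses (p0 : (N.to_nat p)%:R = 0 :> R) (M_gt1 : (1 < size M)%N).

Lemma size_vX : size (vX M) = size M.
Proof. by rewrite /= size_map !size_behead; lia. Qed.

Lemma veval_vX : veval g (vX M) = g.
Proof. by rewrite /= veval_zeros mulr0 addr0 -[_%:R]/(0 : R) add0r mulr1. Qed.

Lemma veval_vone : veval g (vone M) = 1.
Proof. by rewrite /= veval_zeros mulr0 addr0. Qed.

Lemma veval_vminus1 : (0 < N.to_nat p)%N -> veval g (vminus1 p M) = -1.
Proof.
move=> p_gt0; rewrite /= veval_zeros mulr0 addr0.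
have -> : N.to_nat (p - 1) = (N.to_nat p - 1)%N by lia.
by rewrite natrB // p0 sub0r.
Qed.

Lemma Xpows_spec (e : N) : (0 < N.to_nat e <= N.to_nat (cert_n q))%N ->
  size (vpow p M (Npos_of e) (Xpows q p M)) = size M /\
  vcong g M (veval g (vpow p M (Npos_of e) (Xpows q p M))) (g ^+ N.to_nat e).
Proof.
case/andP=> e_gt0 e_n; have n_gt0 := leq_trans e_gt0 e_n.
have sz : (Pos.size_nat (Npos_of e) <= Pos.size_nat (Npos_of (cert_n q)))%N.
  by apply: Pos_size_nat_leq; rewrite !Npos_ofE.
have := vpow_spec g p0 sz size_vX.
by rewrite veval_vX Npos_ofE.
Qed.

End PowerTable.

Lemma horner_veval (R : comNzRingType) (x : R) (v : list N) :
  (veval 'X v).[x] = veval x v.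
Proof. by elim: v => /= [|a v IH]; rewrite ?horner0 // hornerD hornerM hornerX IH -polyC_natr hornerC. Qed.

Lemma size_veval (R : comNzRingType) (v : list N) :
  (size (veval 'X v : {poly R}) <= size v)%N.
Proof.
elim: v => [|a v IH] /=; first by rewrite size_poly0.
rewrite -polyC_natr (leq_trans (size_polyD _ _)) // geq_max.
rewrite (leq_trans (size_polyC_leq1 _)) //=.
by rewrite mulrC; case: (eqVneq (veval 'X v : {poly R}) 0) => [->|nz]; rewrite ?mul0r ?size_poly0 // size_mulX.
Qed.

Section Root.
Variables (F : finFieldType) (L : fieldExtType F).
Hypothesis dimL : \dim {:L} = 2%N.
Let n := (#|F| ^ 2 - 1)%N.

(** The congruence says that [mu] divides [X ^ n - 1], which over [L] is the product of the linear
    factors at the powers of a primitive root. As [mu] has positive degree, one of these powers is a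
    root of it. *)
Lemma vcong_root (M : list N) : (1 < size M)%N ->
  vcong ('X : {poly L}) M 1 ('X ^+ n) -> exists g : L, g ^+ size M = veval g M.
Proof.
move=> M_gt1 [c cE]; pose mu : {poly L} := 'X^(size M) - veval 'X M.
have size_mu : size mu = (size M).+1.
  rewrite /mu size_polyDl ?size_polyXn // size_polyN ltnS; exact: size_veval.
have [g0 g0P] := exists_prim_root dimL.
have : mu %| 'X^n - 1.
  by apply/dvdpP; exists (- c); rewrite cE /mu; ring.
rewrite -(factor_Xn_sub_1 g0P) => /dvdp_prod_XsubC[m].
set s := mask _ _ => mu_s.
case sE : s => [|i s'] in mu_s.
  by move/eqp_size: mu_s; rewrite big_nil size_poly1 size_mu => -[]; lia.
exists (g0 ^+ i); have : root mu (g0 ^+ i).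
  by rewrite (eqp_root mu_s) big_cons rootM root_XsubC eqxx.
by rewrite /root /mu hornerD hornerN hornerXn horner_veval subr_eq0 => /eqP.
Qed.

End Root.

Lemma all_In (T : Type) (P : pred T) (s : list T) x : all P s -> List.In x s -> P x.
Proof. by elim: s => //= y s IH /andP[Py /IH Ps] [<-|/Ps]. Qed.

Lemma In_map_nat (l : nat) (s : list N) : l \in map N.to_nat s ->
  exists2 x, List.In x s & N.to_nat x = l.
Proof.
elim: s => //= y s IH; rewrite inE => /orP[/eqP ->|/IH[x xs <-]]; first by exists y; [left|].
by exists x; [right|].
Qed.

Lemma In_map_inv (T U : Type) (f : T -> U) (s : list T) y : List.In y (map f s) ->
  exists2 x, List.In x s & f x = y.
Proof.
elim: s => //= x s IH [<-|/IH[z zs <-]]; first by exists x; [left|].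
by exists z; [right|].
Qed.

Lemma In_zip (T U : Type) (s : list T) (t : list U) x : size t = size s -> List.In x s ->
  exists y, List.In (x, y) (zip s t).
Proof.
elim: s t => [|z s IH] [|w t] //= [st] [->|/(IH _ st)[y yP]]; first by exists w; left.
by exists y; right.
Qed.

Lemma leq_to_nat (a b : N) : (a <= b)%num -> (N.to_nat a <= N.to_nat b)%N.
Proof. by lia. Qed.

Lemma ltn_to_nat (a b : N) : (a < b)%num -> (N.to_nat a < N.to_nat b)%N.
Proof. by lia. Qed.

Section CertSound.
Variables (F : finFieldType) (L : fieldExtType F).
Hypothesis dimL : \dim {:L} = 2%N.
Let q := #|F|.
Let n := (q ^ 2 - 1)%N.
Hypothesis q_odd : odd q.
Variables (Q p : N) (M : list N) (invs : list (list N)) (jes : list (N * N)) (l1 l2 : list N).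
Hypotheses (QE : N.to_nat Q = q) (E1 : pfac_odd (N.sub Q 1) = Some l1)
  (E2 : pfac_odd (N.add Q 1) = Some l2).

Let q_gt1 : (1 < q)%N := finNzRing_gt1 F.

Let nE : N.to_nat (cert_n Q) = n.
Proof. by rewrite /cert_n /n -QE; lia. Qed.

Let n_gt0 : (0 < n)%N.
Proof. by rewrite /n sub1_sqr_fact muln_gt0 addn1 subn_gt0. Qed.

Let halfE : N.to_nat (cert_half Q) = ((q + 1) %/ 2)%N.
Proof. by rewrite /cert_half NdivE N2Nat.inj_add QE. Qed.

Let expE e : N.to_nat (cert_exp Q e) = ((q + 1) %/ 2 + (q + 1) * N.to_nat e)%N.
Proof. by rewrite /cert_exp N2Nat.inj_add halfE N2Nat.inj_mul N2Nat.inj_add QE. Qed.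

Let mem_primes_n l : prime l -> odd l -> (l %| n)%N ->
  (l \in map N.to_nat l1) || ((l %| q + 1)%N && (l \in map N.to_nat l2)).
Proof.
move=> l_prime l_odd; rewrite /n sub1_sqr_fact Euclid_dvdM // => /orP[l_q|l_q].
  apply/orP; right; rewrite l_q; apply: (pfac_odd_complete E2) => //.
  by rewrite N2Nat.inj_add QE.
apply/orP; left; apply: (pfac_odd_complete E1) => //.
by rewrite N2Nat.inj_sub QE.
Qed.

Lemma field_ok_sound : (1 < size M)%N -> N.pow p (N.of_nat (size M)) = N.mul Q Q ->
  field_ok Q p M invs (Npos 2 :: l1 ++ l2) jes (Xpows Q p M) ->
  exists2 g : L, n.-primitive_root g &
    forall je, List.In je jes ->
      g ^+ (q * N.to_nat je.1) = g ^+ N.to_nat je.1 + g ^+ N.to_nat (cert_exp Q je.2) /\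
      (N.to_nat (cert_exp Q je.2) <= n)%N.
Proof.
move=> M_gt1 pM /and4P[/veqE Xn /eqP size_invs ord_ok rel_ok].
have pM' : (N.to_nat p ^ size M = q * q)%N.
  rewrite -QE -multE -N2Nat.inj_mul -pM N2Nat.inj_pow Nat2N.id.
  by elim: (size M) => //= m <-; rewrite expnS.
have p_gt0 : (0 < N.to_nat p)%N.
  rewrite lt0n; apply/negP => /eqP p0; move: pM'; rewrite p0 exp0n; last by lia.
  by nia.
(* A power of [p] is [q ^ 2], which vanishes in [L]; this is what makes arithmetic modulo [p] valid
   there. *)
have pL : (N.to_nat p)%:R = 0 :> L.
  have /eqP : ((N.to_nat p)%:R : L) ^+ size M = 0 by rewrite -natrX pM' natrM natr_card mul0r.
  by rewrite expf_eq0 => /andP[_ /eqP].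
have pX : (N.to_nat p)%:R = 0 :> {poly L} by rewrite -polyC_natr pL.
have nN : (0 < N.to_nat (cert_n Q) <= N.to_nat (cert_n Q))%N by rewrite nE n_gt0 leqnn.
(* The check that the n-th power of X is 1 is used twice: first over [{poly L}] to produce [g], then
   at [g], where congruences have become equalities. *)
have [g gM] : exists g : L, g ^+ size M = veval g M.
  apply: (vcong_root dimL M_gt1); have [_] := Xpows_spec 'X pX M_gt1 nN.
  by rewrite nE Xn veval_vone.
have eqL x y : vcong g M x y -> x = y by case=> c ->; rewrite gM subrr mulr0 addr0.
have powL e : (0 < N.to_nat e <= n)%N ->
    size (vpow p M (Npos_of e) (Xpows Q p M)) = size M /\
    veval g (vpow p M (Npos_of e) (Xpows Q p M)) = g ^+ N.to_nat e.
  by rewrite -nE => /(Xpows_spec g pL M_gt1)[sz /eqL].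
have gn : g ^+ n = 1.
  have n_range : (0 < N.to_nat (cert_n Q) <= n)%N by rewrite nE n_gt0 leqnn.
  by have [_] := powL _ n_range; rewrite nE Xn veval_vone => <-.
have q_n : (q <= n)%N by rewrite /n sub1_sqr_fact (leq_trans (leq_addr 1 q)) // leq_pmulr // subn_gt0.
exists g => [|je je_jes].
  apply: prim_root_by_primes => // l l_prime l_n.
  have : l \in map N.to_nat (Npos 2 :: l1 ++ l2).
    rewrite /= inE map_cat mem_cat; have [l_odd|] := boolP (odd l).
      by case/orP: (mem_primes_n l_prime l_odd l_n) => [->|/andP[_ ->]]; rewrite !orbT.
    by case: (even_prime l_prime) => [->|->].
  case/In_map_nat => x /(In_zip size_invs)[u xu xl].
  have := all_In ord_ok xu; rewrite /order_ok [(x, u).1]/= [(x, u).2]/= => /veqE /(congr1 (veval g)).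
  have e_n : (0 < N.to_nat (N.div (cert_n Q) x) <= n)%N.
    by rewrite NdivE nE xl leq_div divn_gt0 ?prime_gt0 // dvdn_leq.
  have [sz ev] := powL _ e_n.
  have s1 : size (vminus1 p M) = size M by rewrite /= size_map size_behead; lia.
  have sv : size (vadd p (vpow p M (Npos_of (N.div (cert_n Q) x)) (Xpows Q p M)) (vminus1 p M)) = size M.
    by rewrite size_vadd s1 // sz.
  rewrite (eqL _ _ (veval_vmul g pL u sv)) (veval_vadd g pL) ?sz ?s1 // ev.
  rewrite (veval_vminus1 g pL M_gt1 p_gt0) veval_vone.
  rewrite NdivE nE xl => inv1; apply/eqP => g1; move: inv1.
  by rewrite g1 subrr mulr0 => /esym/eqP; rewrite oner_eq0.
have := all_In rel_ok je_jes; case: je {je_jes} => j e /=.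
case/and5P=> /N.leb_spec0 h_n /N.ltb_spec0 j_gt0 /N.ltb_spec0 j_128 /N.leb_spec0 j_n /veqE /(congr1 (veval g)).
have {}h_n : (N.to_nat (cert_exp Q e) <= n)%N by rewrite -nE leq_to_nat.
have h_gt0 : (0 < N.to_nat (cert_exp Q e))%N by rewrite expE; lia.
have {}j_n : (0 < N.to_nat j <= n)%N by rewrite -nE (leq_to_nat j_n) (ltn_to_nat j_gt0).
have [sj evj] := powL _ j_n.
have h_range : (0 < N.to_nat (cert_exp Q e) <= n)%N by rewrite h_gt0.
have [sh evh] := powL _ h_range.
have q_range : (0 < N.to_nat Q <= n)%N by rewrite QE q_n ltnW.
have [sq evq] := powL _ q_range.
have j7 : (Pos.size_nat (Npos_of j) <= 7)%N.
  apply: (@Pos_size_nat_leq _ 127); rewrite Npos_ofE ?(ltn_to_nat j_gt0) //.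
  exact: (ltn_to_nat j_128).
have [_ /eqL ->] := vpow_spec g pL j7 sq.
rewrite (veval_vadd g pL) ?sj ?sh // evj evh evq Npos_ofE; last by case/andP: j_n.
by rewrite QE -exprM => ->.
Qed.

Lemma cover_ok_sound : cover_ok Q l1 l2 jes ->
  forall m, (m = (q + 1) %/ 2 %[mod q + 1])%N ->
    exists2 je, List.In je jes & gcdn (m + N.to_nat (cert_offset Q je)) n = 2%N.
Proof.
case/andP=> off_ok cov m m_half.
have [x xa xl] := cover_spec cov m.
have [je je_jes xE] := In_map_inv xa; exists je => //.
rewrite xE; have := all_In off_ok je_jes; rewrite /offset_ok xE.
set i := (m + N.to_nat x)%N; case/andP=> l2_ok mod4.
have n4 : (4 %| n)%N by apply: dvdn_trans (dvdn8_sqr_sub1 q_odd).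
have half2 : ((q + 1) %/ 2 * 2 = q + 1)%N by rewrite divnK // dvdn2 oddD q_odd.
(* Trivial core: residues modulo 4 settle the power of 2, and all odd primes take the part of the
   sieved ones. *)
apply: (@gcdn_eq2_sieve n 1 i [seq l <- primes n | odd l]) => //.
- by move=> l l_prime l_odd l_n; rewrite mem_filter mem_primes l_prime n_gt0 l_n l_odd orbT.
- have mE : m = (m %/ (q + 1) * (q + 1) + (q + 1) %/ 2)%N.
    by rewrite {1}(divn_eq m (q + 1)) m_half [((q + 1) %/ 2 %% _)%N]modn_small //; lia.
  have QmodE d : N.to_nat (Nmod Q d) = (q %% N.to_nat d)%N by rewrite NmodE QE.
  have xmodE (y d : N) : N.to_nat (Nmod y d) = (N.to_nat y %% N.to_nat d)%N := NmodE y d.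
  suff i2 : (i %% 4 = 2)%N by rewrite muln1 -gcdn_modl i2.
  case: ifP mod4 => [/N.eqb_spec q3 /N.eqb_spec x2|q1 /N.eqb_spec x1].
    have {}q3 : (q %% 4 = 3)%N by have := QmodE 4%num; rewrite q3.
    have {}x2 : ((N.to_nat x + (q + 1) %/ 2) %% 4 = 2)%N.
      by have := xmodE (x + cert_half Q)%num 4%num; rewrite x2 N2Nat.inj_add halfE.
    have [w wE] : exists w, (q + 1 = 4 * w)%N by exists ((q + 1) %/ 4)%N; lia.
    move: mE x2; rewrite /i wE; have -> : (4 * w %/ 2 = 2 * w)%N by lia.
    move=> -> x2; rewrite mulnCA mulnC -addnA modnMDl.
    by rewrite addnC.
  have {}q1 : (q %% 4 = 1)%N.
    have : (q %% 4 != 3)%N.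
      by apply/eqP => q3; move/negP: q1; apply; apply/N.eqb_spec; have := QmodE 4%num; rewrite q3; lia.
    by lia.
  have {}x1 : (N.to_nat x %% 2 = 1)%N by have := xmodE x 2%num; rewrite x1.
  have : ~~ (4 %| i)%N.
    apply: (xl 4%num) => //; rewrite ifF; first by left.
    by apply/negP => /N.eqb_spec q3; have := QmodE 4%num; rewrite q3 q1.
  have : (m %% 2 = 1)%N.
    have [w wE] : exists w, (q + 1 = 4 * w + 2)%N by exists ((q + 1) %/ 4)%N; lia.
    rewrite mE wE; have -> : ((4 * w + 2) %/ 2 = 2 * w + 1)%N by lia.
    have -> : (m %/ (4 * w + 2) * (4 * w + 2) + (2 * w + 1) =
      (m %/ (4 * w + 2) * (2 * w + 1) + w) * 2 + 1)%N by ring.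
    by rewrite modnMDl.
  by rewrite /i; lia.
move=> l; rewrite mem_filter mem_primes => /andP[l_odd /and3P[l_prime _ l_n]].
case/orP: (mem_primes_n l_prime l_odd l_n) => [/In_map_nat[y y1 yl]|].
  rewrite -yl; apply: xl; last by move=> y0; move: l_prime; rewrite -yl y0.
  by case: ifP => //; right.
case/andP=> l_q /In_map_nat[y y2 yl].
have l_m : (l %| m)%N.
  have l_h : (l %| (q + 1) %/ 2)%N.
    by move: l_q; rewrite -{1}half2 Gauss_dvdl // coprimen2.
  by rewrite /dvdn -(modn_dvdm m l_q) m_half modn_dvdm.
rewrite /i dvdn_addr //; apply: contra (all_In l2_ok y2).
by rewrite -yl /dvdn -NmodE => /eqP y0; apply/N.eqb_spec; lia.
Qed.

End CertSound.

Lemma cert_ok_sound (F : finFieldType) (L : fieldExtType F) (c : cert) :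
  \dim {:L} = 2%N -> odd #|F| -> N.to_nat (cert_q c) = #|F| -> cert_ok c ->
  translate_property L 2.
Proof.
case: c => Q p M invs jes dimL q_odd /= QE.
case E1 : (pfac_odd (N.sub Q 1)) => [l1|//]; case E2 : (pfac_odd (N.add Q 1)) => [l2|//].
case/and4P=> M_gt1 /N.eqb_spec pM f_ok c_ok.
have [g gP rel] := field_ok_sound dimL q_odd QE E1 E2 M_gt1 pM f_ok.
pose f (je : N * N) := (N.to_nat je.1, N.to_nat (cert_exp Q je.2)).
have In_mem (s : list (N * N)) je : List.In je s -> f je \in map f s.
  by elim: s => //= z s IH [->|/IH]; rewrite inE ?eqxx // => ->; rewrite orbT.
have mem_In (s : list (N * N)) jh : jh \in map f s -> exists2 je, List.In je s & jh = f je.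
  elim: s => //= z s IH; rewrite inE => /orP[/eqP ->|/IH[je je_s ->]]; first by exists z; [left|].
  by exists je; [right|].
apply: (translate_direct dimL (JH := map f jes) q_odd gP) => [jh /mem_In[je /rel[r1 r2] ->]|m m_half].
  split=> //=; rewrite /cert_exp /cert_half N2Nat.inj_add NdivE N2Nat.inj_add N2Nat.inj_mul.
  rewrite N2Nat.inj_add QE.
  rewrite -[X in (X %% _ = _)%N]/((#|F| + 1) %/ 2 + (#|F| + 1) * N.to_nat je.2)%N.
  by rewrite addnC mulnC modnMDl.
have [je je_jes gcd2] := cover_ok_sound dimL q_odd QE E1 E2 c_ok m_half.
exists (f je); first exact: In_mem.
have [_ r2] := rel je je_jes.
rewrite -[RHS]gcd2; congr gcdn; rewrite -addnA; congr (_ + _)%N.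
rewrite /cert_offset /f /= N2Nat.inj_sub N2Nat.inj_add.
have -> : N.to_nat (cert_n Q) = (#|F| ^ 2 - 1)%N by rewrite /cert_n -QE; lia.
exact: addnBAC.
Qed.

(** * Soundness of the numerical sieve *)

Lemma ler_sum_subset (T : eqType) (s t : seq T) (f : T -> rat) :
  uniq s -> {subset s <= t} -> (forall x, 0 <= f x) -> \sum_(x <- s) f x <= \sum_(x <- t) f x.
Proof.
move=> us st f0; elim: s t us st => [|x s IH] t /=.
  by move=> _ _; rewrite big_nil sumr_ge0.
case/andP=> xs us st; have xt := st x (mem_head _ _).
rewrite big_cons (big_rem x xt) /= lerD2l; apply: IH => // y ys.
have : y \in t by apply: st; rewrite inE ys orbT.
by rewrite (perm_mem (perm_to_rem xt)) inE => /orP[/eqP yx|//]; rewrite -yx ys in xs.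
Qed.

Section SieveSound.
Variables (F : finFieldType) (L : fieldExtType F).
Hypothesis dimL : \dim {:L} = 2%N.
Let q := #|F|.
Let n := (q ^ 2 - 1)%N.
Hypothesis q_odd : odd q.

Lemma sieve_ok_sound (Q : N) : N.to_nat Q = q -> sieve_ok Q -> translate_property L 2.
Proof.
move=> QE; rewrite /sieve_ok.
case E1 : (pfac_odd (N.sub Q 1)) => [l1|//]; case E2 : (pfac_odd (N.add Q 1)) => [l2|//].
have c_gt0 : (0 < N.to_nat sieve_scale)%N by apply: (@ltn_to_nat 0).
(* The argument runs for an arbitrary positive scale. *)
move: sieve_scale c_gt0 => C; set c := N.to_nat C => c_gt0.
set ls := filter _ _; set s := foldr (fun _ : N => N.succ) _ _; set t := foldr (fun _ => _) _ _.
set d := N.sub C t; case/andP=> /N.ltb_spec0 ineq /N.ltb_spec0 d_gt0.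
have sE : N.to_nat s = size ls.
  by rewrite /s; elim: (ls) => //= l ls' <-; rewrite N2Nat.inj_succ.
have tE : N.to_nat t = (\sum_(l <- map N.to_nat ls) (c %/ l).+1)%N.
  rewrite /t; elim: (ls) => [|l ls' IH] /=; first by rewrite big_nil.
  by rewrite big_cons N2Nat.inj_add N2Nat.inj_succ NdivE IH.
have dE : N.to_nat d = (c - N.to_nat t)%N by rewrite /d N2Nat.inj_sub.
have dn_gt0 : (0 < N.to_nat d)%N := ltn_to_nat d_gt0.
have {}ineq : (72 * (size ls * c + N.to_nat d) ^ 2 < q * N.to_nat d ^ 2)%N.
  rewrite -QE -sE; move: (ltn_to_nat ineq); rewrite !N2Nat.inj_mul N2Nat.inj_add N2Nat.inj_mul.
  by rewrite -!mulnn.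
pose S := [seq l <- primes n | odd l && (l != 3%N)].
have S_uniq : uniq S by rewrite filter_uniq // primes_uniq.
have S_ls : {subset S <= map N.to_nat ls}.
  move=> l; rewrite mem_filter mem_primes => /andP[/andP[l_odd l3] /and3P[l_prime _ l_n]].
  have : l \in map N.to_nat (l1 ++ l2).
    rewrite map_cat mem_cat; move: l_n; rewrite /n sub1_sqr_fact Euclid_dvdM // => /orP[l_q|l_q].
      apply/orP; right; apply: (pfac_odd_complete E2) => //.
      by rewrite N2Nat.inj_add QE.
    apply/orP; left; apply: (pfac_odd_complete E1) => //.
    by rewrite N2Nat.inj_sub QE.
  rewrite /ls; elim: (l1 ++ l2) => //= x r IH; rewrite inE => /orP[/eqP lx|/IH lr]; last first.
    by case: ifP; rewrite ?inE ?lr ?orbT.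
  case: ifP => [_|/negbFE/N.eqb_spec x3]; first by rewrite /= inE lx eqxx.
  by rewrite lx x3 in l3.
have cR : 0 < c%:R :> rat by rewrite ltr0n.
apply: (@sieve_translate3 F L dimL q_odd (size ls)%:R ((N.to_nat d)%:R / c%:R)).
- by rewrite ler_nat -(size_map N.to_nat ls); apply: uniq_leq_size S_uniq S_ls.
- by rewrite divr_gt0 ?ltr0n.
- apply: (le_trans (ler_sum_subset S_uniq S_ls _)) => [x|]; first by rewrite invr_ge0.
  rewrite dE natrB; last by move: dn_gt0; rewrite dE subn_gt0 => /ltnW.
  rewrite mulrBl divff ?gt_eqF // subKr tE natr_sum mulr_suml.
  apply: ler_sum => l _; rewrite ler_pdivlMr //.
  (* Entries of [ls] are not known here to be positive; the inverse of 0 is 0. *)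
  have [->|l_gt0] := posnP l; first by rewrite invr0 mul0r.
  rewrite mulrC ler_pdivrMr ?ltr0n // -natrM ler_nat.
  exact/ltnW/ltn_ceil.
move: ineq; rewrite -(ltr_nat rat) (natrM _ 72) (natrM _ q) !natrX natrD natrM.
move: (size ls)%:R (N.to_nat d)%:R q%:R (c%:R) cR => a b e f f0 H.
have -> : 72 * (a + b / f) ^+ 2 = 72 * (a * f + b) ^+ 2 / f ^+ 2 by field; rewrite gt_eqF.
have -> : e * (b / f) ^+ 2 = e * b ^+ 2 / f ^+ 2 by field; rewrite gt_eqF.
have f2 : 0 < (f ^+ 2)^-1 by rewrite invr_gt0 exprn_gt0.
by rewrite (ltr_pM2r f2).
Qed.

End SieveSound.

Lemma range_ok_spec (qs : list N) (fuel : nat) (q0 x k : N) : range_ok qs fuel q0 ->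
  x = (q0 + 2 * k)%num -> (N.to_nat k < fuel)%N ->
  [|| ~~ candidate x, sieve_ok x | Nmem x qs].
Proof.
elim: fuel q0 k => [//|f IH] q0 k; case/andP=> ok rok xE kf.
case: (N.eq_dec k 0%num) => [k0|k0]; first by rewrite xE k0 N.add_0_r.
have xE' : x = (q0 + 2 + 2 * (k - 1))%num by lia.
by apply: (IH _ _ rok xE'); lia.
Qed.

Lemma Nmem_In (x : N) (s : list N) : Nmem x s -> List.In x s.
Proof. by elim: s => //= y s IH /orP[/N.eqb_spec ->|/IH]; [left|right]. Qed.

(** * Failure of the property for q = 41 *)

Lemma poly_sqr_irreducible (F : fieldType) (c : F) :
  (forall x, x ^+ 2 != c) -> irreducible_poly ('X^2 - c%:P).
Proof.
move=> nsq; apply: cubic_irreducible; first by rewrite size_XnsubC.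
by move=> x; rewrite /root hornerD hornerN hornerXn hornerC subr_eq0.
Qed.

(* With [z^2 = 14], either [z + x] is a nonsquare or [(z + x)^(840 / l) = 1] for a prime [l]. *)
Definition not_2primitive41 (x : nat) : bool :=
  let pow e := vpow 41 [:: 14; 0]%num e (vpows 41 [:: 14; 0]%num 10 [:: N.of_nat x; 1]%num) in
  [|| veq (pow 840%positive) [:: 40; 0]%num, veq (pow 420%positive) [:: 1; 0]%num,
      veq (pow 280%positive) [:: 1; 0]%num, veq (pow 168%positive) [:: 1; 0]%num |
      veq (pow 120%positive) [:: 1; 0]%num].

Lemma translate_property41_fails : ~ translate_property_Fq 41 2 2.
Proof.
pose F : finFieldType := 'F_41.
have F_lt (x : F) : (x < 41)%N by apply: (ltn_ord x).
have nsq (x : F) : x ^+ 2 != 14%:R.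
  have : all (fun k => k ^ 2 %% 41 != 14)%N (iota 0 41) by vm_compute.
  move/allP => /(_ x); rewrite mem_iota /= add0n => /(_ (F_lt x)); apply: contra.
  by rewrite -{1}(natr_Zp x) -natrX => /eqP/(congr1 val) /=; rewrite !val_Fp_nat // => ->.
have [L dimL [z]] := irredp_FAdjoin (poly_sqr_irreducible nsq).
rewrite size_XnsubC //= in dimL * => z_root gen_z.
have z2 : z ^+ 2 = 14%:R.
  move: z_root; rewrite /root rmorphB /= map_polyXn map_polyC /=.
  rewrite hornerD hornerN hornerXn hornerC subr_eq0 => /eqP ->.
  by rewrite scaler_nat.
have cardF : #|F| = 41%N by rewrite card_Fp.
move=> /(_ F L cardF dimL z gen_z)[x [_]].
rewrite dimL cardF; set m := (_ %/ 2)%N => y_prim.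
have mE : m = 840%N by vm_compute.
have p0 : (N.to_nat 41)%:R = 0 :> L.
  have /eqP : (41%:R : F) = 0 by apply/eqP; rewrite -(dvdn_pcharf (pchar_Fp _)).
  by move=> F0; rewrite -(scaler_nat 41 (1 : L)); rewrite -[41%:R]/(41%:R : F) (eqP F0) scale0r.
pose M := [:: 14; 0]%num.
have eqL u v : vcong z M u v -> u = v.
  have M0 : veval z M = 14%:R by rewrite /= mulr0 mulr0n addr0 mulr0 addr0.
  by case=> c ->; rewrite M0 -[size M]/2%N z2 subrr mulr0 addr0.
have yE : veval z [:: N.of_nat x; 1]%num = z + x%:A.
  by rewrite /= Nat2N.id mulr0 addr0 mulr1 addrC -scaler_nat natr_Zp.
pose tb := vpows 41 M 10 [:: N.of_nat x; 1]%num.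
have pow_y (e : positive) (k : nat) (v : list N) : (Pos.size_nat e <= 10)%N -> Pos.to_nat e = k ->
    veq (vpow 41 M e tb) v -> (z + x%:A) ^+ k = veval z v.
  move=> e10 <- /veqE <-.
  have sx : size [:: N.of_nat x; 1]%num = size M by [].
  by have [_ /eqL ->] := vpow_spec z p0 e10 sx; rewrite yE.
have constE (c : N) : veval z [:: c; 0]%num = (N.to_nat c)%:R.
  by rewrite /= mulr0 mulr0n addr0 mulr0 addr0.
have y840 : (z + x%:A) ^+ 840 = 1 by rewrite -mE; apply: prim_expr_order.
have y_neq1 (e : positive) (k : nat) : (Pos.size_nat e <= 10)%N -> Pos.to_nat e = k ->
    (0 < k < 840)%N -> ~~ veq (vpow 41 M e tb) [:: 1; 0]%num.
  move=> e10 ek /andP[k_gt0 k_lt]; apply/negP => /(pow_y _ _ _ e10 ek) y1.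
  have : (840 %| k)%N by rewrite -mE (prim_order_dvd y_prim) y1 constE.
  by rewrite gtnNdvd.
have check : all not_2primitive41 (iota 0 41) by vm_compute.
have x_iota : nat_of_ord x \in iota 0 41 by rewrite mem_iota add0n leq0n F_lt.
have := allP check _ x_iota; rewrite /not_2primitive41 -/M -/tb => {check}.
(* The exponents are 840 divided by its prime factors 2, 3, 5 and 7; a power equal to 1 there
   contradicts order 840. *)
have /negP h420 := y_neq1 420%positive 420%N isT erefl isT.
have /negP h280 := y_neq1 280%positive 280%N isT erefl isT.
have /negP h168 := y_neq1 168%positive 168%N isT erefl isT.
have /negP h120 := y_neq1 120%positive 120%N isT erefl isT.
case/orP=> [h840|/orP[/h420 []|/orP[/h280 []|/orP[/h168 []|/h120 []]]]].
(* In the nonsquare case the 840th power is both 1 and 40, that is -1, which forces 2 = 0. *)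
have := pow_y 840%positive 840%N [:: 40; 0]%num isT erefl h840.
rewrite y840 constE => one40.
have e40 : N.to_nat 40 = (20 * 2)%N := erefl.
have e41 : N.to_nat 41 = (20 * 2 + 1)%N := erefl.
rewrite e40 in one40; move: p0; rewrite e41 natrD -one40 => two0.
have {}two0 : 2%:R = 0 :> L by rewrite (natrD _ 1 1).
by move/eqP: one40; rewrite natrM two0 mulr0 oner_eq0.
Qed.

(** For [q = p ^ e] the relation has degree [2 * e], so that elements are written directly over F_p.
    The inverses are listed for 2, then for the odd primes of [q - 1], then for those of [q + 1]. As
    an example, the entry for [q = 3] has [g ^ 2 = 1 + g] and [n = 8]. Here [g ^ 4 = -1], so
    [g ^ 4 - 1] is 1 modulo 3 and so is its inverse; the pair (2, 0) stands for [h = 2] and asserts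
    [g ^ 6 - g ^ 2 = g ^ 2]. *)
Definition certs : list cert := [::
  Cert 3 3 [:: 1; 1] [:: [:: 1; 0]] [:: (2, 0)];
  Cert 9 3 [:: 1; 2; 0; 0] [:: [:: 1; 0; 0; 0]; [:: 1; 2; 0; 2]] [:: (2, 3); (4, 1)];
  Cert 17 17 [:: 3; 6] [:: [:: 8; 0]; [:: 7; 6]] [:: (2, 15); (4, 9)];
  Cert 19 19 [:: 9; 17] [:: [:: 9; 0]; [:: 2; 0]; [:: 1; 11]] [:: (2, 16); (6, 14)];
  Cert 23 23 [:: 9; 3] [:: [:: 11; 0]; [:: 21; 0]; [:: 19; 10]] [:: (2, 11); (10, 5)];
  Cert 25 5 [:: 2; 2; 4; 0] [:: [:: 2; 0; 0; 0]; [:: 1; 4; 4; 2]; [:: 0; 2; 3; 4]] [:: (2, 17); (4, 19); (6, 18); (8, 4)];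
  Cert 27 3 [:: 1; 1; 0; 0; 0; 0] [:: [:: 1; 0; 0; 0; 0; 0]; [:: 1; 0; 1; 1; 1; 0]; [:: 2; 0; 2; 1; 1; 0]] [:: (2, 14); (6, 17)];
  Cert 29 29 [:: 8; 25] [:: [:: 14; 0]; [:: 5; 0]; [:: 16; 1]; [:: 13; 14]] [:: (2, 18); (8, 26); (4, 15); (14, 9)];
  Cert 37 37 [:: 15; 6] [:: [:: 18; 0]; [:: 3; 0]; [:: 1; 18]] [:: (2, 27); (6, 14); (4, 30); (10, 6)];
  Cert 43 43 [:: 13; 28] [:: [:: 21; 0]; [:: 26; 0]; [:: 23; 0]; [:: 41; 17]] [:: (2, 18); (6, 22); (10, 40); (18, 22)];
  Cert 47 47 [:: 21; 10] [:: [:: 23; 0]; [:: 36; 0]; [:: 13; 2]] [:: (2, 21); (10, 3)];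
  Cert 49 7 [:: 4; 3; 2; 0] [:: [:: 3; 0; 0; 0]; [:: 1; 0; 0; 0]; [:: 6; 5; 5; 5]] [:: (2, 34); (4, 16); (6, 27); (12, 7)];
  Cert 53 53 [:: 33; 24] [:: [:: 26; 0]; [:: 33; 0]; [:: 47; 38]] [:: (2, 30); (4, 24); (8, 13); (10, 41)];
  Cert 59 59 [:: 36; 31] [:: [:: 29; 0]; [:: 39; 0]; [:: 32; 55]; [:: 15; 58]] [:: (2, 0); (14, 53)];
  Cert 61 61 [:: 30; 42] [:: [:: 30; 0]; [:: 56; 0]; [:: 37; 0]; [:: 13; 56]] [:: (2, 24); (6, 31); (4, 47); (10, 55); (12, 30); (24, 13)];
  Cert 67 67 [:: 47; 18] [:: [:: 33; 0]; [:: 12; 0]; [:: 52; 0]; [:: 3; 48]] [:: (2, 51); (10, 9); (14, 61)];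
  Cert 71 71 [:: 60; 47] [:: [:: 35; 0]; [:: 67; 0]; [:: 55; 0]; [:: 40; 30]] [:: (2, 68); (10, 5); (26, 32)];
  Cert 73 73 [:: 47; 70] [:: [:: 36; 0]; [:: 21; 0]; [:: 32; 46]] [:: (2, 46); (6, 17); (4, 43); (14, 53)];
  Cert 79 79 [:: 16; 7] [:: [:: 39; 0]; [:: 18; 0]; [:: 21; 0]; [:: 54; 7]] [:: (2, 56); (6, 38); (22, 50)];
  Cert 81 3 [:: 1; 1; 1; 2; 0; 1; 0; 2] [:: [:: 1; 0; 0; 0; 0; 0; 0; 0]; [:: 2; 0; 0; 0; 1; 1; 2; 0]; [:: 0; 0; 1; 2; 2; 0; 1; 2]] [:: (2, 66); (6, 39); (4, 9); (8, 74)];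
  Cert 83 83 [:: 7; 51] [:: [:: 41; 0]; [:: 64; 0]; [:: 30; 46]; [:: 17; 40]] [:: (2, 70); (10, 60)];
  Cert 89 89 [:: 15; 6] [:: [:: 44; 0]; [:: 37; 0]; [:: 49; 28]; [:: 22; 37]] [:: (2, 0); (14, 41); (4, 7); (16, 52)];
  Cert 97 97 [:: 76; 86] [:: [:: 48; 0]; [:: 76; 0]; [:: 18; 21]] [:: (2, 45); (4, 51); (6, 30); (26, 17)];
  Cert 101 101 [:: 83; 44] [:: [:: 50; 0]; [:: 28; 0]; [:: 78; 63]; [:: 30; 56]] [:: (2, 51); (4, 65); (8, 1); (14, 55)];
  Cert 103 103 [:: 33; 60] [:: [:: 51; 0]; [:: 15; 0]; [:: 77; 0]; [:: 6; 53]] [:: (2, 84); (10, 87); (34, 53)];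
  Cert 107 107 [:: 13; 97] [:: [:: 53; 0]; [:: 100; 0]; [:: 80; 91]] [:: (2, 91); (10, 71)];
  Cert 109 109 [:: 98; 68] [:: [:: 54; 0]; [:: 57; 0]; [:: 76; 25]; [:: 3; 56]] [:: (2, 70); (6, 67); (4, 87); (12, 14)];
  Cert 113 113 [:: 93; 108] [:: [:: 56; 0]; [:: 67; 0]; [:: 40; 84]; [:: 12; 5]] [:: (2, 40); (4, 12); (8, 49); (28, 4)];
  Cert 121 11 [:: 5; 2; 0; 0] [:: [:: 5; 0; 0; 0]; [:: 9; 10; 5; 1]; [:: 6; 0; 0; 0]; [:: 10; 1; 3; 4]] [:: (2, 15); (4, 69); (8, 97); (12, 58); (14, 37); (32, 51)];
  Cert 125 5 [:: 2; 2; 0; 0; 0; 0] [:: [:: 2; 0; 0; 0; 0; 0]; [:: 1; 3; 0; 3; 4; 0]; [:: 2; 2; 4; 0; 3; 3]; [:: 2; 4; 0; 3; 4; 2]] [:: (2, 59); (4, 9); (8, 92); (20, 47)];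
  Cert 127 127 [:: 21; 111] [:: [:: 63; 0]; [:: 120; 0]; [:: 1; 0]] [:: (2, 36); (10, 80); (34, 0)];
  Cert 131 131 [:: 11; 54] [:: [:: 65; 0]; [:: 63; 0]; [:: 30; 0]; [:: 10; 36]; [:: 55; 78]] [:: (2, 122); (10, 24); (34, 74)];
  Cert 137 137 [:: 83; 89] [:: [:: 68; 0]; [:: 26; 0]; [:: 95; 121]; [:: 30; 124]] [:: (2, 44); (4, 56); (8, 99); (10, 69)];
  Cert 139 139 [:: 83; 94] [:: [:: 69; 0]; [:: 78; 0]; [:: 28; 0]; [:: 134; 111]; [:: 51; 27]] [:: (2, 61); (6, 83); (18, 1)];
  Cert 149 149 [:: 79; 77] [:: [:: 74; 0]; [:: 134; 0]; [:: 54; 16]; [:: 123; 80]] [:: (2, 55); (4, 15); (8, 68); (22, 70)];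
  Cert 151 151 [:: 42; 144] [:: [:: 75; 0]; [:: 111; 0]; [:: 42; 0]; [:: 8; 24]] [:: (2, 101); (6, 44); (10, 92)];
  Cert 157 157 [:: 114; 19] [:: [:: 78; 0]; [:: 56; 0]; [:: 62; 0]; [:: 124; 53]] [:: (2, 90); (4, 24); (6, 96); (12, 24); (8, 113); (56, 42)];
  Cert 163 163 [:: 131; 110] [:: [:: 81; 0]; [:: 143; 0]; [:: 131; 88]] [:: (2, 42); (6, 3)];
  Cert 167 167 [:: 61; 16] [:: [:: 83; 0]; [:: 69; 0]; [:: 29; 132]; [:: 37; 131]] [:: (2, 56); (10, 25)];
  Cert 169 13 [:: 2; 6; 2; 0] [:: [:: 6; 0; 0; 0]; [:: 7; 0; 0; 0]; [:: 12; 8; 2; 4]; [:: 11; 3; 4; 11]; [:: 6; 10; 8; 4]] [:: (2, 139); (4, 113); (16, 1); (32, 120); (22, 138); (62, 137)];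
  Cert 173 173 [:: 143; 95] [:: [:: 86; 0]; [:: 40; 0]; [:: 38; 52]; [:: 94; 49]] [:: (2, 26); (4, 170); (8, 59); (16, 112)];
  Cert 179 179 [:: 3; 169] [:: [:: 89; 0]; [:: 112; 0]; [:: 17; 93]; [:: 35; 25]] [:: (2, 166); (14, 49)];
  Cert 181 181 [:: 98; 160] [:: [:: 90; 0]; [:: 104; 0]; [:: 103; 0]; [:: 42; 73]; [:: 175; 146]] [:: (2, 53); (4, 7); (6, 87); (10, 12); (20, 18); (36, 69)];
  Cert 191 191 [:: 20; 76] [:: [:: 95; 0]; [:: 23; 0]; [:: 48; 0]; [:: 76; 96]] [:: (2, 62); (10, 165); (14, 1)];
  Cert 193 193 [:: 40; 117] [:: [:: 96; 0]; [:: 100; 0]; [:: 161; 149]] [:: (2, 176); (10, 67); (6, 162); (18, 175)];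
  Cert 197 197 [:: 52; 111] [:: [:: 98; 0]; [:: 152; 0]; [:: 10; 85]; [:: 62; 187]] [:: (2, 77); (10, 120); (4, 28); (20, 185)];
  Cert 199 199 [:: 57; 156] [:: [:: 99; 0]; [:: 35; 0]; [:: 130; 0]; [:: 168; 68]] [:: (2, 167); (6, 8); (46, 26)];
  Cert 211 211 [:: 36; 112] [:: [:: 105; 0]; [:: 145; 0]; [:: 167; 0]; [:: 89; 0]; [:: 145; 150]] [:: (2, 129); (6, 22); (22, 98); (42, 42); (34, 97)];
  Cert 223 223 [:: 181; 24] [:: [:: 111; 0]; [:: 87; 0]; [:: 190; 0]; [:: 210; 159]] [:: (2, 31); (26, 135); (38, 218)];
  Cert 227 227 [:: 27; 216] [:: [:: 113; 0]; [:: 29; 0]; [:: 6; 125]; [:: 169; 134]] [:: (2, 195); (10, 181)];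
  Cert 229 229 [:: 160; 218] [:: [:: 114; 0]; [:: 197; 0]; [:: 183; 0]; [:: 154; 153]; [:: 175; 136]] [:: (2, 68); (4, 134); (6, 14); (12, 22); (8, 133); (16, 34)];
  Cert 233 233 [:: 151; 114] [:: [:: 116; 0]; [:: 219; 0]; [:: 80; 111]; [:: 56; 185]] [:: (2, 27); (8, 191); (4, 38); (10, 154)];
  Cert 239 239 [:: 54; 192] [:: [:: 119; 0]; [:: 52; 0]; [:: 32; 0]; [:: 120; 117]; [:: 216; 116]] [:: (2, 21); (14, 101); (22, 46)];
  Cert 241 241 [:: 234; 184] [:: [:: 120; 0]; [:: 155; 0]; [:: 158; 0]; [:: 25; 77]] [:: (2, 84); (8, 234); (4, 87); (16, 110); (6, 54); (62, 77)];
  Cert 243 3 [:: 1; 0; 2; 1; 2; 0; 1; 2; 0; 0] [:: [:: 1; 0; 0; 0; 0; 0; 0; 0; 0; 0]; [:: 0; 1; 0; 1; 0; 0; 2; 1; 1; 1]; [:: 2; 2; 0; 0; 1; 0; 0; 1; 2; 2]] [:: (2, 73); (6, 220)];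
  Cert 251 251 [:: 49; 172] [:: [:: 125; 0]; [:: 38; 0]; [:: 229; 63]; [:: 153; 239]] [:: (2, 111); (10, 84)];
  Cert 257 257 [:: 175; 186] [:: [:: 128; 0]; [:: 155; 8]; [:: 30; 247]] [:: (2, 123); (8, 161)];
  Cert 263 263 [:: 258; 69] [:: [:: 131; 0]; [:: 11; 0]; [:: 172; 258]; [:: 185; 250]] [:: (2, 245); (10, 181)];
  Cert 269 269 [:: 95; 162] [:: [:: 134; 0]; [:: 59; 0]; [:: 260; 118]; [:: 189; 265]] [:: (2, 239); (8, 225); (4, 108); (28, 57)];
  Cert 271 271 [:: 7; 15] [:: [:: 135; 0]; [:: 9; 0]; [:: 219; 0]; [:: 121; 38]] [:: (2, 155); (6, 51); (38, 255)];
  Cert 277 277 [:: 5; 233] [:: [:: 138; 0]; [:: 53; 0]; [:: 32; 0]; [:: 16; 70]] [:: (2, 145); (4, 167); (8, 29); (24, 146); (18, 32); (22, 149); (32, 270)];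
  Cert 281 281 [:: 117; 132] [:: [:: 140; 0]; [:: 162; 0]; [:: 12; 0]; [:: 63; 48]; [:: 7; 134]] [:: (2, 49); (4, 257); (8, 261); (10, 191); (14, 49); (20, 19)];
  Cert 283 283 [:: 157; 8] [:: [:: 141; 0]; [:: 203; 0]; [:: 23; 0]; [:: 95; 153]] [:: (2, 162); (10, 5); (14, 212)];
  Cert 289 17 [:: 12; 1; 2; 0] [:: [:: 8; 0; 0; 0]; [:: 15; 16; 7; 4]; [:: 8; 0; 3; 13]; [:: 15; 1; 2; 5]] [:: (2, 200); (4, 80); (8, 97); (12, 254)];
  Cert 293 293 [:: 261; 138] [:: [:: 146; 0]; [:: 118; 0]; [:: 75; 35]; [:: 143; 51]] [:: (2, 257); (4, 19); (8, 183); (10, 229)];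
  Cert 307 307 [:: 164; 244] [:: [:: 153; 0]; [:: 96; 0]; [:: 144; 0]; [:: 69; 202]; [:: 145; 297]] [:: (2, 198); (6, 304); (34, 203)];
  Cert 311 311 [:: 80; 82] [:: [:: 155; 0]; [:: 230; 0]; [:: 200; 0]; [:: 67; 78]; [:: 262; 96]] [:: (2, 253); (22, 79); (46, 294)];
  Cert 313 313 [:: 292; 95] [:: [:: 156; 0]; [:: 71; 0]; [:: 130; 0]; [:: 85; 186]] [:: (2, 191); (6, 110); (10, 296); (16, 98); (24, 217); (52, 256)];
  Cert 317 317 [:: 129; 132] [:: [:: 158; 0]; [:: 191; 0]; [:: 32; 146]; [:: 278; 27]] [:: (2, 19); (4, 15); (8, 299); (14, 43)];
  Cert 331 331 [:: 290; 179] [:: [:: 165; 0]; [:: 10; 0]; [:: 147; 0]; [:: 16; 0]; [:: 90; 195]] [:: (2, 323); (10, 80); (18, 170); (22, 104); (6, 268)];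
  Cert 337 337 [:: 45; 21] [:: [:: 168; 0]; [:: 69; 0]; [:: 107; 0]; [:: 219; 284]] [:: (2, 263); (8, 241); (6, 53); (10, 30); (14, 187); (32, 291)];
  Cert 343 7 [:: 4; 2; 1; 0; 0; 0] [:: [:: 3; 0; 0; 0; 0; 0]; [:: 1; 0; 0; 0; 0; 0]; [:: 5; 6; 2; 0; 1; 2]; [:: 5; 0; 2; 4; 1; 4]] [:: (2, 251); (6, 29); (10, 296)];
  Cert 347 347 [:: 332; 38] [:: [:: 173; 0]; [:: 268; 0]; [:: 277; 305]; [:: 332; 156]] [:: (2, 217); (10, 159)];
  Cert 349 349 [:: 315; 111] [:: [:: 174; 0]; [:: 273; 0]; [:: 3; 0]; [:: 273; 168]; [:: 312; 139]] [:: (2, 34); (6, 49); (4, 157); (8, 262); (12, 242); (32, 257)];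
  Cert 353 353 [:: 296; 49] [:: [:: 176; 0]; [:: 66; 0]; [:: 31; 150]; [:: 16; 129]] [:: (2, 285); (4, 235); (8, 79); (14, 197)];
  Cert 359 359 [:: 266; 223] [:: [:: 179; 0]; [:: 101; 0]; [:: 328; 282]; [:: 334; 356]] [:: (2, 149); (14, 189)];
  Cert 361 19 [:: 9; 10; 0; 0] [:: [:: 9; 0; 0; 0]; [:: 2; 0; 0; 0]; [:: 3; 10; 7; 16]; [:: 17; 10; 17; 4]] [:: (2, 198); (4, 268); (6, 352); (12, 318); (20, 43); (32, 254)];
  Cert 367 367 [:: 298; 162] [:: [:: 183; 0]; [:: 94; 0]; [:: 356; 0]; [:: 278; 171]] [:: (2, 332); (6, 200); (10, 119)];
  Cert 373 373 [:: 242; 137] [:: [:: 186; 0]; [:: 343; 0]; [:: 145; 0]; [:: 304; 1]; [:: 76; 37]] [:: (2, 351); (6, 134); (8, 89); (16, 272); (10, 206); (36, 46)];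
  Cert 379 379 [:: 372; 61] [:: [:: 189; 0]; [:: 235; 0]; [:: 162; 0]; [:: 13; 304]; [:: 222; 322]] [:: (2, 146); (18, 249); (26, 93)];
  Cert 389 389 [:: 387; 307] [:: [:: 194; 0]; [:: 26; 0]; [:: 290; 268]; [:: 125; 245]; [:: 184; 199]] [:: (2, 326); (8, 328); (4, 239); (14, 5)];
  Cert 397 397 [:: 155; 266] [:: [:: 198; 0]; [:: 11; 0]; [:: 343; 0]; [:: 120; 117]] [:: (2, 136); (4, 390); (6, 290); (8, 174); (16, 105); (20, 82)];
  Cert 401 401 [:: 104; 347] [:: [:: 200; 0]; [:: 147; 0]; [:: 393; 22]; [:: 68; 307]] [:: (2, 130); (10, 281); (4, 225); (14, 331)];
  Cert 409 409 [:: 367; 333] [:: [:: 204; 0]; [:: 118; 0]; [:: 16; 0]; [:: 261; 206]; [:: 55; 136]] [:: (2, 237); (4, 175); (6, 22); (12, 0); (8, 391); (16, 180)];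
  Cert 419 419 [:: 261; 108] [:: [:: 209; 0]; [:: 35; 0]; [:: 327; 0]; [:: 269; 92]; [:: 344; 207]; [:: 24; 275]] [:: (2, 246); (22, 240); (26, 79)];
  Cert 421 421 [:: 287; 53] [:: [:: 210; 0]; [:: 287; 0]; [:: 130; 0]; [:: 170; 0]; [:: 86; 100]] [:: (18, 215); (32, 129); (58, 143); (26, 124); (52, 21); (28, 174); (14, 295); (10, 2); (56, 252); (40, 177)];
  Cert 431 431 [:: 302; 102] [:: [:: 215; 0]; [:: 15; 0]; [:: 138; 0]; [:: 265; 261]] [:: (2, 33); (14, 15); (22, 207)];
  Cert 433 433 [:: 303; 206] [:: [:: 216; 0]; [:: 210; 0]; [:: 199; 38]; [:: 85; 140]] [:: (2, 219); (6, 150); (4, 362); (16, 193)];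
  Cert 439 439 [:: 308; 41] [:: [:: 219; 0]; [:: 235; 0]; [:: 134; 0]; [:: 430; 418]; [:: 25; 63]] [:: (2, 268); (6, 122); (26, 314)];
  Cert 443 443 [:: 168; 353] [:: [:: 221; 0]; [:: 305; 0]; [:: 28; 0]; [:: 76; 46]; [:: 212; 177]] [:: (2, 435); (10, 91); (14, 163)];
  Cert 449 449 [:: 148; 227] [:: [:: 224; 0]; [:: 317; 0]; [:: 165; 137]; [:: 148; 420]] [:: (2, 268); (8, 28); (4, 349); (14, 159)];
  Cert 457 457 [:: 90; 97] [:: [:: 228; 0]; [:: 412; 0]; [:: 318; 0]; [:: 313; 394]] [:: (2, 389); (4, 323); (8, 159); (10, 373); (18, 273); (30, 334)];
  Cert 461 461 [:: 241; 297] [:: [:: 230; 0]; [:: 407; 0]; [:: 325; 0]; [:: 164; 359]; [:: 366; 294]; [:: 222; 281]] [:: (2, 448); (8, 314); (4, 273); (16, 284); (10, 420); (34, 119)];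
  Cert 463 463 [:: 188; 415] [:: [:: 231; 0]; [:: 161; 0]; [:: 186; 0]; [:: 59; 0]; [:: 357; 121]] [:: (2, 51); (6, 283); (10, 161); (26, 187); (30, 451)];
  Cert 467 467 [:: 459; 52] [:: [:: 233; 0]; [:: 341; 0]; [:: 241; 323]; [:: 255; 71]] [:: (2, 294); (10, 257)];
  Cert 479 479 [:: 251; 188] [:: [:: 239; 0]; [:: 250; 0]; [:: 231; 102]; [:: 272; 178]] [:: (2, 173); (14, 295)];
  Cert 491 491 [:: 342; 248] [:: [:: 245; 0]; [:: 437; 0]; [:: 402; 0]; [:: 398; 74]; [:: 397; 173]] [:: (2, 125); (10, 96); (26, 108)];
  Cert 499 499 [:: 29; 131] [:: [:: 249; 0]; [:: 46; 0]; [:: 144; 0]; [:: 439; 39]] [:: (2, 450); (6, 130); (38, 310)];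
  Cert 503 503 [:: 223; 316] [:: [:: 251; 0]; [:: 277; 0]; [:: 173; 96]; [:: 483; 24]] [:: (2, 296); (10, 366)];
  Cert 509 509 [:: 297; 138] [:: [:: 254; 0]; [:: 18; 0]; [:: 208; 340]; [:: 464; 174]; [:: 454; 93]] [:: (2, 479); (8, 165); (4, 114); (16, 319)];
  Cert 521 521 [:: 507; 156] [:: [:: 260; 0]; [:: 368; 0]; [:: 44; 0]; [:: 372; 52]; [:: 48; 497]] [:: (2, 154); (8, 88); (4, 293); (20, 402); (10, 502); (40, 158)];
  Cert 523 523 [:: 118; 114] [:: [:: 261; 0]; [:: 194; 0]; [:: 507; 0]; [:: 203; 157]] [:: (2, 345); (6, 370); (14, 334)];
  Cert 529 23 [:: 2; 16; 13; 0] [:: [:: 11; 0; 0; 0]; [:: 7; 14; 12; 13]; [:: 8; 0; 0; 0]; [:: 7; 1; 13; 0]; [:: 16; 16; 21; 16]] [:: (2, 525); (6, 216); (4, 326); (14, 336); (18, 526); (32, 50)];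
  Cert 541 541 [:: 269; 96] [:: [:: 270; 0]; [:: 317; 0]; [:: 143; 0]; [:: 229; 215]] [:: (2, 418); (4, 266); (10, 400); (24, 260); (32, 539); (36, 328)];
  Cert 547 547 [:: 438; 505] [:: [:: 273; 0]; [:: 13; 0]; [:: 342; 0]; [:: 414; 0]; [:: 473; 270]] [:: (2, 37); (6, 254); (14, 35); (22, 492); (30, 347)];
  Cert 557 557 [:: 58; 47] [:: [:: 278; 0]; [:: 143; 0]; [:: 67; 246]; [:: 495; 370]] [:: (2, 233); (4, 91); (8, 361); (14, 355)];
  Cert 563 563 [:: 228; 271] [:: [:: 281; 0]; [:: 280; 0]; [:: 522; 314]; [:: 535; 102]] [:: (2, 126); (10, 17)];
  Cert 569 569 [:: 349; 386] [:: [:: 284; 0]; [:: 193; 0]; [:: 176; 260]; [:: 72; 405]; [:: 443; 123]] [:: (2, 251); (8, 505); (4, 280); (16, 531)];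
  Cert 571 571 [:: 70; 461] [:: [:: 285; 0]; [:: 534; 0]; [:: 86; 0]; [:: 263; 0]; [:: 307; 343]; [:: 559; 223]] [:: (2, 345); (6, 345); (50, 245); (10, 431); (46, 454)];
  Cert 587 587 [:: 143; 412] [:: [:: 293; 0]; [:: 236; 0]; [:: 256; 174]; [:: 262; 3]] [:: (2, 74); (10, 110)];
  Cert 593 593 [:: 185; 528] [:: [:: 296; 0]; [:: 44; 0]; [:: 93; 12]; [:: 388; 386]] [:: (2, 335); (8, 247); (4, 86); (14, 432)];
  Cert 599 599 [:: 592; 471] [:: [:: 299; 0]; [:: 511; 0]; [:: 323; 0]; [:: 403; 376]; [:: 396; 535]] [:: (2, 422); (22, 463); (26, 25)];
  Cert 601 601 [:: 290; 570] [:: [:: 300; 0]; [:: 392; 0]; [:: 349; 0]; [:: 2; 543]; [:: 8; 524]] [:: (2, 450); (4, 112); (6, 429); (8, 31); (10, 126); (30, 223)];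
  Cert 607 607 [:: 233; 404] [:: [:: 303; 0]; [:: 272; 0]; [:: 67; 0]; [:: 89; 572]] [:: (2, 83); (10, 358); (14, 196)];
  Cert 613 613 [:: 205; 300] [:: [:: 306; 0]; [:: 182; 0]; [:: 585; 0]; [:: 464; 473]] [:: (2, 275); (4, 225); (10, 112); (14, 291); (18, 207); (22, 194)];
  Cert 617 617 [:: 33; 47] [:: [:: 308; 0]; [:: 34; 0]; [:: 171; 0]; [:: 161; 597]; [:: 92; 298]] [:: (2, 395); (16, 205); (10, 429); (22, 146); (14, 215); (26, 18)];
  Cert 619 619 [:: 207; 560] [:: [:: 309; 0]; [:: 290; 0]; [:: 186; 0]; [:: 316; 294]; [:: 588; 576]] [:: (2, 467); (6, 399); (14, 282)];
  Cert 625 5 [:: 2; 3; 4; 0; 0; 0; 0; 0] [:: [:: 2; 0; 0; 0; 0; 0; 0; 0]; [:: 4; 0; 4; 3; 0; 4; 3; 2]; [:: 1; 4; 1; 4; 0; 3; 1; 4]; [:: 0; 0; 0; 2; 4; 3; 1; 2]] [:: (2, 275); (4, 115); (12, 541); (22, 353); (16, 233); (32, 174)];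
  Cert 631 631 [:: 420; 124] [:: [:: 315; 0]; [:: 14; 0]; [:: 163; 0]; [:: 185; 0]; [:: 594; 311]] [:: (2, 485); (10, 157); (30, 351); (26, 621); (34, 170)];
  Cert 641 641 [:: 270; 188] [:: [:: 320; 0]; [:: 230; 0]; [:: 561; 127]; [:: 189; 431]] [:: (2, 392); (10, 353); (4, 539); (14, 371)];
  Cert 643 643 [:: 26; 500] [:: [:: 321; 0]; [:: 369; 0]; [:: 384; 0]; [:: 602; 557]; [:: 422; 532]] [:: (2, 257); (6, 75); (26, 231)];
  Cert 647 647 [:: 137; 227] [:: [:: 323; 0]; [:: 50; 0]; [:: 252; 0]; [:: 270; 428]] [:: (2, 629); (14, 288); (22, 310)];
  Cert 653 653 [:: 268; 36] [:: [:: 326; 0]; [:: 56; 0]; [:: 22; 162]; [:: 41; 560]] [:: (2, 525); (4, 195); (8, 40); (10, 602)];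
  Cert 659 659 [:: 310; 48] [:: [:: 329; 0]; [:: 106; 0]; [:: 507; 0]; [:: 549; 540]; [:: 551; 485]; [:: 416; 573]] [:: (2, 331); (14, 413); (34, 463)];
  Cert 661 661 [:: 347; 381] [:: [:: 330; 0]; [:: 121; 0]; [:: 308; 0]; [:: 412; 0]; [:: 608; 578]] [:: (2, 46); (4, 548); (6, 163); (18, 556); (20, 252); (40, 583); (8, 415); (30, 303); (24, 257); (36, 542)];
  Cert 673 673 [:: 425; 261] [:: [:: 336; 0]; [:: 363; 0]; [:: 245; 0]; [:: 644; 387]] [:: (2, 261); (4, 199); (6, 76); (8, 20); (10, 158); (18, 33)];
  Cert 677 677 [:: 627; 274] [:: [:: 338; 0]; [:: 104; 0]; [:: 448; 439]; [:: 172; 273]] [:: (2, 16); (8, 534); (4, 509); (32, 558)];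
  Cert 683 683 [:: 304; 351] [:: [:: 341; 0]; [:: 607; 0]; [:: 501; 0]; [:: 571; 347]; [:: 580; 417]] [:: (2, 438); (10, 517); (22, 307)];
  Cert 691 691 [:: 592; 587] [:: [:: 345; 0]; [:: 84; 0]; [:: 677; 0]; [:: 380; 0]; [:: 626; 125]] [:: (2, 136); (6, 526); (14, 366); (22, 402); (50, 316)];
  Cert 701 701 [:: 699; 526] [:: [:: 350; 0]; [:: 161; 0]; [:: 39; 0]; [:: 308; 336]; [:: 240; 179]] [:: (50, 651); (14, 698); (58, 77); (56, 45); (2, 453); (62, 574)];
  Cert 709 709 [:: 338; 534] [:: [:: 354; 0]; [:: 160; 0]; [:: 599; 0]; [:: 585; 31]; [:: 332; 571]] [:: (2, 557); (4, 263); (8, 550); (22, 420); (18, 635); (34, 622)];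
  Cert 719 719 [:: 156; 514] [:: [:: 359; 0]; [:: 285; 0]; [:: 43; 516]; [:: 171; 398]] [:: (2, 310); (14, 80)];
  Cert 727 727 [:: 353; 652] [:: [:: 363; 0]; [:: 578; 0]; [:: 415; 0]; [:: 620; 666]; [:: 647; 405]] [:: (2, 530); (10, 617); (34, 118)];
  Cert 729 3 [:: 1; 0; 0; 2; 1; 0; 1; 1; 2; 0; 0; 0] [:: [:: 1; 0; 0; 0; 0; 0; 0; 0; 0; 0; 0; 0]; [:: 0; 1; 1; 0; 0; 0; 1; 1; 0; 1; 1; 1]; [:: 1; 1; 1; 0; 0; 1; 1; 1; 0; 1; 2; 0]; [:: 2; 2; 0; 2; 1; 2; 0; 1; 2; 1; 1; 1]; [:: 1; 1; 0; 1; 2; 2; 0; 0; 0; 2; 0; 2]] [:: (2, 315); (4, 67); (6, 218); (12, 202); (8, 155); (18, 655)];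
  Cert 739 739 [:: 636; 306] [:: [:: 369; 0]; [:: 139; 0]; [:: 28; 0]; [:: 205; 600]; [:: 365; 285]] [:: (2, 234); (14, 151); (18, 424)];
  Cert 743 743 [:: 546; 332] [:: [:: 371; 0]; [:: 699; 0]; [:: 131; 0]; [:: 519; 205]; [:: 12; 311]] [:: (2, 171); (10, 250); (34, 571)];
  Cert 751 751 [:: 382; 25] [:: [:: 375; 0]; [:: 476; 0]; [:: 315; 0]; [:: 189; 105]] [:: (2, 134); (6, 362); (26, 70)];
  Cert 757 757 [:: 639; 239] [:: [:: 378; 0]; [:: 495; 0]; [:: 508; 0]; [:: 708; 428]] [:: (2, 177); (4, 517); (8, 410); (12, 9); (14, 482); (16, 482)];
  Cert 761 761 [:: 479; 515] [:: [:: 380; 0]; [:: 400; 0]; [:: 705; 0]; [:: 479; 669]; [:: 689; 151]] [:: (2, 576); (4, 232); (8, 581); (10, 217); (20, 366); (32, 19)];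
  Cert 769 769 [:: 419; 547] [:: [:: 384; 0]; [:: 376; 0]; [:: 211; 137]; [:: 494; 673]; [:: 223; 532]] [:: (2, 344); (6, 395); (4, 725); (34, 531)];
  Cert 797 797 [:: 777; 551] [:: [:: 398; 0]; [:: 479; 0]; [:: 345; 181]; [:: 408; 26]; [:: 26; 308]] [:: (2, 785); (4, 491); (8, 210); (20, 129)];
  Cert 809 809 [:: 275; 298] [:: [:: 404; 0]; [:: 18; 0]; [:: 406; 76]; [:: 603; 281]] [:: (2, 528); (4, 266); (8, 777); (22, 39)];
  Cert 811 811 [:: 238; 240] [:: [:: 405; 0]; [:: 43; 0]; [:: 12; 0]; [:: 88; 496]; [:: 705; 403]] [:: (2, 677); (6, 290); (18, 222)];
  Cert 821 821 [:: 275; 201] [:: [:: 410; 0]; [:: 814; 0]; [:: 4; 0]; [:: 102; 338]; [:: 411; 580]] [:: (2, 711); (8, 499); (4, 670); (14, 86); (10, 391); (16, 299)];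
  Cert 827 827 [:: 91; 717] [:: [:: 413; 0]; [:: 511; 0]; [:: 593; 0]; [:: 498; 603]; [:: 433; 677]] [:: (2, 222); (10, 766); (14, 330)];
  Cert 829 829 [:: 112; 51] [:: [:: 414; 0]; [:: 234; 0]; [:: 295; 0]; [:: 310; 573]; [:: 718; 557]] [:: (2, 618); (6, 43); (4, 9); (12, 306); (18, 360); (42, 641)];
  Cert 839 839 [:: 281; 456] [:: [:: 419; 0]; [:: 241; 0]; [:: 63; 31]; [:: 108; 86]; [:: 833; 506]] [:: (2, 158); (22, 375)];
  Cert 841 29 [:: 3; 10; 3; 0] [:: [:: 14; 0; 0; 0]; [:: 16; 22; 6; 14]; [:: 15; 11; 3; 7]; [:: 4; 0; 0; 0]; [:: 17; 10; 26; 6]] [:: (2, 766); (4, 682); (6, 344); (10, 563); (8, 161); (18, 691); (16, 574); (38, 648); (22, 225); (60, 141)];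
  Cert 853 853 [:: 483; 733] [:: [:: 426; 0]; [:: 73; 0]; [:: 634; 0]; [:: 390; 170]; [:: 291; 211]] [:: (2, 160); (4, 180); (12, 648); (18, 2); (16, 94); (34, 726)];
  Cert 857 857 [:: 96; 707] [:: [:: 428; 0]; [:: 582; 0]; [:: 153; 282]; [:: 254; 649]; [:: 616; 471]] [:: (2, 833); (8, 389); (4, 608); (10, 88)];
  Cert 859 859 [:: 662; 649] [:: [:: 429; 0]; [:: 199; 0]; [:: 79; 0]; [:: 138; 0]; [:: 659; 84]; [:: 481; 385]] [:: (2, 300); (6, 793); (58, 365); (14, 567); (22, 362)];
  Cert 881 881 [:: 3; 473] [:: [:: 440; 0]; [:: 847; 0]; [:: 824; 0]; [:: 430; 475]; [:: 776; 779]] [:: (2, 489); (8, 749); (4, 656); (16, 611); (20, 396); (38, 768)];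
  Cert 883 883 [:: 279; 258] [:: [:: 441; 0]; [:: 770; 0]; [:: 164; 0]; [:: 203; 878]; [:: 350; 76]] [:: (2, 383); (6, 702); (22, 7)];
  Cert 911 911 [:: 123; 90] [:: [:: 455; 0]; [:: 252; 0]; [:: 527; 0]; [:: 611; 0]; [:: 727; 743]; [:: 857; 234]] [:: (2, 801); (14, 680); (22, 113); (26, 552)];
  Cert 919 919 [:: 266; 293] [:: [:: 459; 0]; [:: 901; 0]; [:: 617; 0]; [:: 416; 499]; [:: 522; 423]] [:: (2, 76); (6, 376); (22, 274)];
  Cert 929 929 [:: 310; 218] [:: [:: 464; 0]; [:: 195; 0]; [:: 627; 740]; [:: 473; 588]; [:: 782; 338]] [:: (2, 7); (14, 210); (4, 728); (16, 511)];
  Cert 937 937 [:: 699; 883] [:: [:: 468; 0]; [:: 107; 0]; [:: 926; 0]; [:: 515; 557]; [:: 15; 712]] [:: (2, 290); (10, 429); (6, 522); (22, 1); (30, 524); (50, 859)];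
  Cert 941 941 [:: 700; 275] [:: [:: 470; 0]; [:: 337; 0]; [:: 851; 0]; [:: 155; 584]; [:: 636; 690]] [:: (2, 537); (4, 65); (8, 512); (10, 724); (20, 501); (28, 724)];
  Cert 947 947 [:: 599; 113] [:: [:: 473; 0]; [:: 164; 0]; [:: 721; 0]; [:: 510; 234]; [:: 25; 494]] [:: (2, 387); (10, 31); (14, 654)];
  Cert 953 953 [:: 300; 275] [:: [:: 476; 0]; [:: 871; 0]; [:: 558; 0]; [:: 69; 651]; [:: 338; 202]] [:: (2, 707); (4, 607); (8, 390); (14, 32); (10, 871); (16, 637)];
  Cert 961 31 [:: 10; 20; 0; 0] [:: [:: 15; 0; 0; 0]; [:: 8; 0; 0; 0]; [:: 1; 0; 0; 0]; [:: 16; 8; 13; 2]; [:: 13; 20; 30; 27]] [:: (2, 286); (4, 718); (14, 125); (32, 585); (20, 934); (50, 8)];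
  Cert 967 967 [:: 556; 737] [:: [:: 483; 0]; [:: 919; 0]; [:: 478; 0]; [:: 207; 0]; [:: 120; 535]] [:: (2, 266); (6, 60); (14, 375); (10, 647); (18, 100)];
  Cert 991 991 [:: 155; 607] [:: [:: 495; 0]; [:: 698; 0]; [:: 450; 0]; [:: 809; 0]; [:: 37; 937]] [:: (2, 914); (10, 667); (50, 700); (14, 833); (18, 458)];
  Cert 1009 1009 [:: 214; 670] [:: [:: 504; 0]; [:: 797; 0]; [:: 237; 0]; [:: 625; 343]; [:: 1004; 375]] [:: (2, 674); (4, 892); (6, 811); (8, 655); (18, 993); (34, 394)];
  Cert 1013 1013 [:: 642; 554] [:: [:: 506; 0]; [:: 82; 0]; [:: 825; 0]; [:: 520; 234]; [:: 991; 726]] [:: (2, 298); (4, 908); (8, 720); (10, 746); (16, 493); (44, 212)];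
  Cert 1019 1019 [:: 787; 471] [:: [:: 509; 0]; [:: 947; 0]; [:: 28; 597]; [:: 844; 957]; [:: 528; 398]] [:: (2, 393); (14, 496)];
  Cert 1021 1021 [:: 902; 692] [:: [:: 510; 0]; [:: 217; 0]; [:: 180; 0]; [:: 255; 0]; [:: 879; 55]; [:: 464; 909]] [:: (2, 534); (8, 1014); (4, 653); (26, 905); (54, 994); (60, 396); (12, 855); (30, 463); (6, 212); (36, 20)];
  Cert 1031 1031 [:: 3; 275] [:: [:: 515; 0]; [:: 933; 0]; [:: 510; 0]; [:: 511; 120]; [:: 211; 872]] [:: (2, 981); (10, 622); (14, 288)];
  Cert 1033 1033 [:: 975; 900] [:: [:: 516; 0]; [:: 623; 0]; [:: 980; 0]; [:: 142; 740]; [:: 528; 606]] [:: (2, 264); (4, 662); (6, 190); (12, 110); (8, 307); (16, 960)];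
  Cert 1039 1039 [:: 731; 591] [:: [:: 519; 0]; [:: 739; 0]; [:: 561; 0]; [:: 361; 157]; [:: 1021; 698]] [:: (2, 618); (6, 862); (18, 309)];
  Cert 1049 1049 [:: 296; 118] [:: [:: 524; 0]; [:: 289; 0]; [:: 163; 984]; [:: 921; 580]; [:: 891; 1025]] [:: (2, 733); (8, 695); (4, 748); (16, 597)];
  Cert 1051 1051 [:: 535; 621] [:: [:: 525; 0]; [:: 410; 0]; [:: 971; 0]; [:: 984; 0]; [:: 44; 907]] [:: (2, 773); (14, 111); (26, 283); (38, 1000); (6, 574)];
  Cert 1061 1061 [:: 2; 413] [:: [:: 530; 0]; [:: 779; 0]; [:: 629; 0]; [:: 365; 697]; [:: 500; 609]] [:: (2, 244); (10, 61); (4, 757); (16, 88); (8, 871); (38, 561)];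
  Cert 1063 1063 [:: 123; 280] [:: [:: 531; 0]; [:: 948; 0]; [:: 246; 0]; [:: 603; 941]; [:: 677; 166]] [:: (2, 177); (10, 747); (18, 678)];
  Cert 1069 1069 [:: 257; 968] [:: [:: 534; 0]; [:: 741; 0]; [:: 701; 0]; [:: 816; 1064]; [:: 170; 522]] [:: (2, 139); (4, 23); (6, 178); (18, 65); (8, 21); (24, 418)];
  Cert 1091 1091 [:: 343; 311] [:: [:: 545; 0]; [:: 82; 0]; [:: 264; 0]; [:: 594; 1010]; [:: 686; 613]; [:: 96; 52]] [:: (2, 30); (34, 368); (38, 56)];
  Cert 1093 1093 [:: 214; 744] [:: [:: 546; 0]; [:: 50; 0]; [:: 410; 0]; [:: 336; 0]; [:: 49; 445]] [:: (2, 1013); (8, 327); (4, 490); (30, 826); (18, 885); (42, 528); (14, 180); (16, 694); (10, 230); (34, 843)];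
  Cert 1103 1103 [:: 154; 222] [:: [:: 551; 0]; [:: 514; 0]; [:: 427; 0]; [:: 807; 107]; [:: 509; 60]] [:: (2, 788); (10, 1022); (14, 360)];
  Cert 1109 1109 [:: 947; 609] [:: [:: 554; 0]; [:: 527; 0]; [:: 879; 334]; [:: 718; 462]; [:: 633; 750]] [:: (2, 600); (14, 845); (4, 9); (16, 606)];
  Cert 1117 1117 [:: 787; 247] [:: [:: 558; 0]; [:: 412; 0]; [:: 201; 0]; [:: 530; 665]; [:: 148; 243]] [:: (2, 593); (4, 489); (8, 537); (14, 375); (10, 344); (20, 298)];
  Cert 1123 1123 [:: 263; 601] [:: [:: 561; 0]; [:: 385; 0]; [:: 903; 0]; [:: 384; 0]; [:: 862; 397]] [:: (2, 41); (6, 696); (18, 371); (10, 924); (14, 991)];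
  Cert 1129 1129 [:: 410; 718] [:: [:: 564; 0]; [:: 623; 0]; [:: 1062; 0]; [:: 260; 243]; [:: 172; 759]] [:: (2, 949); (8, 441); (4, 150); (18, 262); (44, 325); (6, 831); (12, 1030)];
  Cert 1163 1163 [:: 359; 132] [:: [:: 581; 0]; [:: 1076; 0]; [:: 400; 0]; [:: 484; 442]; [:: 924; 823]] [:: (2, 193); (10, 1104); (14, 643)];
  Cert 1171 1171 [:: 790; 490] [:: [:: 585; 0]; [:: 640; 0]; [:: 866; 0]; [:: 770; 0]; [:: 437; 751]] [:: (30, 575); (38, 1066); (18, 223); (42, 37); (34, 365)];
  Cert 1181 1181 [:: 436; 255] [:: [:: 590; 0]; [:: 118; 0]; [:: 109; 0]; [:: 131; 476]; [:: 17; 463]] [:: (2, 48); (4, 596); (8, 516); (14, 972); (22, 1104); (26, 233)];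
  Cert 1217 1217 [:: 781; 132] [:: [:: 608; 0]; [:: 1113; 0]; [:: 287; 724]; [:: 707; 607]; [:: 612; 590]] [:: (2, 517); (8, 261); (4, 1120); (16, 103)];
  Cert 1223 1223 [:: 820; 424] [:: [:: 611; 0]; [:: 484; 0]; [:: 525; 0]; [:: 246; 469]; [:: 592; 202]] [:: (2, 330); (10, 306); (22, 1100)];
  Cert 1229 1229 [:: 1096; 477] [:: [:: 614; 0]; [:: 692; 0]; [:: 1006; 1047]; [:: 409; 578]; [:: 327; 1055]] [:: (2, 723); (8, 261); (4, 912); (14, 364)];
  Cert 1231 1231 [:: 1005; 460] [:: [:: 615; 0]; [:: 778; 0]; [:: 736; 0]; [:: 753; 0]; [:: 893; 1005]; [:: 179; 505]] [:: (2, 82); (6, 1178); (30, 397); (46, 727); (26, 1147)];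
  Cert 1259 1259 [:: 73; 1149] [:: [:: 629; 0]; [:: 290; 0]; [:: 674; 0]; [:: 598; 91]; [:: 85; 13]; [:: 545; 937]] [:: (2, 884); (22, 960); (26, 806)];
  Cert 1277 1277 [:: 744; 1120] [:: [:: 638; 0]; [:: 919; 0]; [:: 846; 0]; [:: 1067; 38]; [:: 39; 578]] [:: (2, 1188); (4, 1218); (8, 344); (20, 139); (16, 558); (26, 830)];
  Cert 1289 1289 [:: 295; 414] [:: [:: 644; 0]; [:: 874; 0]; [:: 419; 0]; [:: 655; 1071]; [:: 1233; 514]; [:: 817; 790]] [:: (2, 0); (8, 774); (4, 237); (16, 1046); (14, 1200); (28, 712)];
  Cert 1291 1291 [:: 369; 870] [:: [:: 645; 0]; [:: 115; 0]; [:: 451; 0]; [:: 1104; 0]; [:: 646; 92]; [:: 895; 1053]] [:: (2, 14); (6, 827); (54, 1113); (10, 205); (22, 651)];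
  Cert 1301 1301 [:: 175; 901] [:: [:: 650; 0]; [:: 970; 0]; [:: 490; 0]; [:: 1257; 608]; [:: 298; 987]; [:: 849; 658]] [:: (2, 347); (10, 332); (4, 1120); (16, 701); (26, 493); (34, 106)];
  Cert 1303 1303 [:: 1266; 253] [:: [:: 651; 0]; [:: 402; 0]; [:: 245; 0]; [:: 850; 0]; [:: 1091; 733]] [:: (2, 1030); (6, 43); (30, 962); (10, 29); (14, 815)];
  Cert 1319 1319 [:: 567; 1105] [:: [:: 659; 0]; [:: 542; 0]; [:: 765; 642]; [:: 1184; 1139]; [:: 555; 714]] [:: (2, 299); (14, 251)];
  Cert 1321 1321 [:: 1237; 618] [:: [:: 660; 0]; [:: 539; 0]; [:: 630; 0]; [:: 725; 0]; [:: 598; 1287]] [:: (2, 761); (6, 664); (4, 1078); (16, 187); (30, 639); (40, 311); (12, 463); (28, 372); (8, 4); (26, 330); (18, 652)];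
  Cert 1327 1327 [:: 387; 568] [:: [:: 663; 0]; [:: 1000; 0]; [:: 1023; 0]; [:: 288; 0]; [:: 336; 146]] [:: (2, 865); (10, 1302); (34, 382); (6, 1137); (26, 1049)];
  Cert 1331 11 [:: 5; 2; 6; 0; 0; 0] [:: [:: 5; 0; 0; 0; 0; 0]; [:: 6; 0; 0; 0; 0; 0]; [:: 4; 4; 7; 8; 5; 6]; [:: 9; 7; 4; 3; 6; 5]; [:: 4; 8; 5; 7; 0; 5]; [:: 2; 1; 10; 3; 7; 7]] [:: (2, 1242); (14, 1301); (26, 308); (50, 1052)];
  Cert 1361 1361 [:: 588; 855] [:: [:: 680; 0]; [:: 848; 0]; [:: 286; 0]; [:: 1335; 1256]; [:: 340; 1322]] [:: (2, 1189); (4, 1049); (8, 1063); (16, 864); (28, 406); (38, 2)];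
  Cert 1369 37 [:: 19; 32; 0; 0] [:: [:: 18; 0; 0; 0]; [:: 33; 0; 0; 0]; [:: 4; 16; 17; 16]; [:: 2; 17; 25; 13]; [:: 18; 4; 28; 0]] [:: (2, 1228); (8, 934); (4, 1057); (16, 160); (18, 406); (22, 993)];
  Cert 1381 1381 [:: 936; 327] [:: [:: 690; 0]; [:: 578; 0]; [:: 1324; 0]; [:: 485; 0]; [:: 1047; 758]] [:: (2, 54); (4, 348); (8, 748); (12, 267); (22, 1189); (44, 221); (6, 913); (10, 352); (14, 940); (18, 921)];
  Cert 1399 1399 [:: 720; 827] [:: [:: 699; 0]; [:: 596; 0]; [:: 694; 0]; [:: 1308; 369]; [:: 1378; 1328]] [:: (2, 954); (6, 91); (46, 989)];
  Cert 1409 1409 [:: 1020; 1185] [:: [:: 704; 0]; [:: 468; 0]; [:: 58; 271]; [:: 248; 1103]; [:: 385; 991]] [:: (2, 24); (4, 484); (8, 1012); (14, 188)];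
  Cert 1427 1427 [:: 1242; 298] [:: [:: 713; 0]; [:: 946; 0]; [:: 11; 0]; [:: 874; 133]; [:: 547; 49]; [:: 461; 40]] [:: (2, 586); (10, 641); (38, 774)];
  Cert 1429 1429 [:: 139; 501] [:: [:: 714; 0]; [:: 221; 0]; [:: 494; 0]; [:: 804; 0]; [:: 1293; 571]; [:: 211; 427]; [:: 1211; 848]] [:: (2, 54); (4, 344); (6, 1261); (8, 1189); (14, 255); (36, 655); (16, 665); (24, 30); (12, 1130); (28, 1009)];
  Cert 1451 1451 [:: 133; 172] [:: [:: 725; 0]; [:: 100; 0]; [:: 832; 0]; [:: 667; 1013]; [:: 1016; 1397]] [:: (2, 1322); (10, 434); (26, 1306)];
  Cert 1471 1471 [:: 186; 994] [:: [:: 735; 0]; [:: 1064; 0]; [:: 1338; 0]; [:: 659; 0]; [:: 533; 1060]] [:: (2, 631); (6, 119); (42, 118); (26, 1236); (10, 591)];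
  Cert 1481 1481 [:: 901; 306] [:: [:: 740; 0]; [:: 1107; 0]; [:: 587; 0]; [:: 1; 1118]; [:: 504; 834]; [:: 1360; 1022]] [:: (2, 248); (8, 740); (4, 1065); (10, 795); (16, 1033); (32, 1474)];
  Cert 1483 1483 [:: 4; 334] [:: [:: 741; 0]; [:: 481; 0]; [:: 329; 0]; [:: 237; 0]; [:: 1195; 1427]; [:: 587; 1404]] [:: (2, 1203); (6, 1131); (34, 429); (10, 1265); (38, 572)];
  Cert 1489 1489 [:: 1253; 534] [:: [:: 744; 0]; [:: 657; 0]; [:: 1385; 0]; [:: 1360; 20]; [:: 177; 320]] [:: (2, 223); (4, 135); (6, 1003); (22, 890); (18, 905); (48, 1049)];
  Cert 1499 1499 [:: 1430; 1141] [:: [:: 749; 0]; [:: 10; 0]; [:: 996; 0]; [:: 209; 1295]; [:: 691; 611]] [:: (2, 92); (14, 1080); (22, 259)];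
  Cert 1511 1511 [:: 252; 30] [:: [:: 755; 0]; [:: 1314; 0]; [:: 417; 0]; [:: 307; 735]; [:: 356; 631]] [:: (2, 5); (10, 180); (22, 62)];
  Cert 1531 1531 [:: 1248; 1498] [:: [:: 765; 0]; [:: 215; 0]; [:: 745; 0]; [:: 794; 0]; [:: 400; 581]] [:: (2, 1373); (6, 917); (34, 1205); (22, 306); (10, 1087)];
  Cert 1549 1549 [:: 1208; 664] [:: [:: 774; 0]; [:: 424; 0]; [:: 1338; 0]; [:: 1075; 433]; [:: 1091; 209]] [:: (2, 990); (4, 70); (6, 156); (16, 1494); (12, 1291); (42, 399)];
  Cert 1553 1553 [:: 1216; 639] [:: [:: 776; 0]; [:: 1060; 0]; [:: 83; 549]; [:: 337; 852]; [:: 702; 462]] [:: (2, 1115); (8, 1353); (4, 638); (10, 818)];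
  Cert 1559 1559 [:: 549; 1057] [:: [:: 779; 0]; [:: 830; 0]; [:: 1127; 0]; [:: 673; 12]; [:: 482; 769]; [:: 539; 86]] [:: (2, 267); (14, 434); (22, 792)];
  Cert 1571 1571 [:: 235; 144] [:: [:: 785; 0]; [:: 635; 0]; [:: 520; 0]; [:: 197; 270]; [:: 1320; 1149]] [:: (2, 200); (10, 715); (14, 998)];
  Cert 1579 1579 [:: 1566; 95] [:: [:: 789; 0]; [:: 839; 0]; [:: 1247; 0]; [:: 200; 644]; [:: 1335; 537]] [:: (2, 448); (6, 553); (14, 759)];
  Cert 1583 1583 [:: 749; 35] [:: [:: 791; 0]; [:: 806; 0]; [:: 20; 0]; [:: 1565; 1]; [:: 108; 627]] [:: (2, 1251); (10, 641); (26, 106)];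
  Cert 1597 1597 [:: 1014; 684] [:: [:: 798; 0]; [:: 606; 0]; [:: 456; 0]; [:: 33; 0]; [:: 286; 1337]; [:: 1586; 1548]] [:: (2, 800); (4, 524); (6, 155); (18, 1136); (12, 394); (22, 518); (8, 874); (30, 808); (10, 901); (40, 97); (62, 1392)];
  Cert 1609 1609 [:: 46; 1440] [:: [:: 804; 0]; [:: 83; 0]; [:: 532; 0]; [:: 1316; 1358]; [:: 1199; 614]; [:: 1384; 759]] [:: (2, 1372); (4, 100); (6, 669); (8, 1311); (12, 412); (38, 362)];
  Cert 1637 1637 [:: 1525; 905] [:: [:: 818; 0]; [:: 200; 0]; [:: 1578; 342]; [:: 958; 63]; [:: 1317; 1616]] [:: (2, 1020); (4, 730); (8, 639); (10, 773)];
  Cert 1681 41 [:: 7; 32; 0; 0] [:: [:: 20; 0; 0; 0]; [:: 40; 8; 36; 6]; [:: 8; 0; 0; 0]; [:: 33; 38; 7; 8]; [:: 5; 25; 5; 16]] [:: (26, 1462); (20, 964); (60, 1042); (22, 1548); (30, 608); (14, 1215); (6, 1535); (34, 1628); (54, 247); (44, 1547)];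
  Cert 1693 1693 [:: 344; 220] [:: [:: 846; 0]; [:: 1548; 0]; [:: 138; 0]; [:: 74; 715]; [:: 556; 1080]] [:: (2, 82); (4, 792); (10, 694); (18, 1503); (12, 787); (36, 1682)];
  Cert 1699 1699 [:: 1357; 667] [:: [:: 849; 0]; [:: 1566; 0]; [:: 1629; 0]; [:: 507; 1402]; [:: 677; 566]] [:: (2, 366); (6, 1591); (14, 1276)];
  Cert 1709 1709 [:: 1134; 905] [:: [:: 854; 0]; [:: 557; 0]; [:: 1376; 0]; [:: 1110; 1242]; [:: 1447; 941]; [:: 1705; 457]] [:: (2, 1242); (4, 610); (8, 859); (16, 1184); (14, 594); (32, 790)];
  Cert 1721 1721 [:: 103; 1576] [:: [:: 860; 0]; [:: 918; 0]; [:: 466; 0]; [:: 600; 1302]; [:: 828; 1590]; [:: 633; 1706]] [:: (2, 530); (8, 280); (4, 1465); (10, 477); (20, 1250); (44, 767)];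
  Cert 1741 1741 [:: 1261; 1015] [:: [:: 870; 0]; [:: 1279; 0]; [:: 619; 0]; [:: 354; 0]; [:: 869; 494]; [:: 893; 825]] [:: (16, 574); (6, 292); (32, 404); (2, 1372); (30, 999); (44, 1005); (24, 1174); (40, 305); (54, 725); (50, 792)];
  Cert 1759 1759 [:: 872; 1499] [:: [:: 879; 0]; [:: 1589; 0]; [:: 849; 0]; [:: 429; 1079]; [:: 958; 393]] [:: (2, 739); (6, 436); (14, 1677)];
  Cert 1801 1801 [:: 992; 1215] [:: [:: 900; 0]; [:: 24; 0]; [:: 1382; 0]; [:: 1078; 394]; [:: 993; 1076]] [:: (26, 875); (8, 425); (10, 1258); (22, 1705); (36, 1545); (44, 718)];
  Cert 1847 1847 [:: 1702; 883] [:: [:: 923; 0]; [:: 1217; 0]; [:: 1319; 0]; [:: 931; 46]; [:: 1349; 1526]; [:: 1318; 886]] [:: (2, 625); (10, 1637); (26, 1305)];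
  Cert 1849 43 [:: 38; 23; 16; 0] [:: [:: 21; 0; 0; 0]; [:: 16; 0; 0; 0]; [:: 23; 0; 0; 0]; [:: 42; 30; 26; 21]; [:: 14; 6; 5; 28]; [:: 23; 14; 6; 32]] [:: (2, 1845); (4, 401); (6, 826); (14, 379); (16, 79); (32, 350); (22, 692); (24, 1566); (8, 347); (34, 1543)];
  Cert 1861 1861 [:: 1294; 1485] [:: [:: 930; 0]; [:: 1709; 0]; [:: 58; 0]; [:: 968; 0]; [:: 701; 761]; [:: 365; 878]] [:: (2, 279); (16, 1013); (4, 308); (18, 1816); (58, 429); (60, 1643); (30, 1804); (62, 1133); (24, 1052); (48, 1323)];
  Cert 1871 1871 [:: 1253; 735] [:: [:: 935; 0]; [:: 1455; 0]; [:: 884; 0]; [:: 934; 0]; [:: 1343; 396]; [:: 582; 813]] [:: (50, 1555); (34, 1174); (58, 1650); (14, 920)];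
  Cert 1889 1889 [:: 1246; 1443] [:: [:: 944; 0]; [:: 1586; 0]; [:: 1817; 851]; [:: 908; 1406]; [:: 1681; 1545]] [:: (2, 1435); (16, 1351); (4, 868); (32, 63)];
  Cert 1931 1931 [:: 604; 1360] [:: [:: 965; 0]; [:: 402; 0]; [:: 1571; 0]; [:: 1891; 754]; [:: 586; 1906]; [:: 1662; 530]] [:: (2, 825); (10, 1902); (22, 376)];
  Cert 1951 1951 [:: 1622; 1848] [:: [:: 975; 0]; [:: 25; 0]; [:: 1225; 0]; [:: 1411; 0]; [:: 30; 1819]] [:: (2, 785); (18, 1154); (34, 1709); (6, 559); (38, 1012)];
  Cert 1973 1973 [:: 61; 311] [:: [:: 986; 0]; [:: 1118; 0]; [:: 61; 0]; [:: 1920; 787]; [:: 1580; 1468]; [:: 1128; 145]] [:: (2, 634); (10, 1873); (8, 315); (16, 1402); (22, 514); (32, 1780)];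
  Cert 1979 1979 [:: 1032; 1962] [:: [:: 989; 0]; [:: 135; 0]; [:: 1845; 0]; [:: 1364; 859]; [:: 537; 1693]; [:: 1777; 1024]] [:: (2, 740); (14, 1100); (26, 484)];
  Cert 2003 2003 [:: 1985; 1142] [:: [:: 1001; 0]; [:: 1511; 0]; [:: 822; 0]; [:: 599; 0]; [:: 851; 551]; [:: 125; 654]] [:: (2, 1598); (14, 1220); (22, 823); (50, 1597)];
  Cert 2029 2029 [:: 1628; 1209] [:: [:: 1014; 0]; [:: 1001; 0]; [:: 1847; 0]; [:: 2017; 1205]; [:: 669; 1657]; [:: 59; 1705]] [:: (2, 549); (4, 1563); (6, 284); (8, 946); (18, 384); (44, 1754)];
  Cert 2069 2069 [:: 993; 185] [:: [:: 1034; 0]; [:: 84; 0]; [:: 1430; 0]; [:: 631; 1078]; [:: 954; 1287]; [:: 1330; 1652]] [:: (2, 897); (8, 1345); (4, 608); (16, 1389); (14, 543); (32, 179)];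
  Cert 2089 2089 [:: 858; 1671] [:: [:: 1044; 0]; [:: 1813; 0]; [:: 649; 0]; [:: 1993; 1134]; [:: 1392; 1391]; [:: 1586; 1242]] [:: (2, 128); (4, 1186); (6, 429); (18, 732); (24, 1421); (46, 717)];
  Cert 2099 2099 [:: 862; 1061] [:: [:: 1049; 0]; [:: 1399; 0]; [:: 1341; 223]; [:: 560; 1819]; [:: 1276; 1877]] [:: (2, 573); (22, 500)];
  Cert 2129 2129 [:: 166; 1587] [:: [:: 1064; 0]; [:: 2124; 0]; [:: 1088; 0]; [:: 1909; 883]; [:: 1674; 1872]; [:: 1930; 396]] [:: (2, 1668); (16, 1062); (4, 2079); (22, 403); (14, 660); (28, 1618)];
  Cert 2131 2131 [:: 666; 44] [:: [:: 1065; 0]; [:: 866; 0]; [:: 1194; 0]; [:: 2100; 0]; [:: 1306; 1442]; [:: 1750; 2003]] [:: (2, 2038); (10, 1129); (18, 1972); (14, 363); (62, 1825)];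
  Cert 2141 2141 [:: 626; 412] [:: [:: 1070; 0]; [:: 273; 0]; [:: 507; 0]; [:: 875; 531]; [:: 1418; 1391]; [:: 569; 969]] [:: (2, 2021); (8, 931); (4, 1496); (22, 882); (10, 681); (38, 582)];
  Cert 2209 47 [:: 9; 42; 0; 0] [:: [:: 23; 0; 0; 0]; [:: 13; 11; 31; 13]; [:: 10; 0; 0; 0]; [:: 20; 36; 35; 18]; [:: 15; 19; 36; 1]; [:: 16; 8; 44; 42]] [:: (2, 1820); (4, 212); (6, 1735); (12, 87); (18, 1298); (8, 1552); (22, 495)];
  Cert 2221 2221 [:: 956; 1186] [:: [:: 1110; 0]; [:: 921; 0]; [:: 26; 0]; [:: 569; 0]; [:: 677; 1600]; [:: 969; 798]] [:: (2, 408); (6, 1279); (4, 441); (8, 922); (16, 1450); (28, 1379); (18, 1622); (40, 2080); (14, 674); (48, 1308)];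
  Cert 2239 2239 [:: 723; 916] [:: [:: 1119; 0]; [:: 2140; 0]; [:: 1808; 0]; [:: 445; 549]; [:: 415; 1869]] [:: (2, 1706); (6, 1694); (26, 1342)];
  Cert 2243 2243 [:: 1553; 226] [:: [:: 1121; 0]; [:: 325; 0]; [:: 1938; 0]; [:: 2022; 1183]; [:: 604; 1136]; [:: 1924; 1958]] [:: (2, 10); (10, 1642); (14, 1546)];
  Cert 2281 2281 [:: 1911; 298] [:: [:: 1140; 0]; [:: 1299; 0]; [:: 1785; 0]; [:: 2115; 0]; [:: 1765; 1741]; [:: 1267; 91]] [:: (2, 2220); (6, 77); (4, 1173); (8, 2212); (18, 1315); (20, 85); (10, 1937); (32, 1259); (46, 680); (48, 1874)];
  Cert 2309 2309 [:: 581; 1907] [:: [:: 1154; 0]; [:: 1641; 0]; [:: 1782; 118]; [:: 1677; 1944]; [:: 2106; 223]; [:: 1103; 689]] [:: (2, 1737); (4, 2049); (8, 1872); (26, 1044)];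
  Cert 2311 2311 [:: 113; 2192] [:: [:: 1155; 0]; [:: 1064; 0]; [:: 1017; 0]; [:: 1557; 0]; [:: 1891; 0]; [:: 1728; 1136]] [:: (62, 1329); (114, 658); (2, 1408); (22, 1461); (98, 1759); (66, 1655); (58, 1490)];
  Cert 2339 2339 [:: 1903; 169] [:: [:: 1169; 0]; [:: 722; 0]; [:: 1649; 0]; [:: 1863; 753]; [:: 2245; 790]; [:: 1092; 513]] [:: (2, 1497); (14, 389); (34, 815)];
  Cert 2351 2351 [:: 354; 318] [:: [:: 1175; 0]; [:: 173; 0]; [:: 181; 0]; [:: 2297; 1856]; [:: 2004; 2331]] [:: (2, 1856); (10, 1408); (34, 1024)];
  Cert 2381 2381 [:: 637; 1490] [:: [:: 1190; 0]; [:: 968; 0]; [:: 1658; 0]; [:: 819; 0]; [:: 2225; 1277]; [:: 2362; 2242]] [:: (2, 1593); (4, 1051); (8, 782); (10, 1400); (22, 1327); (26, 1304); (32, 2249); (56, 1122)];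
  Cert 2393 2393 [:: 251; 494] [:: [:: 1196; 0]; [:: 2268; 0]; [:: 2264; 0]; [:: 1106; 136]; [:: 1121; 911]; [:: 530; 1485]] [:: (2, 2205); (8, 3); (4, 968); (10, 1192); (16, 1596); (26, 68)];
  Cert 2437 2437 [:: 722; 1639] [:: [:: 1218; 0]; [:: 28; 0]; [:: 2385; 0]; [:: 183; 0]; [:: 1230; 55]; [:: 1911; 130]] [:: (2, 392); (8, 1072); (6, 890); (10, 775); (18, 1494); (30, 1627); (16, 2242); (24, 833); (28, 2310); (34, 1554)];
  Cert 2441 2441 [:: 328; 1344] [:: [:: 1220; 0]; [:: 2008; 0]; [:: 1318; 0]; [:: 86; 1985]; [:: 930; 400]; [:: 1893; 671]] [:: (2, 752); (14, 1725); (8, 527); (16, 14); (26, 1360); (34, 957)];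
  Cert 2521 2521 [:: 2257; 541] [:: [:: 1260; 0]; [:: 1065; 0]; [:: 1827; 0]; [:: 1921; 0]; [:: 888; 2322]; [:: 2063; 477]] [:: (32, 1188); (56, 789); (28, 27); (14, 131); (22, 290); (54, 2403); (10, 391); (62, 1684); (46, 2195); (38, 198); (30, 1626)];
  Cert 2531 2531 [:: 1636; 1207] [:: [:: 1265; 0]; [:: 251; 0]; [:: 2198; 0]; [:: 587; 0]; [:: 1299; 2424]; [:: 315; 1352]] [:: (2, 2432); (14, 1161); (22, 1976); (50, 1008)];
  Cert 2549 2549 [:: 1011; 1671] [:: [:: 1274; 0]; [:: 404; 0]; [:: 1086; 0]; [:: 1449; 912]; [:: 2530; 1768]; [:: 2100; 838]] [:: (2, 769); (22, 698); (4, 1746); (38, 1192); (26, 2491); (58, 1590)];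
  Cert 2551 2551 [:: 934; 1029] [:: [:: 1275; 0]; [:: 833; 0]; [:: 1784; 0]; [:: 2483; 0]; [:: 1488; 959]; [:: 759; 120]] [:: (2, 672); (6, 933); (54, 1375); (38, 1101); (42, 1725)];
  Cert 2617 2617 [:: 1516; 2006] [:: [:: 1308; 0]; [:: 2099; 0]; [:: 2263; 0]; [:: 1302; 681]; [:: 1682; 2040]; [:: 2239; 320]] [:: (2, 1359); (4, 1); (6, 1281); (16, 179); (8, 470); (20, 2249)];
  Cert 2621 2621 [:: 1923; 961] [:: [:: 1310; 0]; [:: 1342; 0]; [:: 1420; 0]; [:: 2560; 1612]; [:: 860; 1831]; [:: 2366; 456]] [:: (2, 1024); (4, 2186); (8, 296); (10, 602); (14, 1543); (20, 259)];
  Cert 2659 2659 [:: 2180; 1332] [:: [:: 1329; 0]; [:: 1187; 0]; [:: 2265; 0]; [:: 2266; 314]; [:: 719; 488]; [:: 2433; 1244]] [:: (2, 530); (6, 108); (26, 837)];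
  Cert 2729 2729 [:: 2354; 654] [:: [:: 1364; 0]; [:: 834; 0]; [:: 2532; 0]; [:: 1272; 718]; [:: 2504; 2375]; [:: 2410; 2634]; [:: 1992; 2218]] [:: (2, 409); (4, 2023); (8, 37); (22, 2007); (16, 2223); (34, 1869)];
  Cert 2731 2731 [:: 1907; 2497] [:: [:: 1365; 0]; [:: 761; 0]; [:: 1655; 0]; [:: 93; 0]; [:: 909; 0]; [:: 2014; 2153]] [:: (2, 2405); (6, 2163); (50, 1326); (10, 203); (126, 2710); (82, 34); (26, 450)];
  Cert 2789 2789 [:: 1384; 947] [:: [:: 1394; 0]; [:: 1669; 0]; [:: 2628; 0]; [:: 1198; 2168]; [:: 1210; 1523]; [:: 2534; 83]] [:: (2, 56); (16, 364); (4, 917); (22, 621); (8, 901); (34, 579)];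
  Cert 2851 2851 [:: 54; 807] [:: [:: 1425; 0]; [:: 1562; 0]; [:: 2719; 0]; [:: 1730; 0]; [:: 1769; 575]; [:: 2211; 369]] [:: (2, 434); (6, 2699); (54, 699); (18, 1103); (34, 1242)];
  Cert 2861 2861 [:: 1276; 785] [:: [:: 1430; 0]; [:: 58; 0]; [:: 1418; 0]; [:: 2461; 0]; [:: 1345; 146]; [:: 634; 997]] [:: (20, 303); (52, 1338); (56, 1206); (34, 936); (40, 176); (16, 513); (28, 2148); (38, 2296)];
  Cert 2927 2927 [:: 1560; 32] [:: [:: 1463; 0]; [:: 523; 0]; [:: 269; 0]; [:: 562; 0]; [:: 2253; 1780]; [:: 2635; 2122]] [:: (2, 1340); (10, 2715); (22, 29); (34, 1009)];
  Cert 2939 2939 [:: 2811; 1152] [:: [:: 1469; 0]; [:: 1643; 0]; [:: 875; 0]; [:: 661; 1675]; [:: 2396; 228]; [:: 596; 2068]] [:: (2, 1353); (22, 2413); (26, 215)];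
  Cert 2969 2969 [:: 1527; 1274] [:: [:: 1484; 0]; [:: 1515; 0]; [:: 137; 0]; [:: 866; 2406]; [:: 164; 1680]; [:: 2277; 1150]] [:: (2, 964); (4, 826); (8, 2712); (16, 2339); (26, 2462); (14, 2631); (52, 472)];
  Cert 3011 3011 [:: 1258; 2947] [:: [:: 1505; 0]; [:: 1555; 0]; [:: 2639; 0]; [:: 1419; 0]; [:: 2842; 1265]; [:: 749; 2611]] [:: (14, 2384); (38, 672); (34, 2902); (62, 2327)];
  Cert 3037 3037 [:: 2348; 251] [:: [:: 1518; 0]; [:: 248; 0]; [:: 2173; 0]; [:: 2433; 0]; [:: 1827; 1147]; [:: 3005; 1549]] [:: (2, 2295); (6, 1118); (8, 2605); (12, 2950); (18, 2571); (36, 1261); (16, 288); (22, 272); (30, 1485); (38, 1644)];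
  Cert 3079 3079 [:: 441; 1949] [:: [:: 1539; 0]; [:: 1208; 0]; [:: 1681; 0]; [:: 1335; 1095]; [:: 393; 265]; [:: 1965; 2513]] [:: (2, 881); (18, 227); (26, 1666)];
  Cert 3109 3109 [:: 1194; 1287] [:: [:: 1554; 0]; [:: 2434; 0]; [:: 1500; 0]; [:: 2007; 0]; [:: 2181; 2550]; [:: 2919; 940]] [:: (28, 2352); (48, 2687); (18, 503); (16, 849); (4, 1622); (32, 2377); (62, 2629); (52, 681); (46, 189); (6, 2894)];
  Cert 3121 3121 [:: 2101; 698] [:: [:: 1560; 0]; [:: 666; 0]; [:: 549; 0]; [:: 134; 0]; [:: 518; 781]; [:: 213; 138]] [:: (2, 2925); (6, 2674); (8, 2464); (12, 2325); (16, 1831); (50, 1343); (26, 1138); (36, 380); (4, 536); (34, 2202)];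
  Cert 3191 3191 [:: 2229; 1489] [:: [:: 1595; 0]; [:: 2144; 0]; [:: 1543; 0]; [:: 2834; 0]; [:: 2241; 117]; [:: 121; 227]; [:: 542; 160]] [:: (2, 2431); (22, 2205); (26, 404); (46, 1456)];
  Cert 3221 3221 [:: 2033; 2631] [:: [:: 1610; 0]; [:: 321; 0]; [:: 1542; 0]; [:: 1622; 0]; [:: 1227; 2106]; [:: 793; 565]] [:: (2, 2556); (4, 232); (8, 2898); (16, 3007); (20, 442); (38, 786); (32, 2754); (94, 3100)];
  Cert 3229 3229 [:: 2911; 2182] [:: [:: 1614; 0]; [:: 771; 0]; [:: 1413; 0]; [:: 1190; 616]; [:: 3215; 111]; [:: 1875; 1083]] [:: (2, 913); (6, 1278); (4, 1374); (18, 508); (26, 57); (42, 1580)];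
  Cert 3299 3299 [:: 742; 1133] [:: [:: 1649; 0]; [:: 712; 0]; [:: 1332; 0]; [:: 2281; 226]; [:: 2595; 735]; [:: 597; 459]] [:: (2, 1832); (26, 3242); (34, 1939)];
  Cert 3301 3301 [:: 473; 2127] [:: [:: 1650; 0]; [:: 2725; 0]; [:: 837; 0]; [:: 2694; 0]; [:: 450; 774]; [:: 397; 1848]] [:: (2, 1980); (12, 2216); (6, 2674); (24, 3084); (38, 1552); (48, 1300); (30, 383); (32, 33); (4, 641); (22, 3291)];
  Cert 3319 3319 [:: 2562; 1132] [:: [:: 1659; 0]; [:: 1703; 0]; [:: 3152; 0]; [:: 264; 0]; [:: 59; 1504]; [:: 5; 1422]] [:: (2, 1608); (14, 2450); (34, 1268); (26, 2240); (18, 1731)];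
  Cert 3331 3331 [:: 2968; 2431] [:: [:: 1665; 0]; [:: 2708; 0]; [:: 1927; 0]; [:: 36; 0]; [:: 3166; 218]; [:: 2394; 3266]] [:: (2, 1551); (18, 2701); (50, 1324); (22, 2337); (10, 3037)];
  Cert 3359 3359 [:: 916; 1352] [:: [:: 1679; 0]; [:: 803; 0]; [:: 2109; 0]; [:: 883; 1949]; [:: 2481; 3328]; [:: 1743; 2544]] [:: (2, 1274); (22, 1268); (34, 2000)];
  Cert 3389 3389 [:: 2579; 1701] [:: [:: 1694; 0]; [:: 170; 0]; [:: 930; 0]; [:: 2011; 1988]; [:: 222; 1235]; [:: 1335; 2196]] [:: (2, 2196); (4, 1176); (14, 3026); (16, 2626); (26, 2100); (32, 2768)];
  Cert 3499 3499 [:: 1272; 2609] [:: [:: 1749; 0]; [:: 2280; 0]; [:: 3481; 0]; [:: 739; 0]; [:: 1092; 258]; [:: 1365; 7]] [:: (2, 3252); (6, 3196); (22, 1409); (18, 955); (26, 2392)];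
  Cert 3541 3541 [:: 3106; 2134] [:: [:: 1770; 0]; [:: 2380; 0]; [:: 470; 0]; [:: 1145; 0]; [:: 1542; 1706]; [:: 229; 1684]; [:: 1112; 140]] [:: (2, 1444); (6, 1943); (4, 3187); (8, 1510); (20, 941); (30, 3127); (18, 2226); (36, 606); (10, 2901); (34, 2230)];
  Cert 3571 3571 [:: 886; 938] [:: [:: 1785; 0]; [:: 34; 0]; [:: 2410; 0]; [:: 936; 0]; [:: 1151; 0]; [:: 3080; 1383]; [:: 1273; 2765]] [:: (2, 2296); (10, 2386); (58, 843); (34, 1525); (82, 1578); (22, 2069); (6, 1419)];
  Cert 3709 3709 [:: 3576; 1614] [:: [:: 1854; 0]; [:: 1402; 0]; [:: 2730; 0]; [:: 2566; 831]; [:: 591; 2511]; [:: 676; 2157]] [:: (2, 1471); (8, 2231); (4, 1738); (16, 1457); (22, 1672); (58, 3135)];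
  Cert 3719 3719 [:: 3546; 2176] [:: [:: 1859; 0]; [:: 1571; 0]; [:: 1270; 0]; [:: 982; 2479]; [:: 2477; 895]; [:: 2499; 1312]] [:: (2, 198); (26, 2936); (34, 887)];
  Cert 3739 3739 [:: 1881; 592] [:: [:: 1869; 0]; [:: 231; 0]; [:: 1414; 0]; [:: 2583; 0]; [:: 765; 509]; [:: 1396; 2389]; [:: 1746; 392]] [:: (2, 3228); (6, 2113); (18, 3318); (26, 938); (14, 1144)];
  Cert 3761 3761 [:: 1098; 1533] [:: [:: 1880; 0]; [:: 2892; 0]; [:: 3751; 0]; [:: 1198; 337]; [:: 2632; 3235]; [:: 2119; 483]] [:: (2, 3591); (4, 2681); (10, 912); (16, 302); (14, 2778); (52, 1882)];
  Cert 3821 3821 [:: 1043; 3338] [:: [:: 1910; 0]; [:: 2470; 0]; [:: 1966; 0]; [:: 582; 3238]; [:: 790; 383]; [:: 1181; 2750]] [:: (2, 1962); (16, 1030); (4, 2921); (32, 1194); (8, 1567); (34, 747)];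
  Cert 3851 3851 [:: 741; 3207] [:: [:: 1925; 0]; [:: 2496; 0]; [:: 2535; 0]; [:: 1443; 0]; [:: 1934; 897]; [:: 855; 3752]] [:: (34, 2245); (2, 1148); (46, 3422); (14, 1193)];
  Cert 3989 3989 [:: 694; 1539] [:: [:: 1994; 0]; [:: 327; 0]; [:: 314; 2506]; [:: 2583; 3742]; [:: 3551; 2564]; [:: 119; 1301]] [:: (2, 3976); (8, 2694); (4, 1043); (16, 1232)];
  Cert 4003 4003 [:: 2229; 2428] [:: [:: 2001; 0]; [:: 2394; 0]; [:: 3498; 0]; [:: 935; 0]; [:: 2864; 1737]; [:: 3052; 42]; [:: 3038; 807]] [:: (2, 3288); (6, 3991); (18, 3159); (10, 2394); (50, 792)];
  Cert 4019 4019 [:: 3301; 2334] [:: [:: 2009; 0]; [:: 2438; 0]; [:: 3026; 0]; [:: 3367; 3701]; [:: 292; 1503]; [:: 2281; 1274]] [:: (2, 1315); (14, 3187); (22, 3857)];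
  Cert 4159 4159 [:: 3843; 187] [:: [:: 2079; 0]; [:: 851; 0]; [:: 306; 0]; [:: 1112; 0]; [:: 3990; 1314]; [:: 1974; 2670]] [:: (2, 1054); (6, 3221); (14, 2849); (18, 902); (22, 1689)];
  Cert 4201 4201 [:: 487; 3083] [:: [:: 2100; 0]; [:: 3175; 0]; [:: 517; 0]; [:: 1598; 0]; [:: 3414; 1806]; [:: 1996; 586]] [:: (52, 1355); (60, 2122); (36, 883); (26, 3853); (2, 3189); (38, 3576); (48, 2617); (14, 1071); (32, 1551); (6, 1329)];
  Cert 4409 4409 [:: 355; 4311] [:: [:: 2204; 0]; [:: 1491; 0]; [:: 2511; 0]; [:: 3265; 2901]; [:: 2710; 1450]; [:: 3222; 3440]] [:: (2, 3365); (32, 1697); (4, 2072); (52, 2593); (8, 1144); (46, 2864); (58, 798)];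
  Cert 4421 4421 [:: 809; 509] [:: [:: 2210; 0]; [:: 3043; 0]; [:: 1950; 0]; [:: 3270; 0]; [:: 123; 69]; [:: 220; 2987]; [:: 4122; 227]] [:: (2, 2610); (4, 2454); (10, 4223); (20, 1793); (14, 3743); (26, 4198); (28, 2344); (52, 3533)];
  Cert 4523 4523 [:: 3404; 1265] [:: [:: 2261; 0]; [:: 2133; 0]; [:: 395; 0]; [:: 966; 0]; [:: 3060; 1361]; [:: 2356; 2896]; [:: 3892; 2014]] [:: (2, 3475); (10, 3753); (34, 434); (46, 3578)];
  Cert 4621 4621 [:: 2669; 4241] [:: [:: 2310; 0]; [:: 952; 0]; [:: 3269; 0]; [:: 2060; 0]; [:: 3765; 0]; [:: 1881; 4108]] [:: (2, 698); (6, 2917); (12, 3908); (16, 3247); (18, 4437); (20, 4075); (34, 4240); (30, 2491); (22, 3800); (50, 2691); (58, 3942); (62, 2071); (48, 2501); (42, 3533)];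
  Cert 4691 4691 [:: 2124; 877] [:: [:: 2345; 0]; [:: 4253; 0]; [:: 2821; 0]; [:: 2415; 0]; [:: 3521; 2062]; [:: 4618; 4520]; [:: 1049; 2993]] [:: (10, 422); (50, 759); (58, 172); (22, 3049); (38, 2366)];
  Cert 4759 4759 [:: 4068; 4697] [:: [:: 2379; 0]; [:: 508; 0]; [:: 1688; 0]; [:: 2704; 0]; [:: 4747; 1151]; [:: 1347; 2730]; [:: 2561; 1234]] [:: (2, 4013); (6, 3489); (22, 2245); (18, 3220); (26, 562)];
  Cert 5279 5279 [:: 2676; 1333] [:: [:: 2639; 0]; [:: 3181; 0]; [:: 1298; 0]; [:: 2190; 0]; [:: 3745; 3618]; [:: 2470; 2416]; [:: 307; 352]] [:: (2, 2396); (14, 396); (34, 2983); (46, 3963)];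
  Cert 5641 5641 [:: 4065; 2739] [:: [:: 2820; 0]; [:: 681; 0]; [:: 4538; 0]; [:: 2626; 0]; [:: 3627; 2823]; [:: 3225; 4059]; [:: 2106; 3374]] [:: (2, 2853); (4, 67); (10, 5265); (18, 960); (44, 821); (74, 3961); (8, 27); (22, 5067); (6, 4728); (38, 5625)];
  Cert 5741 5741 [:: 704; 2294] [:: [:: 2870; 0]; [:: 4259; 0]; [:: 5482; 0]; [:: 705; 0]; [:: 3999; 5725]; [:: 1728; 962]; [:: 3398; 440]] [:: (10, 4072); (32, 728); (56, 5138); (26, 3612); (4, 4780); (34, 1198); (46, 3237); (14, 2482)];
  Cert 5851 5851 [:: 969; 2217] [:: [:: 2925; 0]; [:: 192; 0]; [:: 1563; 0]; [:: 713; 0]; [:: 2152; 1922]; [:: 3595; 1604]; [:: 2142; 2946]] [:: (2, 4139); (18, 2559); (46, 94); (10, 3159); (30, 1448)];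
  Cert 6889 83 [:: 38; 78; 21; 0] [:: [:: 41; 0; 0; 0]; [:: 68; 25; 17; 5]; [:: 50; 36; 61; 57]; [:: 13; 0; 0; 0]; [:: 74; 7; 9; 34]; [:: 5; 46; 78; 76]; [:: 78; 39; 58; 45]] [:: (2, 1178); (62, 4987); (16, 972); (18, 6056); (54, 5928); (36, 3038); (22, 2326); (32, 5764); (12, 2968); (28, 3141)];
  Cert 6971 6971 [:: 1952; 6818] [:: [:: 3485; 0]; [:: 1166; 0]; [:: 1734; 0]; [:: 5500; 0]; [:: 2698; 2769]; [:: 2289; 5953]; [:: 812; 6526]] [:: (2, 6110); (10, 3658); (50, 3200); (58, 4505)];
  Cert 7309 7309 [:: 1916; 659] [:: [:: 3654; 0]; [:: 1297; 0]; [:: 1053; 0]; [:: 5445; 0]; [:: 7147; 4448]; [:: 714; 6231]; [:: 3365; 2574]] [:: (2, 5233); (12, 4931); (4, 256); (18, 78); (38, 5444); (52, 4176); (8, 6388); (26, 2788); (22, 2809); (28, 5907)];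
  Cert 7589 7589 [:: 5466; 1071] [:: [:: 3794; 0]; [:: 2606; 0]; [:: 3473; 0]; [:: 3664; 1630]; [:: 2977; 4990]; [:: 3281; 7016]; [:: 5315; 3696]] [:: (2, 5769); (16, 201); (4, 3286); (32, 6799); (14, 2881); (34, 5990)];
  Cert 8009 8009 [:: 7068; 3086] [:: [:: 4004; 0]; [:: 6890; 0]; [:: 2254; 0]; [:: 3963; 0]; [:: 3246; 6743]; [:: 3207; 613]; [:: 6807; 4597]] [:: (82, 2964); (94, 4087); (46, 3367); (56, 4765); (4, 1661); (116, 2952); (86, 5614); (112, 7298)];
  Cert 8161 8161 [:: 2403; 536] [:: [:: 4080; 0]; [:: 1752; 0]; [:: 1790; 0]; [:: 5850; 0]; [:: 6148; 6448]; [:: 4488; 6576]; [:: 4513; 7459]] [:: (2, 5710); (12, 1510); (16, 5884); (18, 6562); (20, 4287); (26, 7801); (36, 5420); (40, 5855); (4, 2181); (54, 2323)];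
  Cert 8581 8581 [:: 3074; 2003] [:: [:: 4290; 0]; [:: 8439; 0]; [:: 496; 0]; [:: 6781; 0]; [:: 2717; 0]; [:: 132; 6743]; [:: 1155; 7059]] [:: (2, 3295); (8, 1869); (12, 8128); (18, 6462); (16, 4936); (22, 2562); (6, 1263); (48, 6431); (20, 2816); (30, 7200); (74, 1904); (62, 2793); (78, 1268); (32, 1082)];
  Cert 14629 14629 [:: 6683; 9734] [:: [:: 7314; 0]; [:: 2491; 0]; [:: 11988; 0]; [:: 5736; 0]; [:: 261; 11261]; [:: 3314; 5841]; [:: 3985; 11660]; [:: 5669; 3481]] [:: (2, 3939); (6, 13776); (4, 12948); (12, 10247); (16, 10472); (34, 1980); (8, 2076); (32, 1953); (18, 2217); (36, 1347)]]%num.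

(** * The range below 34700 and the conclusion *)

Definition excluded_q : list N := [:: 5; 7; 11; 13; 31; 41]%num.

Lemma certs_ok : all cert_ok certs.
Proof. by vm_compute. Qed.

(** Starting from 3, 17349 odd numbers end with 34699, the last one below 34700. *)
Lemma small_q_ok : range_ok (map cert_q certs ++ excluded_q) (N.to_nat 17349) 3%num.
Proof. by vm_compute. Qed.

Lemma translate_small (q : nat) : prime_power q -> odd q -> (q < 347 * 100)%N ->
  q \notin [:: 5; 7; 11; 13; 31; 41]%N -> translate_property_Fq q 2 2.
Proof.
move=> [p [k [p_prime k_gt0 qpk]]] q_odd q_lt q_notin F L cardF dimL.
have q_gt1 : (1 < q)%N by rewrite -cardF finNzRing_gt1.
pose Q := N.of_nat q; have QE : N.to_nat Q = q by apply: Nat2N.id.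
have F_odd : odd #|F| by rewrite cardF.
have [j jE] : exists j, q = (3 + 2 * j)%N by exists ((q - 3) %/ 2)%N; lia.
have xE : Q = (3 + 2 * N.of_nat j)%num by rewrite /Q jE; lia.
have j_lt : (N.to_nat (N.of_nat j) < N.to_nat 17349)%N by apply: ltn_to_nat; lia.
have := range_ok_spec small_q_ok xE j_lt.
have -> : candidate Q by apply: (candidate_prime_power p_prime (e := k)); rewrite QE.
rewrite orFb => /orP[|/Nmem_In QP]; first by apply: sieve_ok_sound; rewrite ?QE.
have [Q_certs|] : List.In Q (map cert_q certs) \/ List.In Q excluded_q.
  by elim: (map cert_q certs) QP => [|x s IH] /=; [right|case=> [->|/IH[]]; tauto].
  have [c c_certs cQ] := In_map_inv Q_certs.
  apply: (cert_ok_sound dimL F_odd _ (all_In certs_ok c_certs)).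
  by rewrite cQ QE.
move=> Q_exc; case/negP: q_notin; rewrite -QE.
by move: Q_exc; rewrite /=; do 6?case=> [<- //|].
Qed.

Theorem theorem4 :
  (forall q : nat, prime_power q -> odd q ->
     q \notin [:: 5; 7; 11; 13; 31; 41]%N ->
     translate_property_Fq q 2 2) /\
  is_least_int
    (fun T : int => forall q : nat, prime_power q -> odd q -> T < q%:Z ->
       translate_property_Fq q 2 2)
    41.
Proof.
have main q : prime_power q -> odd q -> q \notin [:: 5; 7; 11; 13; 31; 41]%N ->
    translate_property_Fq q 2 2.
  move=> q_pp q_odd q_notin; have [q_ge|q_lt] := leqP (347 * 100) q.
    by move=> F L cardF dimL; apply: translate_large; rewrite ?cardF.
  exact: translate_small.
split=> //; split=> [q q_pp q_odd q_gt|T T_ok].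
  apply: main => //; rewrite !inE; lia.
(* A smaller bound would admit [q = 41]. *)
rewrite leNgt; apply/negP => T_lt; apply: translate_property41_fails.
by apply: T_ok => //; exists 41%N, 1%N.
Qed.
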